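(* Let $m\in\mathbb{N}$, $m\ge3$. Then there exist $r\in(0,1)$ and a conformally constrained Willmore torus $f\colon\mathbb{T}^2\to\mathbb{S}^3$ which is regularly homotopic to $f_{m,r}\colon\mathbb{R}^2/2\pi\mathbb{Z}^2\to\mathbb{S}^3$, $f_{m,r}(u,v)=f_r(u,mv)$, lies in the same conformal class as $f_{m,r}$, and satisfies $8\pi\le\mathcal{W}(f)<\mathcal{W}(f_{m,r})$.
   Context: $\mathbb{T}^2=\mathbb{R}^2/2\pi\mathbb{Z}^2$. For $r\in(0,1)$, $f_r\colon\mathbb{R}^2/2\pi\mathbb{Z}^2\to\mathbb{S}^3\subset\mathbb{C}^2=\mathbb{R}^4$ is $f_r(u,v)=(re^{iu},\sqrt{1-r^2}\,e^{iv})$. Conformal class: let $\mathcal{M}=\{\vec\omega\in\mathbb{R}^2: 0\le\omega_1\le\frac12,\ |\vec\omega|\ge1,\ \omega_2>0\}$ and $\mathbb{T}_{\vec\omega}=\mathbb{R}^2/(\mathbb{Z}(1,0)+\mathbb{Z}\vec\omega)$ with the flat metric. For a metric $h$ on $\mathbb{T}^2$ there is a unique $\vec\omega=:\mathfrak{c}(h)\in\mathcal{M}$ such that a conformal diffeomorphism $\mathbb{T}_{\vec\omega}\to(\mathbb{T}^2,h)$ exists. The conformal class of an immersion is $\mathfrak{c}$ of its induced metric. Willmore energy: for an immersed torus in $\mathbb{R}^3$, $\mathcal{W}(f)=\int H^2\,\mathrm{d}\mu_f$ with $H=\frac12(\kappa_1+\kappa_2)$. For an immersion into $\mathbb{S}^3$,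 $\mathcal{W}(f)=\int|\vec H|^2\,\mathrm{d}\mu_f$, where $\vec H$ is half the trace of the second fundamental form of $f$ as a surface in $\mathbb{R}^4$; equivalently it is the Willmore energy of $\sigma\circ f$ for a stereographic projection $\sigma$ from a point outside the image of $f$. Conformally constrained Willmore tori in $\mathbb{R}^3$: for an immersion $f\colon\mathbb{T}^2\to\mathbb{R}^3$ with $\vec\omega=\mathfrak{c}(f)$, let $\mathfrak{C}_f(\vec\omega)$ be the set of all $\partial_tF(0,\cdot)$, where $F\colon(-\varepsilon,\varepsilon)\times\mathbb{T}^2\to\mathbb{R}^3$ is a family of immersions such that $F$ and $\partial_tF$ have continuous spatial derivatives of all orders, $F(0,\cdot)=f$ and $\mathfrak{c}(F(t,\cdot))=\vec\omega$ for all $t$. Let $\overline{\mathfrak{C}_f(\vec\omega)}$ be the closure of its linear span in $L^2(\mathrm{d}\mu_f)$. $f$ is a conformally constrained Willmore torus if the $L^2(\mathrm{d}\mu_f)$-orthogonal projection of $\nabla\mathcal{W}(f)=(\Delta H+|A^0|^2H)N$ onto $\overline{\mathfrak{C}_f(\vec\omega)}$ vanishes ($N$ unit normal, $A^0$ trace-free second fundamental form). By conformal invariance, an immersion $f\colon\mathbb{T}^2\to\mathbb{S}^3$ is called a conformally constrained Willmore torus if $\sigma\circ f$ is one, for a stereographic projection $\sigma$ from a point outside the image of $f$. *)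

(* Defs.v *)
From HB Require Import structures.
From mathcomp Require Import all_boot all_order all_algebra.
From mathcomp Require Import all_classical all_reals all_analysis.

Set Implicit Arguments.
Unset Strict Implicit.
Unset Printing Implicit Defensive.

Import Order.TTheory GRing.Theory Num.Theory.
Import numFieldNormedType.Exports.
Local Open Scope classical_set_scope.
Local Open Scope ring_scope.

(* Maps defined on a torus R^2 / L are represented by their L-periodic lifts
   to the plane R * R.  On R * R and 'rV_n the library norm `|_| is a sup
   norm, so Euclidean norms are always written through [dot]. *)

Section PlaneCalculus.
Context {R : realType}.

Definition dir (i : 'I_2) : R * R := if i == 0 then (1, 0) else (0, 1).

Definition pd {V : normedModType R} (i : 'I_2) (f : R * R -> V) : R * R -> V :=
  'D_(dir i) f.

Definition ipd {V : normedModType R} (s : seq 'I_2) (f : R * R -> V) :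
    R * R -> V :=
  foldr (fun i g => pd i g) f s.

Definition smooth {V : normedModType R} (f : R * R -> V) : Prop :=
  forall s : seq 'I_2, continuous (ipd s f) /\
    forall (i : 'I_2) (p : R * R), derivable (ipd s f) p (dir i).

(* F is a family, indexed by t in I, of maps on the plane having spatial
   derivatives of all orders that are jointly continuous on I * (R * R). *)
Definition smooth_family {V : normedModType R} (I : set R)
    (F : R -> R * R -> V) : Prop :=
  (forall t, I t -> smooth (F t)) /\
  forall s : seq 'I_2, {within I `*` [set: R * R],
    continuous (fun x : R * (R * R) => ipd s (F x.1) x.2)}.

Definition dot {n : nat} (u v : 'rV[R]_n) : R := (u *m v^T) 0 0.

Definition lattice (a b : R * R) : set (R * R) :=
  [set p | exists k l : int, p = a *~ k + b *~ l].

Definition lat2pi : set (R * R) := lattice (2 * pi, 0) (0, 2 * pi).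

Definition lattice_periodic {T : Type} (L : set (R * R)) (f : R * R -> T) : Prop :=
  forall p q, L (p - q) -> f p = f q.

Definition jac {n : nat} (f : R * R -> 'rV[R]_n) (p : R * R) : 'M[R]_(2, n) :=
  \matrix_(i < 2) pd i f p.

Definition immersion {n : nat} (f : R * R -> 'rV[R]_n) : Prop :=
  [/\ smooth f, lattice_periodic lat2pi f & forall p, row_free (jac f p)].

Definition immersionS3 (f : R * R -> 'rV[R]_4) : Prop :=
  immersion f /\ forall p, dot (f p) (f p) = 1.

Definition metric {n : nat} (f : R * R -> 'rV[R]_n) (p : R * R) : 'M[R]_2 :=
  jac f p *m (jac f p)^T.

Definition imetric {n : nat} (f : R * R -> 'rV[R]_n) (p : R * R) : 'M[R]_2 :=
  invmx (metric f p).

Definition area {n : nat} (f : R * R -> 'rV[R]_n) (p : R * R) : R :=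
  Num.sqrt (\det (metric f p)).

End PlaneCalculus.

Section ConformalClass.
Context {R : realType}.

Definition moduli : set (R * R) :=
  [set w | [/\ 0 <= w.1 <= 2^-1, 1 <= Num.sqrt (w.1 ^+ 2 + w.2 ^+ 2)
             & 0 < w.2]].

(* The lifts to the plane of smooth maps R^2 / L -> R^2 / L'; every such map
   has a lift since the plane is simply connected. *)
Definition torus_map (L L' : set (R * R)) (phi : R * R -> R * R) : Prop :=
  smooth phi /\ forall p q, L (p - q) -> L' (phi p - phi q).

Definition torus_diffeo (L L' : set (R * R)) (phi : R * R -> R * R) : Prop :=
  torus_map L L' phi /\
  exists2 psi, torus_map L' L psi &
    (forall p, L (psi (phi p) - p)) /\ (forall q, L' (phi (psi q) - q)).

Definition row_of_pair (p : R * R) : 'rV[R]_2 :=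
  \row_j (if j == 0 then p.1 else p.2).

Definition pullback (phi : R * R -> R * R) (h : R * R -> 'M[R]_2)
    (p : R * R) : 'M[R]_2 :=
  jac (row_of_pair \o phi) p *m h (phi p) *m (jac (row_of_pair \o phi) p)^T.

(* w is the conformal class c(h) of the (2pi-periodic) metric h: by
   uniformization exactly one w satisfies this. *)
Definition conf_class (h : R * R -> 'M[R]_2) (w : R * R) : Prop :=
  moduli w /\
  exists2 phi, torus_diffeo (lattice (1, 0) w) lat2pi phi &
    exists rho : R * R -> R,
      forall p, 0 < rho p /\ pullback phi h p = (rho p)%:M.

Definition same_conf_class {n k : nat} (f : R * R -> 'rV[R]_n)
    (g : R * R -> 'rV[R]_k) : Prop :=
  exists w, conf_class (metric f) w /\ conf_class (metric g) w.

End ConformalClass.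

Section Willmore.
Context {R : realType}.

Definition cell : set (R * R) := `[0, 2 * pi[ `*` `[0, 2 * pi[.

(* integral of u over the torus with respect to the area measure of f *)
Definition surf_int {n : nat} (f : R * R -> 'rV[R]_n) (u : R * R -> R) : \bar R :=
  (\int[@lebesgue_measure R \x @lebesgue_measure R]_(p in cell)
     (u p * area f p)%:E)%E.

Definition normal_part {n : nat} (f : R * R -> 'rV[R]_n) (p : R * R)
    (x : 'rV[R]_n) : 'rV[R]_n :=
  x - x *m (jac f p)^T *m imetric f p *m jac f p.

Definition mean_curv_vec {n : nat} (f : R * R -> 'rV[R]_n) (p : R * R) :
    'rV[R]_n :=
  2^-1 *: \sum_i \sum_j
    imetric f p i j *: normal_part f p (pd i (pd j f) p).

Definition willmore {n : nat} (f : R * R -> 'rV[R]_n) : \bar R :=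
  surf_int f (fun p => dot (mean_curv_vec f p) (mean_curv_vec f p)).

Definition cross (u v : 'rV[R]_3) : 'rV[R]_3 :=
  \row_k \det (\matrix_(i < 3) [:: delta_mx 0 k; u; v]`_i).

Section SurfacesInSpace.
Variable f : R * R -> 'rV[R]_3.

Definition normal (p : R * R) : 'rV[R]_3 :=
  let c := cross (pd 0 f p) (pd 1 f p) in (Num.sqrt (dot c c))^-1 *: c.

Definition sff (p : R * R) : 'M[R]_2 :=
  \matrix_(i, j) dot (pd i (pd j f) p) (normal p).

(* the principal curvatures are the eigenvalues of g^-1 A *)
Definition mean_curv (p : R * R) : R := 2^-1 * \tr (imetric f p *m sff p).

Definition sff0 (p : R * R) : 'M[R]_2 := sff p - mean_curv p *: metric f p.

Definition sff0_sqnorm (p : R * R) : R :=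
  \tr (imetric f p *m sff0 p *m imetric f p *m sff0 p).

Definition laplacian (u : R * R -> R^o) (p : R * R) : R :=
  (area f p)^-1 * \sum_i \sum_j
    pd i (fun q => area f q * imetric f q i j * pd j u q : R^o) p.

Definition grad_willmore (p : R * R) : 'rV[R]_3 :=
  (laplacian mean_curv p + sff0_sqnorm p * mean_curv p) *: normal p.

(* Elements of L^2(d mu_f) are represented by functions on the plane of which
   only the restriction to [cell] matters. *)
Definition L2 : set (R * R -> 'rV[R]_3) :=
  [set V : R * R -> 'rV[R]_3 | (forall j, measurable_fun cell (fun p => V p 0 j)) /\
           (surf_int f (fun p => dot (V p) (V p)) < +oo)%E].

Definition L2_inner (V W : R * R -> 'rV[R]_3) : \bar R :=
  surf_int f (fun p => dot (V p) (W p)).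

Definition lin_span (C : set (R * R -> 'rV[R]_3)) : set (R * R -> 'rV[R]_3) :=
  [set S | exists (k : nat) (c : 'I_k -> R) (V : 'I_k -> R * R -> 'rV[R]_3),
     (forall i, C (V i)) /\ S = (fun p => \sum_i c i *: V i p)].

Definition L2_closure (C : set (R * R -> 'rV[R]_3)) : set (R * R -> 'rV[R]_3) :=
  [set V | L2 V /\ forall e : R, 0 < e ->
     exists2 S, C S & (L2_inner (V \- S)%R (V \- S)%R < (e ^+ 2)%:E)%E].

(* P is (a representative of) the orthogonal projection of V onto K *)
Definition L2_proj (K : set (R * R -> 'rV[R]_3)) (V P : R * R -> 'rV[R]_3) :
    Prop :=
  K P /\ forall X, K X -> L2_inner (V \- P) X = 0%E.

Definition conf_variation (w : R * R) : set (R * R -> 'rV[R]_3) :=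
  [set V | exists (e : R) (F : R -> R * R -> 'rV[R]_3),
     let Ft := fun t p => derive1 (F ^~ p) t in
     [/\ 0 < e,
         forall t, t \in `]-e, e[ ->
           [/\ immersion (F t), conf_class (metric (F t)) w
             & forall p, derivable (F ^~ p) t 1],
         smooth_family `]-e, e[ F /\ smooth_family `]-e, e[ Ft,
         F 0 = f
       & V = Ft 0]].

Definition conf_willmore : Prop :=
  immersion f /\
  exists2 w, conf_class (metric f) w &
    L2_proj (L2_closure (lin_span (conf_variation w))) grad_willmore
            (fun=> 0).

End SurfacesInSpace.

(* Stereographic projection from the point P of S^3 onto its orthogonal
   complement, identified with R^3 by the orthonormal basis given by the rows
   of B. *)
Definition stereo (P : 'rV[R]_4) (B : 'M[R]_(3, 4)) (x : 'rV[R]_4) : 'rV[R]_3 :=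
  (1 - dot x P)^-1 *: (x *m B^T).

Definition conf_willmoreS3 (f : R * R -> 'rV[R]_4) : Prop :=
  immersionS3 f /\
  exists (P : 'rV[R]_4) (B : 'M[R]_(3, 4)),
    [/\ dot P P = 1, B *m B^T = 1%:M, B *m P^T = 0, forall p, f p <> P
      & conf_willmore (stereo P B \o f)].

Definition reg_homotopicS3 (f g : R * R -> 'rV[R]_4) : Prop :=
  exists F : R -> R * R -> 'rV[R]_4,
    [/\ smooth_family `[0, 1] F, forall t, t \in `[0, 1] -> immersionS3 (F t),
        F 0 = f & F 1 = g].

(* C^2 is identified with R^4 by (z, w) |-> (Re z, Im z, Re w, Im w) *)
Definition torus_r (r : R) (p : R * R) : 'rV[R]_4 :=
  \row_(j < 4) [:: r * cos p.1; r * sin p.1;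
                   Num.sqrt (1 - r ^+ 2) * cos p.2;
                   Num.sqrt (1 - r ^+ 2) * sin p.2]`_j.

Definition torus_mr (m : nat) (r : R) (p : R * R) : 'rV[R]_4 :=
  torus_r r (p.1, m%:R * p.2).

End Willmore.

(* Main.v *)
(* For r = 1 / sqrt (1 + m^2) the torus f_{m,r} lies in the class (0, m^2) and
   has Willmore energy pi^2 (m^2 + 1).  The competitor is the homogeneous torus
   f(u, v) = (s e^{iv}, - sg e^{i(u + (m - 1)v)}) with s = m^2 sg: it lies in the
   same class and has Willmore energy pi^2 (m^2 + m^-2).

   The two tori bound tubes around the curves v |-> (S e^{iv}, c e^{imv}) with
   (S, c) = (1, 0) and (0, 1) respectively; rotating (S, c) while adapting the
   radius of the tube is a regular homotopy.  The shear u + (m - 1)v is the twist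
   of the tube which makes the end points match.

   f is critical because the Willmore gradient of its stereographic image pairs
   with every variation as a multiple of the first variation of the energy
   int g_00 / sqrt (det g).  By the length-area method this energy is at least
   (2 pi)^2 / c on the whole conformal class (0, c), with equality for f, so its
   first variation vanishes on all conformal variations, and no infinitesimal
   description of the conformal constraint is needed. *)

Require Import Defs.
From mathcomp Require Import all_boot all_order all_algebra.
From mathcomp Require Import all_classical all_reals all_analysis.
From mathcomp Require Import measurable_realfun.
From mathcomp Require Import ring lra.

Import Order.TTheory GRing.Theory Num.Theory.
Import numFieldNormedType.Exports.
Local Open Scope classical_set_scope.
Local Open Scope ring_scope.

(** For radii (r, rho) with c = m rho / r >= 1, the torus f_{m,r} lies in the class (0, c) and has
    Willmore energy pi^2 (c + m^2 / c), against pi^2 (c + 1 / c) for the homogeneous torus with s =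
    c sg. The gap is therefore there for all such r. The choice rho = m r, that is c = m^2, keeps
    the ratio q / p of the tubes between 1 / m^2 and 1 / m, far enough from the focal set for the
    homotopy to stay immersed.

    The functional int g_00 / sqrt (det g) suits the problem because in fixed coordinates its
    integrand depends only on the conformal class of the metric. The Lagrange multiplier of the
    constrained Willmore equation is a holomorphic quadratic differential, a constant one on a flat
    torus, and the differential of this functional at f supplies it up to a factor.

    The obstacle is that the conformal coordinates of a family F come from an existence statement,
    with no regularity in t. Minimality avoids it: the bound holds for each t separately, and t = 0
    is an interior minimum. Sharpness of the bound rests on (1, 0) being a shortest nonzero vector
    of the lattice spanned by (1, 0) and (0, c), which is where c >= 1 enters. *)

(** * Calculus of partial derivatives in the plane *)

Section PartialDerivatives.
Context {R : realType}.
Implicit Types (f g : R * R -> R) (p q : R * R) (i : 'I_2) (s : seq 'I_2).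

(** Directional derivatives are transported to the restriction to a line, so that one-variable
    calculus (chain rule, mean value, fundamental theorem) applies to them. *)
Lemma is_derive_line {V W : normedModType R} (f : V -> W) (p v : V) (h : R) df :
  is_derive (h *: v + p) v f df ->
  is_derive h (1 : R) (fun t : R => f (t *: v + p)) df.
Proof.
have E : (fun t : R => t^-1 *: (f (t *: v + (h *: v + p)) - f (h *: v + p))) =
         (fun t : R => t^-1 *: (f ((t *: (1 : R) + h) *: v + p) - f (h *: v + p))).
  by apply/funext => t; rewrite scalerDl addrA [t *: 1]mulr1.
by move=> [d1 d2]; split; move: d1 d2; rewrite /derivable /derive /= E.
Qed.

Lemma is_derive_of_line {V W : normedModType R} (f : V -> W) (p v : V) df :
  is_derive (0 : R) (1 : R) (fun t : R => f (t *: v + p)) df -> is_derive p v f df.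
Proof.
have E : (fun t : R => t^-1 *: (f (t *: v + p) - f p)) =
         (fun t : R => t^-1 *: (f ((t *: (1 : R) + 0) *: v + p) - f (0 *: v + p))).
  by apply/funext => t; rewrite addr0 [t *: 1]mulr1 scale0r add0r.
by move=> [d1 d2]; split; move: d1 d2; rewrite /derivable /derive /= -E.
Qed.

(** Existence and value in one relation: derivatives of composite expressions are built by applying
    the rules below backwards, then matched to a chosen closed form with [pder_eq]. *)
Definition pder (i : 'I_2) (f f' : R * R -> R) : Prop :=
  forall p, is_derive p (dir i) f (f' p).

Lemma pder_pd i f f' : pder i f f' -> pd i f = f'.
Proof. by move=> H; apply/funext => p; by case: (H p). Qed.

Lemma pder_derivable i f f' p : pder i f f' -> derivable f p (dir i).
Proof. by move=> H; by case: (H p). Qed.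

Lemma pderP i f : (forall p, derivable f p (dir i)) -> pder i f (pd i f).
Proof. by move=> H p; exact: derivableP. Qed.

Lemma pder_eq i f f' f'' : pder i f f' -> f' =1 f'' -> pder i f f''.
Proof. by move=> H E p; rewrite -E. Qed.

Lemma pder_cst i (c : R) : pder i (fun=> c) (fun=> 0).
Proof. by move=> p; exact: is_derive_cst. Qed.

Lemma pderD i f f' g g' : pder i f f' -> pder i g g' ->
  pder i (fun p => f p + g p) (fun p => f' p + g' p).
Proof. by move=> Hf Hg p; exact: is_deriveD. Qed.

Lemma pderN i f f' : pder i f f' -> pder i (fun p => - f p) (fun p => - f' p).
Proof. by move=> Hf p; exact: is_deriveN. Qed.

Lemma pderM i f f' g g' : pder i f f' -> pder i g g' ->
  pder i (fun p => f p * g p) (fun p => f' p * g p + f p * g' p).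
Proof.
move=> Hf Hg p; have H := is_deriveM (Hf p) (Hg p).
by apply: (is_derive_eq H); rewrite /GRing.scale/= addrC mulrC.
Qed.

Lemma pderV i f f' : (forall p, f p != 0) -> pder i f f' ->
  pder i (fun p => (f p)^-1) (fun p => - f' p * (f p)^-1 * (f p)^-1).
Proof.
move=> n0 Hf p; have [d1 d2] := Hf p; split; first exact: derivableV.
rewrite deriveV // d2 /GRing.scale/= expr2 invfM; ring.
Qed.

Lemma pder_comp i f f' (g g' : R -> R) :
  (forall x, is_derive x (1 : R) g (g' x)) -> pder i f f' ->
  pder i (fun p => g (f p)) (fun p => g' (f p) * f' p).
Proof.
move=> Hg Hf p; apply: is_derive_of_line.
have Hf0 : is_derive (0 : R) (1 : R) (fun t : R => f (t *: dir i + p)) (f' p).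
  by apply: is_derive_line; rewrite scale0r add0r.
have Hg0 : is_derive (f (0 *: dir i + p)) (1 : R) g (g' (f p)).
  by rewrite scale0r add0r.
exact: (is_derive1_comp Hg0 Hf0).
Qed.

Lemma pder_cos i f f' : pder i f f' ->
  pder i (fun p => cos (f p)) (fun p => - sin (f p) * f' p).
Proof. by apply: pder_comp => x; exact: is_derive_cos. Qed.

Lemma pder_sin i f f' : pder i f f' ->
  pder i (fun p => sin (f p)) (fun p => cos (f p) * f' p).
Proof. by apply: pder_comp => x; exact: is_derive_sin. Qed.

Lemma pder_lin i (a b : R) :
  pder i (fun p => a * p.1 + b * p.2) (fun=> if i == 0 then a else b).
Proof.
move=> p; apply: is_derive_of_line.
set K := (if _ then _ else _).
have -> : (fun t : R => a * (t *: dir i + p).1 + b * (t *: dir i + p).2) =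
  cst (a * p.1 + b * p.2) + (K \*: (id : R -> R)).
  apply/funext => t /=; rewrite /K /dir /cst; case: (i == 0) => /=;
  rewrite -[RHS]/(_ + _ * _) /GRing.scale/= /GRing.scale/=; ring.
have H := is_deriveD (is_derive_cst (a * p.1 + b * p.2) (0 : R) (1 : R))
  (is_deriveZ K (is_derive_id (0 : R) (1 : R))).
by apply: (is_derive_eq H); rewrite add0r /GRing.scale/= mulr1.
Qed.

Lemma pder_fst i : pder i (fun p => p.1) (fun=> (i == 0)%:R).
Proof.
have := pder_lin i 1 0; rewrite (_ : (fun _ => _) = (fun p => p.1)); last first.
  by apply/funext => p; rewrite mul1r mul0r addr0.
by case: (i == 0).
Qed.

Lemma pder_snd i : pder i (fun p => p.2) (fun=> (i != 0)%:R).
Proof.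
have := pder_lin i 0 1; rewrite (_ : (fun _ => _) = (fun p => p.2)); last first.
  by apply/funext => p; rewrite mul1r mul0r add0r.
by case: (i == 0).
Qed.

End PartialDerivatives.

(** * Mean values, chain rule and symmetry of mixed derivatives *)

Section PlaneContinuity.
Context {R : realType}.
Implicit Types (f g : R * R -> R) (p q : R * R) (i : 'I_2).

Lemma plane_cvgP f p : f x @[x --> p] --> f p <->
  forall e : R, 0 < e -> exists2 d : R, 0 < d &
    forall q, `|q.1 - p.1| < d -> `|q.2 - p.2| < d -> `|f q - f p| < e.
Proof.
split=> [/cvgrPdist_lt H e e0|H].
  have /nbhs_ballP[d /= d0 dH] := H e e0; exists d => // q q1 q2.
  by rewrite distrC; apply: dH; split; rewrite /ball /= distrC.
apply/cvgrPdist_lt => e e0; have [d d0 dH] := H e e0.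
apply/(nbhs_ballP p); exists d => //= q [q1 q2]; rewrite distrC; apply: dH.
  by rewrite distrC.
by rewrite distrC.
Qed.

(** The increment [h] may have either sign, hence the location of [c] by a bound on its distance to
    [x0] instead of an interval. *)
Lemma derive_mvt (g dg : R -> R) (x0 h : R) :
  (forall x, `|x - x0| <= `|h| -> is_derive x (1 : R) g (dg x)) ->
  exists2 c, `|c - x0| <= `|h| & g (x0 + h) - g x0 = dg c * h.
Proof.
move=> H.
have cont a b : a <= b -> (forall x, a <= x <= b -> `|x - x0| <= `|h|) ->
    exists2 c, c \in `[a, b] & g b - g a = dg c * (b - a).
  move=> ab xab; apply: (@MVT_segment _ g dg a b ab).
    by move=> x; rewrite in_itv/= => /andP[/ltW ax /ltW xb]; apply/H/xab/andP.
  apply: derivable_within_continuous => x; rewrite in_itv/= => xI.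
  by case: (H x (xab _ xI)).
have [h0|h0] := leP 0 h.
  have [||c] := cont x0 (x0 + h).
  - by rewrite lerDl.
  - by move=> x xI; rewrite !ger0_norm ?subr_ge0 //; move: xI; lra.
  rewrite in_itv/= => cI ->; exists c; last by rewrite addrAC subrr add0r.
  by rewrite !ger0_norm ?subr_ge0 //; move: cI; lra.
have [||c] := cont (x0 + h) x0.
- by rewrite gerDl ltW.
- by move=> x xI; rewrite (ltr0_norm h0) ler0_norm ?subr_le0 //; move: xI; lra.
rewrite in_itv/= => cI E; exists c; last by rewrite -opprB E opprD addrA subrr; ring.
by rewrite (ltr0_norm h0) ler0_norm ?subr_le0 //; move: cI; lra.
Qed.

Lemma scale_dir0 (h : R) p : h *: dir 0 + p = (h + p.1, p.2).
Proof.
by case: p => a b; congr pair; rewrite /dir/= /GRing.scale/= ?mulr1// mulr0 add0r.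
Qed.

Lemma scale_dir1 (h : R) p : h *: dir 1 + p = (p.1, h + p.2).
Proof.
by case: p => a b; congr pair; rewrite /dir/= /GRing.scale/= ?mulr1// mulr0 add0r.
Qed.

Lemma pd_mvt i f p h : (forall q, derivable f q (dir i)) ->
  exists2 c, `|c| <= `|h| &
    f (h *: dir i + p) - f p = pd i f (c *: dir i + p) * h.
Proof.
move=> df.
have [|c cI] := @derive_mvt (fun t => f (t *: dir i + p))
  (fun t => pd i f (t *: dir i + p)) 0 h.
  by move=> x _; apply: is_derive_line; exact: derivableP.
by rewrite add0r scale0r add0r => E; exists c; rewrite ?subr0// in cI *.
Qed.

(* Hadamard/Caratheodory form of differentiability of a C^1 function: it
   reduces the chain rule to the algebra of limits. *)
Lemma C1_factor f p :
  (forall i q, derivable f q (dir i)) ->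
  (forall i, pd i f x @[x --> p] --> pd i f p) ->
  exists A B : R * R -> R,
    [/\ forall q, f q = f p + (q.1 - p.1) * A q + (q.2 - p.2) * B q,
        A x @[x --> p] --> A p, B x @[x --> p] --> B p,
        A p = pd 0 f p & B p = pd 1 f p].
Proof.
move=> df cf.
(* The increment of [f] is split along the path from [p] to [(p.1, q.2)] to [q]; [A] and [B] are the
   two difference quotients, completed by the partial derivatives at [p]. Mean values give their
   continuity at [p]. *)
pose A q := if q.1 == p.1 then pd 0 f p
            else (f q - f (p.1, q.2)) / (q.1 - p.1).
pose B q := if q.2 == p.2 then pd 1 f p
            else (f (p.1, q.2) - f p) / (q.2 - p.2).
exists A, B; split=> //; last 2 first.
- by rewrite /A eqxx.
- by rewrite /B eqxx.
- rewrite /A /B => q; have [e1|n1] := eqVneq q.1 p.1; have [e2|n2] := eqVneq q.2 p.2.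
  + rewrite e1 e2 !subrr !mul0r !addr0; congr f.
    by case: q p e1 e2 {df cf A B} => [? ?] [? ?] /= -> ->.
  + rewrite -e1 subrr mul0r addr0 mulrCA divff ?subr_eq0// mulr1.
    by rewrite -surjective_pairing; ring.
  + rewrite e2 subrr mul0r addr0 mulrCA divff ?subr_eq0// mulr1.
    by rewrite -surjective_pairing; ring.
  + rewrite mulrCA divff ?subr_eq0// mulr1.
    by rewrite [X in _ + X]mulrCA divff ?subr_eq0// mulr1; ring.
- apply/plane_cvgP => e e0.
  have /plane_cvgP/(_ _ e0)[d d0 dH] := cf 0; exists d => // q q1 q2.
  rewrite /A eqxx; have [e1|n1] := eqVneq q.1 p.1; first by rewrite subrr normr0.
  have [c cI] := @pd_mvt 0 f (p.1, q.2) (q.1 - p.1) (df 0).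
  rewrite !scale_dir0 /= subrK -surjective_pairing.
  move=> ->; rewrite mulfK ?subr_eq0//; apply: dH => /=.
    by rewrite addrK (le_lt_trans cI).
  by [].
- apply/plane_cvgP => e e0.
  have /plane_cvgP/(_ _ e0)[d d0 dH] := cf 1; exists d => // q q1 q2.
  rewrite /B eqxx; have [e1|n1] := eqVneq q.2 p.2; first by rewrite subrr normr0.
  have [c cI] := @pd_mvt 1 f p (q.2 - p.2) (df 1).
  rewrite !scale_dir1 /= subrK.
  move=> ->; rewrite mulfK ?subr_eq0//; apply: dH => /=.
    by rewrite subrr normr0.
  by rewrite addrK (le_lt_trans cI).
Qed.

Lemma is_derive_cvgP (g : R -> R) (x dg : R) :
  is_derive x (1 : R) g dg <->
  (h^-1 * (g (x + h) - g x)) @[h --> 0^'] --> dg.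
Proof.
have E : (fun h : R => h^-1 *: (g (h *: (1 : R) + x) - g x)) =
         (fun h : R => h^-1 * (g (x + h) - g x)).
  by apply/funext => h; rewrite [h *: 1]mulr1 [h + x]addrC.
split=> [[d1 <-]|H].
  by move: d1; rewrite /derivable /derive /= E.
split; first by apply/cvg_ex; exists dg; rewrite /= E.
by rewrite /derive/= E; apply/cvg_lim.
Qed.

Lemma chain_rule_line f (a b : R -> R) (x a' b' : R) :
  (forall i q, derivable f q (dir i)) ->
  (forall i, pd i f y @[y --> (a x, b x)] --> pd i f (a x, b x)) ->
  is_derive x (1 : R) a a' -> is_derive x (1 : R) b b' ->
  is_derive x (1 : R) (fun t => f (a t, b t))
    (pd 0 f (a x, b x) * a' + pd 1 f (a x, b x) * b').
Proof.
move=> df cf da db.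
have [A [B [E cA cB A0 B0]]] := C1_factor _ _ df cf.
have ca : a t @[t --> x] --> a x.
  by apply/differentiable_continuous/derivable1_diffP; case: da.
have cb : b t @[t --> x] --> b x.
  by apply/differentiable_continuous/derivable1_diffP; case: db.
have shx : (x + h) @[h --> 0^'] --> x.
  apply/cvgrPdist_lt => e e0; apply/nbhs_ballP; exists e => //= h.
  by rewrite /ball/= sub0r normrN opprD addrA subrr sub0r normrN.
have cab : (a (x + h), b (x + h)) @[h --> 0^'] --> (a x, b x).
  exact: (cvg_pair (cvg_comp _ _ shx ca) (cvg_comp _ _ shx cb)).
apply/is_derive_cvgP.
have -> : (fun h : R => h^-1 * (f (a (x + h), b (x + h)) - f (a x, b x))) =
  (fun h => A (a (x + h), b (x + h)) * (h^-1 * (a (x + h) - a x)) +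
            B (a (x + h), b (x + h)) * (h^-1 * (b (x + h) - b x))).
  by apply/funext => h; rewrite E /=; ring.
rewrite -A0 -B0; apply: cvgD; apply: cvgM.
- exact: (cvg_comp _ _ cab cA).
- exact/is_derive_cvgP.
- exact: (cvg_comp _ _ cab cB).
- exact/is_derive_cvgP.
Qed.

Lemma pder_comp2 i f (a b a' b' : R * R -> R) :
  (forall j q, derivable f q (dir j)) -> (forall j, continuous (pd j f)) ->
  pder i a a' -> pder i b b' ->
  pder i (fun p => f (a p, b p))
         (fun p => pd 0 f (a p, b p) * a' p + pd 1 f (a p, b p) * b' p).
Proof.
move=> df cf da db p; apply: is_derive_of_line.
have E0 : 0 *: dir i + p = p by rewrite scale0r add0r.
have da0 : is_derive (0 : R) (1 : R) (fun t : R => a (t *: dir i + p)) (a' p).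
  by apply: is_derive_line; rewrite E0.
have db0 : is_derive (0 : R) (1 : R) (fun t : R => b (t *: dir i + p)) (b' p).
  by apply: is_derive_line; rewrite E0.
have := @chain_rule_line f _ _ 0 _ _ df _ da0 db0.
by rewrite E0; apply => j; exact: cf.
Qed.

(* Only one of the two mixed derivatives is assumed to exist. *)
Lemma schwarz (G Gx Gxy : R -> R -> R) (Gy : R -> R) (x0 d L : R) : 0 < d ->
  (forall x y, `|x - x0| < d -> `|y| < d ->
     is_derive x (1 : R) (G ^~ y) (Gx x y)) ->
  (forall x, `|x - x0| < d -> is_derive (0 : R) (1 : R) (G x) (Gy x)) ->
  (forall x y, `|x - x0| < d -> `|y| < d ->
     is_derive y (1 : R) (Gx x) (Gxy x y)) ->
  (forall e, 0 < e -> exists2 d', 0 < d' &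
     forall x y, `|x - x0| < d' -> `|y| < d' -> `|Gxy x y - L| <= e) ->
  is_derive x0 (1 : R) Gy L.
Proof.
move=> d0 HGx HGy HGxy HL; apply/is_derive_cvgP/cvgrPdist_le => e e0.
have [d' d'0 dL] := HL e e0.
pose m := Num.min d d'.
have m0 : 0 < m by rewrite lt_min d0.
apply/nbhs_ballP; exists m => //= h; rewrite /ball/= sub0r normrN => hm h0.
have [hd hd'] : `|h| < d /\ `|h| < d' by apply/andP; rewrite -lt_min.
(* Second difference over the rectangle with sides [h] and [k], divided by [k]. Two mean values turn
   [h^-1 * D k] into [Gxy] at a nearby point; letting [k] tend to 0 at fixed [h] bounds the
   difference quotient of [Gy]. *)
pose D k := k^-1 * (G (x0 + h) (0 + k) - G (x0 + h) 0) -
            k^-1 * (G x0 (0 + k) - G x0 0).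
have Dk : D k @[k --> 0^'] --> Gy (x0 + h) - Gy x0.
  apply: cvgB; apply/is_derive_cvgP; apply: HGy.
    by rewrite addrC addKr.
  by rewrite subrr normr0.
have bnd : \forall k \near 0^', `|h^-1 * D k - L| <= e.
  apply/nbhs_ballP; exists m => //= k; rewrite /ball/= sub0r normrN => km k0.
  have [kd kd'] : `|k| < d /\ `|k| < d' by apply/andP; rewrite -lt_min.
  have [|c cI Ec] := @derive_mvt (fun x => G x k - G x 0)
      (fun x => Gx x k - Gx x 0) x0 h.
    move=> x xh; have xd := le_lt_trans xh hd.
    by apply: is_deriveB; apply: HGx; rewrite ?normr0.
  have cd := le_lt_trans cI hd.
  have [|c2 cI2 Ec2] := @derive_mvt (Gx c) (Gxy c) 0 k.
    by move=> y; rewrite subr0 => yk; apply: HGxy => //; exact: le_lt_trans yk kd.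
  have -> : h^-1 * D k = Gxy c c2.
    rewrite /D add0r; rewrite add0r in Ec2.
    transitivity (h^-1 * k^-1 * ((G (x0 + h) k - G (x0 + h) 0) - (G x0 k - G x0 0))).
      by ring.
    by rewrite Ec Ec2; field; rewrite k0.
  apply: dL; first exact: le_lt_trans cI hd'.
  by rewrite subr0 in cI2; exact: le_lt_trans cI2 kd'.
have cl : `|h^-1 * D k - L| @[k --> 0^'] --> `|h^-1 * (Gy (x0 + h) - Gy x0) - L|.
  apply: cvg_norm; apply: cvgB; last exact: cvg_cst.
  by apply: cvgM => //; exact: cvg_cst.
rewrite distrC.
exact: (cvgr_to_le cl bnd).
Qed.

Lemma pd_comm f : (forall i q, derivable f q (dir i)) ->
  (forall q, derivable (pd 0 f) q (dir 1)) ->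
  continuous (pd 1 (pd 0 f)) -> pd 0 (pd 1 f) = pd 1 (pd 0 f).
Proof.
move=> df df01 cf; apply: pder_pd => p; apply: is_derive_of_line.
have E x y : x *: dir 0 + (y *: dir 1 + p) = y *: dir 1 + (x *: dir 0 + p).
  by rewrite addrCA.
refine (@schwarz (fun x y => f (y *: dir 1 + (x *: dir 0 + p)))
  (fun x y => pd 0 f (y *: dir 1 + (x *: dir 0 + p)))
  (fun x y => pd 1 (pd 0 f) (y *: dir 1 + (x *: dir 0 + p)))
  (fun x => pd 1 f (x *: dir 0 + p)) 0 1 _ ltr01 _ _ _ _).
- move=> x y _ _.
  rewrite (_ : (fun _ => _) = (fun t : R => f (t *: dir 0 + (y *: dir 1 + p)))).
    by apply: is_derive_line; rewrite E; exact: derivableP.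
  by apply/funext => t; rewrite E.
- by move=> x _; apply: is_derive_line; rewrite scale0r add0r; exact: derivableP.
- by move=> x y _ _; apply: is_derive_line; exact: derivableP.
- move=> e e0; have /plane_cvgP/(_ _ e0)[d d0 dH] := cf p.
  by exists d => // x y; rewrite subr0 scale_dir0 scale_dir1 => xd yd;
    apply/ltW/dH; rewrite /= addrK.
Qed.

End PlaneContinuity.

(** * Smooth maps and smooth families: coordinates and trigonometric expressions *)

Section SmoothMaps.
Context {R : realType}.
Implicit Types (p q : R * R) (i : 'I_2) (s : seq 'I_2).

Section LinearImage.
Context {V W : normedModType R}.
Variable l : V -> W.
Hypothesis lB : forall x y, l (x - y) = l x - l y.
Hypothesis lZ : forall (a : R) x, l (a *: x) = a *: l x.
Hypothesis cl : continuous l.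

(** A continuous linear map passes through the difference quotient and its limit. The main use is
    with the coordinates of row vectors and of pairs. *)
Lemma is_derive_lin {U : normedModType R} (f : U -> V) (x v : U) df :
  is_derive x v f df -> is_derive x v (l \o f) (l df).
Proof.
move=> [d1 <-].
have H : h^-1 *: ((l \o f) (h *: v + x) - (l \o f) x) @[h --> 0^'] --> l ('D_v f x).
  rewrite (_ : (fun h : R => _) = l \o (fun h : R => h^-1 *: (f (h *: v + x) - f x))).
    exact: (cvg_comp _ _ d1 (cl _)).
  by apply/funext => h /=; rewrite lZ lB.
by split; [apply/cvg_ex; exists (l ('D_v f x))|apply/cvg_lim].
Qed.

Lemma ipd_lin (f : R * R -> V) s : smooth f -> ipd s (l \o f) = l \o ipd s f.
Proof.
move=> sf; elim: s => //= i s ->; apply/funext => p.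
have [_ /(_ i p) /derivableP] := sf s.
by move=> /is_derive_lin; case.
Qed.

Lemma smooth_lin (f : R * R -> V) : smooth f -> smooth (l \o f).
Proof.
move=> sf s; rewrite ipd_lin//; have [c d] := sf s; split.
  by move=> p; apply: (cvg_comp _ _ (c p)); exact: cl.
by move=> i p; have /derivableP/is_derive_lin := d i p; case.
Qed.

Lemma smooth_family_lin (I : set R) (F : R -> R * R -> V) :
  smooth_family I F -> smooth_family I (fun t => l \o F t).
Proof.
move=> [sF cF]; split=> [t It|s]; first exact/smooth_lin/sF.
apply: (@subspace_eq_continuous _ _ _ (l \o (fun x => ipd s (F x.1) x.2))).
  by move=> x; rewrite inE => -[I1 _]; exact: (esym (congr1 (@^~ x.2) (ipd_lin _ s (sF _ I1)))).
by move=> x; apply: (cvg_comp _ _ (cF s x)); exact: cl.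
Qed.

End LinearImage.

Lemma smooth_coord n (f : R * R -> 'rV[R]_n) j :
  smooth f -> smooth (fun p => f p 0 j).
Proof.
apply: (@smooth_lin _ _ (fun M : 'rV[R]_n => M 0 j)).
- by move=> x y; rewrite !mxE.
- by move=> a x; rewrite !mxE.
- exact: coord_continuous.
Qed.

Lemma ipd_coord n (f : R * R -> 'rV[R]_n) j s p : smooth f ->
  ipd s f p 0 j = ipd s (fun q => f q 0 j) p.
Proof.
move=> sf; rewrite (@ipd_lin _ _ (fun M : 'rV[R]_n => M 0 j))//.
- by move=> x y; rewrite !mxE.
- by move=> a x; rewrite !mxE.
- exact: coord_continuous.
Qed.

Lemma smooth_family_coord (I : set R) n (F : R -> R * R -> 'rV[R]_n) j :
  smooth_family I F -> smooth_family I (fun t p => F t p 0 j).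
Proof.
apply: (@smooth_family_lin _ _ (fun M : 'rV[R]_n => M 0 j)).
- by move=> x y; rewrite !mxE.
- by move=> a x; rewrite !mxE.
- exact: coord_continuous.
Qed.

Lemma smooth_fst (f : R * R -> R * R) : smooth f -> smooth (fun p => (f p).1).
Proof.
by apply: (@smooth_lin _ _ (fun x : R * R => x.1)) => // x; exact: cvg_fst.
Qed.

Lemma smooth_snd (f : R * R -> R * R) : smooth f -> smooth (fun p => (f p).2).
Proof.
by apply: (@smooth_lin _ _ (fun x : R * R => x.2)) => // x; exact: cvg_snd.
Qed.

Lemma rV_cvg {T : Type} n (F : set_system T) {FF : Filter F} (f : T -> 'rV[R]_n)
    (l : 'rV[R]_n) :
  (forall j, f x 0 j @[x --> F] --> l 0 j) -> f x @[x --> F] --> l.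
Proof.
move=> H; apply/cvgrPdist_le => e e0.
have : \forall x \near F, forall j, `|l 0 j - f x 0 j| <= e.
  by apply: filter_forall => j; exact: ((cvgrPdist_le _ _).1 (H j)).
apply: filterS => x Hx; rewrite [leLHS]/Num.Def.normr/= mx_normrE.
by rewrite (bigmax_le _ (ltW e0))//= => -[i j] _; rewrite !mxE (ord1 i).
Qed.

Lemma smooth_row n (f : R * R -> 'rV[R]_n) :
  (forall j, smooth (fun p => f p 0 j)) -> smooth f.
Proof.
move=> sf.
have E s : ipd s f = (fun p => \row_j ipd s (fun q => f q 0 j) p).
  elim: s => [|i s IH]; first by apply/funext => p; apply/rowP => j; rewrite mxE.
  rewrite /= IH; apply/funext => p; rewrite /pd derive_mx; last first.
    apply/derivable_mxP => a j.
    rewrite (_ : (fun _ => _) = ipd s (fun q => f q 0 j)).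
      by have [_] := sf j s; exact.
    by apply/funext => q; rewrite mxE.
  apply/rowP => j; rewrite !mxE; congr (derive _ _ _).
  by apply/funext => q; rewrite mxE.
have Ej s j (a : 'I_1) : (fun p => (\row_j ipd s (fun q => f q 0 j) p) a j) =
    ipd s (fun q => f q 0 j).
  by apply/funext => q; rewrite mxE.
move=> s; rewrite E; split.
  move=> p; apply: rV_cvg => j; have [/(_ p) cj _] := sf j s.
  by rewrite [X in _ --> X]mxE Ej.
by move=> i p; apply/derivable_mxP => a j; rewrite Ej; have [_] := sf j s; exact.
Qed.

Lemma smooth_family_row (I : set R) n (F : R -> R * R -> 'rV[R]_n) :
  (forall j, smooth_family I (fun t p => F t p 0 j)) -> smooth_family I F.
Proof.
move=> sF.
have s1 t : I t -> smooth (F t) by move=> It; apply: smooth_row => j; case: (sF j) => + _; exact.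
split=> // s x; apply: rV_cvg => j; move: x.
apply: (@subspace_eq_continuous _ _ _
   (fun x : R * (R * R) => ipd s (fun q => F x.1 q 0 j) x.2)).
  move=> x; rewrite inE => -[I1 _].
  rewrite -[RHS]/(ipd s (F x.1) x.2 0 j) ipd_coord//; exact: s1.
by case: (sF j) => _ /(_ s).
Qed.

Lemma smooth_affine (a b c d : R) :
  smooth (fun p : R * R => (a * p.1 + b * p.2, c * p.1 + d * p.2)).
Proof.
pose l (p : R * R) := (a * p.1 + b * p.2, c * p.1 + d * p.2).
have lB x y : l (x - y) = l x - l y by congr pair => /=; ring.
have lZ (k : R) x : l (k *: x) = k *: l x.
  by congr pair; rewrite /GRing.scale/= /GRing.scale/=; ring.
have cl : continuous l.
  have c2 (u v : R) : continuous (fun p : R * R => u * p.1 + v * p.2).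
    move=> x; apply: cvgD; apply: cvgM; try exact: cvg_cst.
      exact: cvg_fst.
    exact: cvg_snd.
  by move=> x; exact: (cvg_pair (c2 _ _ x) (c2 _ _ x)).
have dl i p : is_derive p (dir i) l (l (dir i)).
  have H := is_derive_id p (@dir R i).
  have H2 := is_derive_lin l lB lZ cl _ _ _ _ H.
  exact: H2.
suff E s : ipd s l = l \/ exists k, ipd s l = cst k.
  move=> s; rewrite -/l; have [->|[k ->]] := E s.
    by split=> // i p; case: (dl i p).
  by split=> [|i p]; [exact: cst_continuous|exact: derivable_cst].
elim: s => [|i s [/= ->|[k /= ->]]]; [by left| |]; right.
  by exists (l (dir i)); apply/funext => p; case: (dl i p).
by exists 0; apply/funext => p; rewrite /pd derive_cst.
Qed.

(** A syntactic class stable under spatial derivatives and made of jointly continuous functions, so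
    that [smooth_family] follows by induction on the order of differentiation. Time enters through
    coefficients that are merely continuous, which suffices because [smooth_family] takes no
    derivative in time. *)
Inductive sfam : (R -> R * R -> R) -> Prop :=
| sfam_coef (a : R -> R) : continuous a -> sfam (fun t _ => a t)
| sfam_cos (a b : R) : sfam (fun _ p => cos (a * p.1 + b * p.2))
| sfam_sin (a b : R) : sfam (fun _ p => sin (a * p.1 + b * p.2))
| sfam_add G H : sfam G -> sfam H -> sfam (fun t p => G t p + H t p)
| sfam_mul G H : sfam G -> sfam H -> sfam (fun t p => G t p * H t p)
| sfam_inv G : (forall t p, G t p != 0) -> sfam G -> sfam (fun t p => (G t p)^-1).

Lemma sfam_continuous G : sfam G -> continuous (fun x : R * (R * R) => G x.1 x.2).
Proof.
have cl (a b : R) : continuous (fun x : R * (R * R) => a * x.2.1 + b * x.2.2).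
  have c2 : continuous (fun x : R * (R * R) => x.2) by move=> x; exact: cvg_snd.
  move=> x; apply: cvgD; apply: cvgM; try exact: cvg_cst.
    by apply: (cvg_comp _ _ (c2 x)); exact: cvg_fst.
  by apply: (cvg_comp _ _ (c2 x)); exact: cvg_snd.
elim=> {G} [a ca|a b|a b|G H _ cG _ cH|G H _ cG _ cH|G n0 _ cG] x.
- have c1 : y.1 @[y --> x] --> x.1 by exact: cvg_fst.
  exact: (cvg_comp _ _ c1 (ca x.1)).
- exact: (cvg_comp _ _ (cl a b x) (@continuous_cos R _)).
- exact: (cvg_comp _ _ (cl a b x) (@continuous_sin R _)).
- exact: (cvgD (cG x) (cH x)).
- exact: (cvgM (cG x) (cH x)).
- exact: (cvgV (n0 _ _) (cG x)).
Qed.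

Lemma sfam_pd i G : sfam G ->
  exists2 G', sfam G' & forall t, pder i (G t) (G' t).
Proof.
have s0 (c : R) : sfam (fun _ _ => c) by apply: (@sfam_coef (fun=> c)); exact: cst_continuous.
elim=> {G} [a ca|a b|a b|G H sG [G' sG' dG] sH [H' sH' dH]|
   G H sG [G' sG' dG] sH [H' sH' dH]|G n0 sG [G' sG' dG]].
- by exists (fun _ _ => 0) => // t; exact: pder_cst.
- exists (fun _ p => (-1 * sin (a * p.1 + b * p.2)) * (if i == 0 then a else b)).
    apply: sfam_mul (s0 _); apply: sfam_mul (s0 _) _; exact: sfam_sin.
  move=> t; apply: (pder_eq _ _ _ _ (pder_cos _ _ _ (pder_lin i a b))) => p.
  by rewrite mulN1r.
- exists (fun _ p => cos (a * p.1 + b * p.2) * (if i == 0 then a else b)).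
    apply: sfam_mul (s0 _); exact: sfam_cos.
  by move=> t; apply: pder_sin; exact: pder_lin.
- by exists (fun t p => G' t p + H' t p) => [|t]; [exact: sfam_add|exact: pderD].
- exists (fun t p => G' t p * H t p + G t p * H' t p) => [|t]; last exact: pderM.
  by apply: sfam_add; exact: sfam_mul.
- exists (fun t p => (-1 * G' t p) * (G t p)^-1 * (G t p)^-1).
    apply: sfam_mul; last exact: sfam_inv.
    by apply: sfam_mul; [exact: sfam_mul|exact: sfam_inv].
  move=> t; apply: (pder_eq _ _ _ _ (pderV _ _ _ (n0 t) (dG t))) => p.
  by rewrite mulN1r.
Qed.

Lemma sfam_smooth_family (I : set R) G : sfam G -> smooth_family I G.
Proof.
move=> sG.
have E s : exists2 G', sfam G' & forall t, ipd s (G t) = G' t.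
  elim: s => [|i s [G' sG' E]]; first by exists G.
  have [G2 sG2 d2] := sfam_pd i _ sG'; exists G2 => // t.
  by rewrite /= E; exact: pder_pd.
split=> [t _ s|s].
  have [G' sG' ->] := E s; split.
    move=> p; have := sfam_continuous _ sG' (t, p).
    move=> /(cvg_comp _ _ (cvg_pair (cvg_cst t) (@cvg_id _ (nbhs p)))).
    exact.
  move=> i p; have [G2 sG2 d2] := sfam_pd i _ sG'.
  exact: pder_derivable.
have [G' sG' E'] := E s.
rewrite (_ : (fun _ => _) = (fun x => G' x.1 x.2)); last first.
  by apply/funext => x; rewrite E'.
by apply: continuous_subspaceT; exact: sfam_continuous.
Qed.

Lemma sfam_smooth g : sfam (fun=> g) -> smooth g.
Proof. by move=> /(sfam_smooth_family setT)[/(_ 0 I)]. Qed.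

End SmoothMaps.

(** * Integration over the period cell *)

Section CellIntegral.
Context {R : realType}.
Implicit Types (p q : R * R) (i : 'I_2).

Local Notation mu := (@lebesgue_measure R).
Local Notation mu2 := (mu \x mu)%E.

(** Second countability of the plane: an open set is the countable union of the rational boxes that
    it contains, and boxes belong to the product sigma-algebra. *)
Lemma open_measurable_plane (A : set (R * R)) : open A ->
  measurable (A : set (measurableTypeR R * measurableTypeR R)).
Proof.
move=> oA.
pose B (z : rat * rat * nat) : set (R * R) :=
  `]ratr z.1.1 - z.2.+1%:R^-1, ratr z.1.1 + z.2.+1%:R^-1[ `*`
  `]ratr z.1.2 - z.2.+1%:R^-1, ratr z.1.2 + z.2.+1%:R^-1[.
have -> : A = \bigcup_z (if `[< B z `<=` A >] then B z else set0).
  apply/seteqP; split=> [p Ap|p [z _]]; last by case: asboolP => // BA Bp; exact: BA.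
  have /nbhs_ballP[d /= d0 dA] : nbhs p A by apply: open_nbhs_nbhs.
  (* Half the radius [d] is taken because [p] and any other point of the box are each within
     [n.+1%:R^-1] of its centre. *)
  have [n] := @ltr_add_invr R 0 (d / 2) ltac:(by rewrite divr_gt0).
  rewrite add0r => nd.
  have : 0 < n.+1%:R^-1 :> R by rewrite invr_gt0 ltr0n.
  move: nd; set e := n.+1%:R^-1 => nd n0.
  have Q (x : R) : exists q : rat, `|ratr q - x| < e.
    have /rat_in_itvoo[q] : x - e < x + e by lra.
    by rewrite in_itv/= => /andP[q1 q2]; exists q; rewrite ltr_norml; apply/andP; split; lra.
  have [q1 H1] := Q p.1; have [q2 H2] := Q p.2.
  have BA : B (q1, q2, n) `<=` A.
    move=> x; rewrite /B/= -/e => -[x1 x2]; apply: dA; move: x1 x2 H1 H2.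
    rewrite !in_itv/= !ltr_norml => /andP[? ?] /andP[? ?] /andP[? ?] /andP[? ?].
    by split; rewrite /ball/= ltr_norml; apply/andP; split; lra.
  exists (q1, q2, n) => //; case: asboolP => // _.
  move: H1 H2; rewrite !ltr_norml => /andP[? ?] /andP[? ?].
  by rewrite /B/= -/e; split; rewrite /= in_itv/=; apply/andP; split; lra.
apply: countable_bigcupT_measurable; first exact: countableP.
move=> z; case: asboolP => // _.
by apply: measurableX; exact: measurable_itv.
Qed.

Lemma continuous_measurable_plane (f : R * R -> R) (D : set (R * R)) :
  continuous f -> measurable_fun (D : set (measurableTypeR R * measurableTypeR R)) f.
Proof.
move=> cf; apply: measurable_funTS => /=.
apply: (measurability _ (RGenOpens.measurableE R)) => /=.
move=> _ [_ [a [b ->]] <-]; rewrite setTI; apply: open_measurable_plane.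
by move/continuousP: cf; apply; exact: interval_open.
Qed.

Lemma measurable_cell : measurable (cell : set (measurableTypeR R * measurableTypeR R)).
Proof. by apply: measurableX; exact: measurable_itv. Qed.

Lemma two_pi_gt0 : 0 < 2 * pi :> R.
Proof. by rewrite mulr_gt0 ?pi_gt0. Qed.

Lemma mu_cell : mu2 (cell : set (measurableTypeR R * measurableTypeR R)) =
  ((2 * pi) ^+ 2)%:E.
Proof.
have muI : mu `[0, 2 * pi[ = (2 * pi)%:E.
  by rewrite lebesgue_measure_itv/= lte_fin two_pi_gt0 -EFinD oppr0 addr0.
have mI : measurable (`[0, 2 * pi[ : set (measurableTypeR R)).
  exact: measurable_itv.
apply: (etrans (product_measure1E mu mu mI mI)).
by rewrite expr2 EFinM; exact: (congr2 mule muI muI).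
Qed.

Lemma continuous_bounded_cell (f : R * R -> R) : continuous f ->
  exists M : R, forall p, cell p -> `|f p| <= M.
Proof.
move=> cf.
have cK : compact (`[0, 2 * pi] `*` `[0, 2 * pi] : set (R * R)).
  by apply: compact_setX; exact: segment_compact.
have /compact_bounded[M [_ HM]] := continuous_compact (continuous_subspaceT cf) cK.
exists (M + 1) => p [p1 p2]; apply: (HM (M + 1)); first by rewrite ltrDl.
exists p => //; split; [move: p1|move: p2];
  by rewrite /= !in_itv/= => /andP[-> /ltW ->].
Qed.

Lemma bounded_integrable_cell (f : R * R -> R) (M : R) :
  measurable_fun (cell : set (measurableTypeR R * measurableTypeR R)) f ->
  (forall p, cell p -> `|f p| <= M) -> mu2.-integrable cell (EFin \o f).
Proof.
move=> mf HM; apply: measurable_bounded_integrable => //.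
- exact: measurable_cell.
- by have := ltry ((2 * pi : R) ^+ 2); rewrite -mu_cell.
- exists M; split; first exact: num_real.
  by move=> x Mx p cp; apply: le_trans (HM p cp) (ltW Mx).
Qed.

Lemma continuous_integrable_cell (f : R * R -> R) :
  continuous f -> mu2.-integrable cell (EFin \o f).
Proof.
move=> cf; have [M HM] := continuous_bounded_cell f cf.
by apply: (bounded_integrable_cell _ M) => //; exact: continuous_measurable_plane.
Qed.

Lemma Rintegral_cst_cell (c : R) :
  \int[mu2]_(p in cell) c = c * (2 * pi) ^+ 2.
Proof.
rewrite Rintegral_cst; last exact: measurable_cell.
by congr (_ * _); exact: (congr1 fine mu_cell).
Qed.

Let pt1 (f : R * R -> R) (y : R) : continuous f -> continuous (fun x => f (x, y)).
Proof.
move=> cf x.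
exact: (cvg_comp _ _ (cvg_pair (@cvg_id _ (nbhs x)) (cvg_cst y)) (cf (x, y))).
Qed.

Let pt2 (f : R * R -> R) (x : R) : continuous f -> continuous (fun y => f (x, y)).
Proof.
move=> cf y.
exact: (cvg_comp _ _ (cvg_pair (cvg_cst x) (@cvg_id _ (nbhs y))) (cf (x, y))).
Qed.

Lemma FTC_period (g dg : R -> R) : continuous dg ->
  (forall x, is_derive x (1 : R) g (dg x)) ->
  (\int[mu]_(x in `[0%R, (2 * pi)%R[) (dg x)%:E = (g (2 * pi) - g 0)%:E)%E.
Proof.
move=> cdg Hg.
have cg : continuous g.
  by move=> x; apply/differentiable_continuous/derivable1_diffP; case: (Hg x).
rewrite integral_itv_bndo_bndc; last first.
  apply/measurable_EFinP; apply: measurable_funTS.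
  exact: continuous_measurable_fun.
rewrite (@continuous_FTC2 _ dg g)// ?two_pi_gt0//.
- exact: continuous_subspaceT.
- split=> [x _||]; first by case: (Hg x).
    by apply: cvg_at_right_filter; exact: cg.
  by apply: cvg_at_left_filter; exact: cg.
- by move=> x _; rewrite derive1E; case: (Hg x).
Qed.

Lemma Rintegral_cell12 (f : R * R -> R) : continuous f ->
  (\int[mu2]_(p in cell) (f p)%:E =
   \int[mu]_(x in `[0%R, (2 * pi)%R[) \int[mu]_(y in `[0%R, (2 * pi)%R[) (f (x, y))%:E)%E.
Proof.
move=> cf; rewrite integral_mkcond -integral12_prod_meas1; last first.
  exact: (proj1 (integrable_mkcond _ measurable_cell) (continuous_integrable_cell f cf)).
rewrite [RHS]integral_mkcond; apply: eq_integral => x _.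
rewrite patchE; case: ifPn => xI.
  rewrite [RHS]integral_mkcond; apply: eq_integral => y _.
  by rewrite !patchE in_setX/= xI.
by apply: integral0_eq => y _; rewrite patchE in_setX/= (negbTE xI).
Qed.

Lemma Rintegral_cell21 (f : R * R -> R) : continuous f ->
  (\int[mu2]_(p in cell) (f p)%:E =
   \int[mu]_(y in `[0%R, (2 * pi)%R[) \int[mu]_(x in `[0%R, (2 * pi)%R[) (f (x, y))%:E)%E.
Proof.
move=> cf; rewrite integral_mkcond -integral21_prod_meas1; last first.
  exact: (proj1 (integrable_mkcond _ measurable_cell) (continuous_integrable_cell f cf)).
rewrite [RHS]integral_mkcond; apply: eq_integral => y _.
rewrite patchE; case: ifPn => yI.
  rewrite [RHS]integral_mkcond; apply: eq_integral => x _.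
  by rewrite !patchE in_setX/= yI andbT.
by apply: integral0_eq => x _; rewrite patchE in_setX/= (negbTE yI) andbF.
Qed.

(** The function is allowed to jump by [dD y] across a period, because products such as
    [x1 * pd 1 x2], with [x1] a coordinate of the lift of a torus map, are not periodic. *)
Lemma Rintegral_pd0 (a : R * R -> R) (D dD : R -> R) :
  (forall q, derivable a q (dir 0)) -> continuous (pd 0 a) ->
  (forall y, is_derive y (1 : R) D (dD y)) -> continuous dD ->
  (forall y, a (2 * pi, y) - a (0, y) = dD y) ->
  \int[mu2]_(p in cell) pd 0 a p = D (2 * pi) - D 0.
Proof.
move=> da ca HD cD E; rewrite /Rintegral (Rintegral_cell21 _ ca).
rewrite (@eq_integral _ _ _ mu _ (fun y => (dD y)%:E)).
  by rewrite (FTC_period _ _ cD HD).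
move=> y _; rewrite -E.
apply: (FTC_period (fun x => a (x, y)) (fun x => pd 0 a (x, y))); first exact: pt1.
move=> x; have := is_derive_line a (0, y) (dir 0) x (pd 0 a (x, y)).
rewrite scale_dir0/= addr0 (_ : (fun t => _) = (fun t => a (t, y))).
  by apply; exact: derivableP.
by apply/funext => t; rewrite scale_dir0 addr0.
Qed.

Lemma Rintegral_pd1 (a : R * R -> R) (D dD : R -> R) :
  (forall q, derivable a q (dir 1)) -> continuous (pd 1 a) ->
  (forall y, is_derive y (1 : R) D (dD y)) -> continuous dD ->
  (forall x, a (x, 2 * pi) - a (x, 0) = dD x) ->
  \int[mu2]_(p in cell) pd 1 a p = D (2 * pi) - D 0.
Proof.
move=> da ca HD cD E; rewrite /Rintegral (Rintegral_cell12 _ ca).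
rewrite (@eq_integral _ _ _ mu _ (fun y => (dD y)%:E)).
  by rewrite (FTC_period _ _ cD HD).
move=> x _; rewrite -E.
apply: (FTC_period (fun y => a (x, y)) (fun y => pd 1 a (x, y))); first exact: pt2.
move=> y; have := is_derive_line a (x, 0) (dir 1) y (pd 1 a (x, y)).
rewrite scale_dir1/= addr0 (_ : (fun t => _) = (fun t => a (x, t))).
  by apply; exact: derivableP.
by apply/funext => t; rewrite scale_dir1 addr0.
Qed.

Lemma lat2pi_dir i : lat2pi ((2 * pi) *: dir i : R * R).
Proof.
case: i => -[|[|//]] Hi; [exists 1, 0|exists 0, 1];
  by rewrite mulr1z mulr0z ?addr0 ?add0r; congr pair;
  rewrite /dir/= /GRing.scale/= ?mulr1 ?mulr0.
Qed.

Lemma lat2pi_add2pi0 (y : R) : lat2pi ((2 * pi, y) - (0, y) : R * R).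
Proof.
have := lat2pi_dir 0; congr lat2pi; congr pair; rewrite /dir/= /GRing.scale/=.
  by rewrite mulr1 subr0.
by rewrite mulr0 subrr.
Qed.

Lemma lat2pi_add2pi1 (x : R) : lat2pi ((x, 2 * pi) - (x, 0) : R * R).
Proof.
have := lat2pi_dir 1; congr lat2pi; congr pair; rewrite /dir/= /GRing.scale/=.
  by rewrite mulr0 subrr.
by rewrite mulr1 subr0.
Qed.

Lemma Rintegral_pd_periodic i (a : R * R -> R) :
  (forall q, derivable a q (dir i)) -> continuous (pd i a) ->
  lattice_periodic lat2pi a ->
  \int[mu2]_(p in cell) pd i a p = 0.
Proof.
move=> da ca pa.
have d0 (y : R) : is_derive y (1 : R) (fun=> 0 : R) ((fun=> 0 : R) y).
  exact: is_derive_cst.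
have c0 : continuous (fun _ : R => 0 : R) by exact: cst_continuous.
have i01 : i = 0 \/ i = 1.
  by case: i {da ca} => -[|[|//]] Hi; [left|right]; exact: val_inj.
case: i01 => ei; rewrite {i}ei in da ca *.
  rewrite (Rintegral_pd0 _ _ _ da ca d0 c0) ?subrr// => y.
  by rewrite (pa _ (0, y)) ?subrr//; exact: lat2pi_add2pi0.
rewrite (Rintegral_pd1 _ _ _ da ca d0 c0) ?subrr// => x.
by rewrite (pa _ (x, 0)) ?subrr//; exact: lat2pi_add2pi1.
Qed.

End CellIntegral.

(** * Lifts of torus maps and their periods *)

Section TorusMaps.
Context {R : realType}.
Implicit Types (p q : R * R) (i : 'I_2).

Lemma smooth_continuous {V : normedModType R} (f : R * R -> V) :
  smooth f -> continuous f.
Proof. by move=> /(_ [::])[]. Qed.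

Lemma smooth_derivable {V : normedModType R} (f : R * R -> V) i p :
  smooth f -> derivable f p (dir i).
Proof. by move=> /(_ [::])[_]; exact. Qed.

Lemma smooth_pd {V : normedModType R} (f : R * R -> V) i :
  smooth f -> smooth (pd i f).
Proof.
have E s : ipd s (pd i f) = ipd (rcons s i) f by rewrite /ipd foldr_rcons.
by move=> sf s; rewrite E.
Qed.

Lemma pd_shift i (f : R * R -> R) w p : pd i (fun q => f (q + w)) p = pd i f (p + w).
Proof.
rewrite /pd /derive /= (_ : (fun h : R => h^-1 *: (f (h *: dir i + p + w) - f (p + w))) =
  (fun h : R => h^-1 *: (f (h *: dir i + (p + w)) - f (p + w))))//.
by apply/funext => h; rewrite addrA.
Qed.

Lemma plane_IVT (g : R * R -> R) p q v : continuous g ->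
  g p <= v <= g q -> exists x, g x = v.
Proof.
move=> cg vI.
pose l (t : R) : R * R := (p.1 + t * (q.1 - p.1), p.2 + t * (q.2 - p.2)).
have cl : continuous l.
  have c1 (a b : R) : continuous (fun t : R => a + t * b).
    move=> t; apply: cvgD; first exact: cvg_cst.
    by apply: cvgM; [exact: cvg_id|exact: cvg_cst].
  by move=> t; exact: (cvg_pair (c1 _ _ t) (c1 _ _ t)).
have cgl : {within `[0, 1], continuous (g \o l)}.
  by apply: continuous_subspaceT => t; exact: (cvg_comp _ _ (cl t) (cg (l t))).
have l0 : l 0 = p by rewrite /l !mul0r !addr0 -surjective_pairing.
have l1 : l 1 = q.
  by rewrite /l !mul1r ![p.1 + _]addrC ![p.2 + _]addrC !subrK -surjective_pairing.
have pq : g p <= g q by have /andP[+ +] := vI; exact: le_trans.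
have [|c _ E] := @IVT R (g \o l) 0 1 v ler01 cgl.
  by rewrite /= l0 l1 (min_idPl pq) (max_idPr pq).
by exists (l c).
Qed.

(** Between two different integer values a continuous function would also take a value [k + 1/2]. *)
Lemma int_valued_const (g : R * R -> R) : continuous g ->
  (forall p, exists k : int, g p = k%:~R) -> forall p q, g p = g q.
Proof.
move=> cg gint.
suff H p q : ~ g p < g q.
  by move=> p q; case: (ltgtP (g p) (g q)) => // /H.
move=> pq; have [k Ek] := gint p; have [l El] := gint q.
have kl : (k + 1 <= l)%R by rewrite lezD1 -(ltr_int R) -Ek -El.
have kl' : k%:~R + 1 <= l%:~R :> R by rewrite -[1]/(1%:~R) -intrD ler_int.
have [|x Ex] := plane_IVT g p q (k%:~R + 2^-1) cg.
  by rewrite Ek El; apply/andP; split; lra.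
have [n En] := gint x.
have : k%:~R < n%:~R :> R by rewrite -En Ex; lra.
have : n%:~R < (k + 1)%:~R :> R by rewrite -En Ex intrD; lra.
by rewrite !ltr_int ltzD1 => /le_lt_trans H /H; rewrite ltxx.
Qed.

Lemma mulrz_pair p (n : int) : p *~ n = (p.1 * n%:~R, p.2 * n%:~R).
Proof.
have Hn (k : nat) : p *+ k = (p.1 *+ k, p.2 *+ k).
  by elim: k => [|k IH] //; rewrite !mulrS IH.
rewrite !mulrzr; case: n => n; first by rewrite -!pmulrn Hn.
by rewrite !NegzE !mulrNz -!pmulrn Hn.
Qed.

Lemma lattice_diagP (a b : R) p : lattice (a, 0) (0, b) p <->
  exists k l : int, p = (a * k%:~R, b * l%:~R).
Proof.
have E (k l : int) : (a, 0) *~ k + (0, b) *~ l = (a * k%:~R, b * l%:~R) :> R * R.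
  by rewrite !mulrz_pair; congr pair; rewrite /= !mul0r ?addr0 ?add0r.
by split=> -[k [l ->]]; exists k, l; rewrite E.
Qed.

Lemma lattice_valued_const (a b : R) (g : R * R -> R * R) : a != 0 -> b != 0 ->
  continuous g -> (forall p, lattice (a, 0) (0, b) (g p)) ->
  forall p q, g p = g q.
Proof.
move=> a0 b0 cg gL p q.
have c1 : continuous (fun p => (g p).1 / a).
  move=> x; apply: cvgM; last exact: cvg_cst.
  by apply: (cvg_comp _ _ (cg x)); exact: cvg_fst.
have c2 : continuous (fun p => (g p).2 / b).
  move=> x; apply: cvgM; last exact: cvg_cst.
  by apply: (cvg_comp _ _ (cg x)); exact: cvg_snd.
have E1 : (g p).1 / a = (g q).1 / a.
  apply: (int_valued_const _ c1) => x.
  by have /lattice_diagP[k [l ->]] := gL x; exists k; rewrite /= mulrAC divff ?mul1r.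
have E2 : (g p).2 / b = (g q).2 / b.
  apply: (int_valued_const _ c2) => x.
  by have /lattice_diagP[k [l ->]] := gL x; exists l; rewrite /= mulrAC divff ?mul1r.
move: E1 E2 => /(mulIf (invr_neq0 a0)) E1 /(mulIf (invr_neq0 b0)) E2.
by rewrite [g p]surjective_pairing E1 E2 -surjective_pairing.
Qed.

(** The increment [f (p + w) - f p] is continuous with values in a discrete lattice, hence constant:
    [d] is the image of [w] under the map induced on fundamental groups. *)
Lemma torus_map_period (a b : R) (L : set (R * R)) (f : R * R -> R * R) w :
  a != 0 -> b != 0 -> torus_map L (lattice (a, 0) (0, b)) f -> L w ->
  exists2 d, lattice (a, 0) (0, b) d & forall p, f (p + w) = f p + d.
Proof.
move=> a0 b0 [sf Lf] Lw; exists (f (0 + w) - f 0); first by apply: Lf; rewrite addrAC subrr add0r.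
move=> p; suff <- : f (p + w) - f p = f (0 + w) - f 0 by rewrite [RHS]addrC subrK.
apply: (lattice_valued_const a b (fun p => f (p + w) - f p)) => //.
  move=> x; have cf := smooth_continuous f sf.
  apply: cvgB; last exact: cf.
  have cw : (y + w) @[y --> x] --> x + w by apply: cvgD; [exact: cvg_id|exact: cvg_cst].
  exact: (cvg_comp _ _ cw (cf _)).
by move=> x; apply: Lf; rewrite addrAC subrr add0r.
Qed.

Lemma shift_mulrz (f : R * R -> R * R) w d : (forall p, f (p + w) = f p + d) ->
  forall (k : int) p, f (p + w *~ k) = f p + d *~ k.
Proof.
move=> H.
have Hn (n : nat) p : f (p + w *+ n) = f p + d *+ n.
  elim: n p => [|n IH] p; first by rewrite !mulr0n !addr0.
  by rewrite !mulrSr !addrA H IH.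
case=> n p; first by rewrite -!pmulrn.
rewrite NegzE !mulrNz -!pmulrn; apply/eqP; rewrite -subr_eq opprK -Hn.
by rewrite subrK.
Qed.

End TorusMaps.

(** * Action of a diffeomorphism on the lattices *)

Section ExtremalLength.
Context {R : realType}.
Implicit Types (p q : R * R) (i : 'I_2).

(** The maps induced on the two lattices are integer matrices inverse to each other, so both
    determinants are units. On the torus [phi \o psi] is the identity, so on the plane it differs
    from the identity by a lattice-valued continuous function, a constant [d]. *)
Lemma torus_diffeo_unimodular (c : R) (phi psi : R * R -> R * R) : c != 0 ->
  torus_map (lattice (1, 0) (0, c)) lat2pi phi ->
  torus_map lat2pi (lattice (1, 0) (0, c)) psi ->
  (forall q, lat2pi (phi (psi q) - q)) ->
  exists k1 l1 k2 l2 : int,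
    [/\ forall p, psi (p + (2 * pi, 0)) = psi p + (k1%:~R, c * l1%:~R),
        forall p, psi (p + (0, 2 * pi)) = psi p + (k2%:~R, c * l2%:~R),
        `|k1 * l2 - l1 * k2| = 1,
        (k1, l1) != (0, 0) &
        exists d, forall q, phi (psi q) = q + d].
Proof.
move=> c0 tphi tpsi phipsi.
have pi0 : 2 * pi != 0 :> R by rewrite gt_eqF ?two_pi_gt0.
have cphi := smooth_continuous _ (proj1 tphi).
have cpsi := smooth_continuous _ (proj1 tpsi).
have [d Hd] : exists d, forall q, phi (psi q) = q + d.
  exists (phi (psi 0) - 0) => q.
  suff <- : phi (psi q) - q = phi (psi 0) - 0 by rewrite [RHS]addrC subrK.
  apply: (lattice_valued_const (2 * pi) (2 * pi) (fun q => phi (psi q) - q)) => //.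
  move=> x; apply: cvgB; last exact: cvg_id.
  exact: (cvg_comp _ _ (cpsi x) (cphi _)).
have L1 : lat2pi ((2 * pi, 0) : R * R).
  by apply/lattice_diagP; exists 1, 0; rewrite mulr1 mulr0.
have L2 : lat2pi ((0, 2 * pi) : R * R).
  by apply/lattice_diagP; exists 0, 1; rewrite mulr1 mulr0.
have M1 : lattice (1, 0) (0, c) ((1, 0) : R * R).
  by apply/lattice_diagP; exists 1, 0; rewrite mulr1 mulr0.
have M2 : lattice (1, 0) (0, c) ((0, c) : R * R).
  by apply/lattice_diagP; exists 0, 1; rewrite mulr1 mulr0.
have [_ [k1 [l1 ->]] P1] := torus_map_period _ _ _ _ _ (oner_neq0 R) c0 tpsi L1.
have [_ [k2 [l2 ->]] P2] := torus_map_period _ _ _ _ _ (oner_neq0 R) c0 tpsi L2.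
have [d1 /lattice_diagP[m1 [n1 E1]] Q1] := torus_map_period _ _ _ _ _ pi0 pi0 tphi M1.
have [d2 /lattice_diagP[m2 [n2 E2]] Q2] := torus_map_period _ _ _ _ _ pi0 pi0 tphi M2.
have per w (k l : int) : (forall p, psi (p + w) = psi p + ((1, 0) *~ k + (0, c) *~ l)) ->
    w = d1 *~ k + d2 *~ l.
  move=> P; have := Hd w; rewrite -[w in psi w]add0r P.
  rewrite addrA (shift_mulrz _ _ _ Q2) (shift_mulrz _ _ _ Q1) Hd add0r.
  by move=> E; apply: (addIr d); rewrite -E -addrA addrC.
have coord (u v : R) w (k l : int) : w = (u, v) ->
    (forall p, psi (p + w) = psi p + ((1, 0) *~ k + (0, c) *~ l)) ->
    u = 2 * pi * (m1 * k + m2 * l)%:~R /\ v = 2 * pi * (n1 * k + n2 * l)%:~R.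
  move=> Ew /per.
  rewrite Ew E1 E2 !mulrz_pair /= => -[-> ->].
  by rewrite !intrD !intrM; split; ring.
have eqz (x : R) (z : int) : 2 * pi * x = 2 * pi * z%:~R -> x = z%:~R by move/(mulfI pi0).
have [|A1 A2] := coord (2 * pi * 1%:~R) (2 * pi * 0%:~R) _ k1 l1 _ P1.
  by rewrite mulr0 mulr1.
have [|A3 A4] := coord (2 * pi * 0%:~R) (2 * pi * 1%:~R) _ k2 l2 _ P2.
  by rewrite mulr0 mulr1.
move: A1 A2 A3 A4 => /eqz/intr_inj A1 /eqz/intr_inj A2 /eqz/intr_inj A3 /eqz/intr_inj A4.
(* Multiplicativity of the determinant: [A1] to [A4] say that the product of the two matrices is the
   identity. *)
have D1 : (k1 * l2 - l1 * k2) * (m1 * n2 - m2 * n1) = 1.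
  transitivity ((m1 * k1 + m2 * l1) * (n1 * k2 + n2 * l2) -
                (n1 * k1 + n2 * l1) * (m1 * k2 + m2 * l2)); first by ring.
  by rewrite -A1 -A2 -A4 mul0r subr0 mulr1.
have latE (k l : int) : (1, 0) *~ k + (0, c) *~ l = (k%:~R, c * l%:~R) :> R * R.
  by rewrite !mulrz_pair; congr pair; rewrite /= !mul0r ?addr0 ?add0r ?mul1r.
exists k1, l1, k2, l2; split.
- by move=> p; rewrite P1 latE.
- by move=> p; rewrite P2 latE.
- have /(congr1 absz) := D1; rewrite abszM => /eqP; rewrite muln_eq1 => /andP[/eqP H _].
  by rewrite -abszE H.
- apply/eqP => -[Ek El]; move: A1; rewrite Ek El !mulr0 addr0 => /eqP.
  by rewrite oner_eq0.
- by exists d.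
Qed.

End ExtremalLength.

(** * The length-area inequality *)

Section ExtremalLengthBound.
Context {R : realType}.
Implicit Types (p q : R * R) (i : 'I_2).

Local Notation mu := (@lebesgue_measure R).
Local Notation mu2 := (mu \x mu)%E.

Lemma sum2 (V : nmodType) (F : 'I_2 -> V) : \sum_i F i = F 0 + F 1.
Proof.
by rewrite big_ord_recl big_ord1; congr (_ + F _); exact: val_inj.
Qed.

Lemma det2 (M : 'M[R]_2) : \det M = M 0 0 * M 1 1 - M 0 1 * M 1 0.
Proof.
rewrite (expand_det_row _ 0) sum2 /cofactor !det_mx11 !mxE /= expr0 expr1.
rewrite mul1r mulN1r mulrN.
by congr (_ * M _ _ - _ * M _ _); exact: val_inj.
Qed.

Lemma smooth_row_of_pair (f : R * R -> R * R) : smooth f -> smooth (row_of_pair \o f).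
Proof.
move=> sf; apply: smooth_row => j; have [e|n] := eqVneq j 0.
  by rewrite (_ : (fun _ => _) = (fun p => (f p).1)) ?e; [exact: smooth_fst|
    apply/funext => p; rewrite mxE].
by rewrite (_ : (fun _ => _) = (fun p => (f p).2)); [exact: smooth_snd|
    apply/funext => p; rewrite mxE (negbTE n)].
Qed.

Lemma jacE n (f : R * R -> 'rV[R]_n) p i j : smooth f ->
  jac f p i j = pd i (fun q => f q 0 j) p.
Proof. by move=> sf; rewrite mxE (ipd_coord _ f j [:: i] p sf). Qed.

Lemma jac_row_of_pair (f : R * R -> R * R) p i j : smooth f ->
  jac (row_of_pair \o f) p i j =
  if j == 0 then pd i (fun q => (f q).1) p else pd i (fun q => (f q).2) p.
Proof.
move=> sf; rewrite jacE; last exact: smooth_row_of_pair.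
by case: ifP => [/eqP ->|n]; congr (pd i _ p); apply/funext => q; rewrite mxE ?n.
Qed.

(** Since [jac] has one row per derivative, the chain rule for [f \o g] puts the factor of [g] on
    the left. *)
Lemma jac_inverse (f g : R * R -> R * R) p d : smooth f -> smooth g ->
  (forall q, f (g q) = q + d) ->
  jac (row_of_pair \o g) p *m jac (row_of_pair \o f) (g p) = 1%:M.
Proof.
move=> sf sg fg; apply/matrixP => i j; rewrite [LHS]mxE [RHS]mxE sum2.
have Jg k := jac_row_of_pair g p i k sg; have Jf k := jac_row_of_pair f (g p) k j sf.
apply: etrans (congr2 +%R (congr2 *%R (Jg 0) (Jf 0)) (congr2 *%R (Jg 1) (Jf 1))) _ => /=.
have H (f1 : R * R -> R) (e : bool) : smooth f1 ->
    (forall q, f1 (g q) = (if e then q.1 else q.2) + (if e then d.1 else d.2)) ->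
    pd i (fun q => (g q).1) p * pd 0 f1 (g p) +
    pd i (fun q => (g q).2) p * pd 1 f1 (g p) = (e == (i == 0))%:R.
  move=> sf1 E.
  have := pder_comp2 i f1 _ _ _ _ (fun j q => smooth_derivable _ j q sf1)
    (fun j => smooth_continuous _ (smooth_pd _ j sf1))
    (pderP i (fun q => (g q).1) (fun q => smooth_derivable _ i q (smooth_fst _ sg)))
    (pderP i (fun q => (g q).2) (fun q => smooth_derivable _ i q (smooth_snd _ sg))).
  rewrite (_ : (fun q => f1 _) = (fun q => (if e then q.1 else q.2) + (if e then d.1 else d.2))); last first.
    by apply/funext => q; rewrite -surjective_pairing E.
  move=> /pder_pd/(congr1 (@^~ p)) /=; rewrite -surjective_pairing => E2.
  rewrite [LHS](_ : _ = pd i (fun q => (if e then q.1 else q.2) + (if e then d.1 else d.2)) p); last first.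
    by rewrite E2 mulrC [X in _ + X]mulrC.
  case: e {E E2} => /=.
    rewrite (pder_pd _ _ _ (pderD _ _ _ _ _ (pder_fst i) (pder_cst i _))).
    by rewrite addr0; case: (i == 0).
  rewrite (pder_pd _ _ _ (pderD _ _ _ _ _ (pder_snd i) (pder_cst i _))).
  by rewrite addr0; case: (i == 0).
have i01 (k : 'I_2) : k = 0 \/ k = 1.
  by case: k => -[|[|//]] Hk; [left|right]; exact: val_inj.
have [ej|ej] := i01 j; rewrite ej /=.
  rewrite (H _ true (smooth_fst _ sf)) => [|q]; last by rewrite fg.
  by have [->|->] := i01 i.
rewrite (H _ false (smooth_snd _ sf)) => [|q]; last by rewrite fg.
by have [->|->] := i01 i.
Qed.

Lemma cell_RintegralD (f g : R * R -> R) : continuous f -> continuous g ->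
  \int[mu2]_(p in cell) (f p + g p) =
  \int[mu2]_(p in cell) f p + \int[mu2]_(p in cell) g p.
Proof.
move=> cf cg; apply: RintegralD; first exact: measurable_cell.
- exact: continuous_integrable_cell.
- exact: continuous_integrable_cell.
Qed.

Lemma cell_RintegralB (f g : R * R -> R) : continuous f -> continuous g ->
  \int[mu2]_(p in cell) (f p - g p) =
  \int[mu2]_(p in cell) f p - \int[mu2]_(p in cell) g p.
Proof.
move=> cf cg; apply: RintegralB; first exact: measurable_cell.
- exact: continuous_integrable_cell.
- exact: continuous_integrable_cell.
Qed.

Lemma cell_RintegralZ (c : R) (f : R * R -> R) : continuous f ->
  \int[mu2]_(p in cell) (c * f p) = c * \int[mu2]_(p in cell) f p.
Proof.
move=> cf; apply: RintegralZl; first exact: measurable_cell.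
exact: continuous_integrable_cell.
Qed.

Lemma pd_period i (f : R * R -> R) w k : smooth f ->
  (forall p, f (p + w) = f p + k) -> forall p, pd i f (p + w) = pd i f p.
Proof.
move=> sf Hf p; rewrite -pd_shift (_ : (fun q => f (q + w)) = (fun q => f q + k)); last first.
  exact/funext.
have df := pderP i f (fun q => smooth_derivable f i q sf).
by rewrite (pder_pd _ _ _ (pderD _ _ _ _ _ df (pder_cst i k))) addr0.
Qed.

Lemma is_derive_mulr (k y : R) : is_derive y (1 : R) (fun y => k * y) k.
Proof.
have := is_deriveZ k (is_derive_id y (1 : R)).
by rewrite /GRing.scale/= mulr1.
Qed.

(** The Jacobian determinant is the divergence of [(x1 * pd 1 x2, - x1 * pd 0 x2)], so only the
    jumps across the periods contribute; the value is the oriented area of the parallelogram spanned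
    by the periods. *)
Lemma Rintegral_jacobian (x1 x2 : R * R -> R) (a1 a2 b1 b2 : R) :
  smooth x1 -> smooth x2 ->
  (forall p, x1 (p + (2 * pi, 0)) = x1 p + a1) ->
  (forall p, x2 (p + (2 * pi, 0)) = x2 p + b1) ->
  (forall p, x1 (p + (0, 2 * pi)) = x1 p + a2) ->
  (forall p, x2 (p + (0, 2 * pi)) = x2 p + b2) ->
  \int[mu2]_(p in cell) (pd 0 x1 p * pd 1 x2 p - pd 0 x2 p * pd 1 x1 p) =
  a1 * b2 - b1 * a2.
Proof.
move=> s1 s2 P11 P12 P21 P22.
have cpd i x : smooth x -> continuous (pd i x : R * R -> R).
  by move=> sx; apply: smooth_continuous; exact: smooth_pd.
have dP i x : smooth x -> pder i (x : R * R -> R) (pd i x).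
  by move=> sx; apply: pderP => q; exact: smooth_derivable.
have c1 := smooth_continuous x1 s1.
have cpt1 (f : R * R -> R) : continuous f -> continuous (fun y => f (0, y)).
  move=> cf y.
  exact: (cvg_comp _ _ (cvg_pair (cvg_cst 0) (@cvg_id _ (nbhs y))) (cf (0, y))).
have cpt2 (f : R * R -> R) : continuous f -> continuous (fun x => f (x, 0)).
  move=> cf x.
  exact: (cvg_comp _ _ (cvg_pair (@cvg_id _ (nbhs x)) (cvg_cst 0)) (cf (x, 0))).
have d01 := pderM _ _ _ _ _ (dP 0 x1 s1) (dP 0 _ (smooth_pd x2 1 s2)).
have d10 := pderM _ _ _ _ _ (dP 1 x1 s1) (dP 1 _ (smooth_pd x2 0 s2)).
have cont2 (f g k l : R * R -> R) : continuous f -> continuous g -> continuous k ->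
    continuous l -> continuous (fun p => f p * g p + k p * l p).
  by move=> cf cg ck cl x; apply: cvgD; apply: cvgM; [exact: cf|exact: cg|exact: ck|exact: cl].
have C2 i j : continuous (pd i (pd j x2)) by apply: cpd; exact: smooth_pd.
have C01 : continuous (pd 0 (fun p => x1 p * pd 1 x2 p)).
  by rewrite (pder_pd _ _ _ d01); apply: cont2 => //; exact: cpd.
have C10 : continuous (pd 1 (fun p => x1 p * pd 0 x2 p)).
  by rewrite (pder_pd _ _ _ d10); apply: cont2 => //; exact: cpd.
have pc : pd 0 (pd 1 x2) = pd 1 (pd 0 x2).
  apply: pd_comm; last exact: C2.
    by move=> i q; exact: smooth_derivable.
  by move=> q; apply: smooth_derivable; exact: smooth_pd.
rewrite (_ : (fun p => _ - _) = (fun p => pd 0 (fun p => x1 p * pd 1 x2 p) p -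
    pd 1 (fun p => x1 p * pd 0 x2 p) p)); last first.
  by apply/funext => p; rewrite (pder_pd _ _ _ d01) (pder_pd _ _ _ d10) pc
    opprD addrACA subrr addr0 [pd 1 x1 p * _]mulrC.
have e1 (y : R) : (2 * pi, y) = (0, y) + (2 * pi, 0) :> R * R.
  by congr pair; rewrite /= ?add0r ?addr0.
have e2 (x : R) : (x, 2 * pi) = (x, 0) + (0, 2 * pi) :> R * R.
  by congr pair; rewrite /= ?add0r ?addr0.
have I0 : \int[mu2]_(p in cell) pd 0 (fun p => x1 p * pd 1 x2 p) p = a1 * b2.
  apply: etrans (Rintegral_pd0 _ (fun y => a1 * x2 (0, y))
    (fun y => a1 * pd 1 x2 (0, y)) _ C01 _ _ _) _.
  - by move=> q; exact: pder_derivable d01.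
  - move=> y; have := is_derive_line x2 (0, 0) (dir 1) y (pd 1 x2 (0, y)).
    rewrite scale_dir1/= addr0 (_ : (fun t => _) = (fun t => x2 (0, t))); last first.
      by apply/funext => t; rewrite scale_dir1 addr0.
    by move=> /(_ (dP 1 x2 s2 _))/(is_deriveZ a1).
  - by move=> y; apply: cvgM; [exact: cvg_cst|exact: (cpt1 _ (cpd 1 _ s2))].
  - by move=> y; rewrite e1 P11 (pd_period _ _ _ _ s2 P12) mulrDl addrAC subrr add0r.
  - by rewrite e2 P22 mulrDr addrAC subrr add0r.
have I1 : \int[mu2]_(p in cell) pd 1 (fun p => x1 p * pd 0 x2 p) p = a2 * b1.
  apply: etrans (Rintegral_pd1 _ (fun x => a2 * x2 (x, 0))
    (fun x => a2 * pd 0 x2 (x, 0)) _ C10 _ _ _) _.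
  - by move=> q; exact: pder_derivable d10.
  - move=> x; have := is_derive_line x2 (0, 0) (dir 0) x (pd 0 x2 (x, 0)).
    rewrite scale_dir0/= addr0 (_ : (fun t => _) = (fun t => x2 (t, 0))); last first.
      by apply/funext => t; rewrite scale_dir0 addr0.
    by move=> /(_ (dP 0 x2 s2 _))/(is_deriveZ a2).
  - by move=> x; apply: cvgM; [exact: cvg_cst|exact: (cpt2 _ (cpd 0 _ s2))].
  - by move=> x; rewrite e2 P21 (pd_period _ _ _ _ s2 P22) mulrDl addrAC subrr add0r.
  - by rewrite e1 P12 mulrDr addrAC subrr add0r.
apply: etrans (cell_RintegralB _ _ C01 C10) _.
by apply: etrans (congr2 (fun a b => a - b) I0 I1) _; rewrite [a2 * _]mulrC.
Qed.

Lemma Rintegral_pd0_period (x : R * R -> R) (k : R) : smooth x ->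
  (forall p, x (p + (2 * pi, 0)) = x p + k) ->
  \int[mu2]_(p in cell) pd 0 x p = 2 * pi * k.
Proof.
move=> sx P.
apply: etrans (Rintegral_pd0 x (fun y => k * y) (fun=> k) _ _ _ _ _) _.
- by move=> q; exact: smooth_derivable.
- by apply: smooth_continuous; exact: smooth_pd.
- by move=> y; exact: is_derive_mulr.
- by move=> y; exact: cvg_cst.
- move=> y; rewrite (_ : (2 * pi, y) = (0, y) + (2 * pi, 0)) ?P; first by rewrite addrAC subrr add0r.
  by congr pair; rewrite /= ?add0r ?addr0.
- by rewrite mulr0 subr0 mulrC.
Qed.

(** A coordinate change may reverse orientation. Writing the absolute value as [s * g p] with a
    constant sign keeps it linear in [g], so that [Rintegral_jacobian] computes its integral. *)
Lemma nonvanishing_sign (g : R * R -> R) : continuous g -> (forall p, g p != 0) ->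
  exists s : R, [/\ s ^+ 2 = 1 & forall p, `|g p| = s * g p].
Proof.
move=> cg g0.
have H p q : g p < 0 -> 0 < g q -> False.
  move=> gp gq; have [|x /eqP] := plane_IVT g p q 0 cg.
    by rewrite (ltW gp) (ltW gq).
  by rewrite (negbTE (g0 x)).
have [gp|gp] := ltP 0 (g 0).
  exists 1; split=> [|q]; first by rewrite expr1n.
  rewrite mul1r ger0_norm// leNgt; apply/negP => gq; exact: H gq gp.
exists (-1); split=> [|q]; first by rewrite sqrrN expr1n.
rewrite mulN1r ler0_norm// leNgt; apply/negP => gq; apply: (H 0 q _ gq).
by rewrite lt_neqAle g0 gp.
Qed.

(* Length-area method: for the conformal coordinates [psi] the integrand is
   |psi_u|^2 / |det J_psi|, which is bounded below, by Cauchy and AM-GM, by an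
   expression whose integral depends only on the periods of [psi]. *)
Lemma extremal_length (c : R) (h : R * R -> 'M[R]_2) : 1 <= c ->
  conf_class h (0, c) -> lattice_periodic lat2pi h ->
  continuous (fun p => h p 0 0 / Num.sqrt (\det (h p))) ->
  (2 * pi) ^+ 2 / c <= \int[mu2]_(p in cell) (h p 0 0 / Num.sqrt (\det (h p))).
Proof.
move=> c1 [_ [phi [tphi [psi tpsi [_ phipsi]]] [rho Hrho]]] hper hcont.
have c0 : 0 < c by exact: lt_le_trans ltr01 c1.
have [k1 [l1 [k2 [l2 [P1 P2 Dkl kl0 [d Hd]]]]]] :=
  torus_diffeo_unimodular c phi psi (lt0r_neq0 c0) tphi tpsi phipsi.
have sphi := proj1 tphi; have spsi := proj1 tpsi.
pose x1 p := (psi p).1; pose x2 p := (psi p).2.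
have s1 : smooth x1 := smooth_fst _ spsi.
have s2 : smooth x2 := smooth_snd _ spsi.
pose J p := pd 0 x1 p * pd 1 x2 p - pd 0 x2 p * pd 1 x1 p.
have cpd i x : smooth x -> continuous (pd i x : R * R -> R).
  by move=> sx; apply: smooth_continuous; exact: smooth_pd.
have cJ : continuous J.
  by move=> x; apply: cvgB; apply: cvgM; exact: cpd.
pose B p := jac (row_of_pair \o psi) p.
have detB p : \det (B p) = J p by rewrite det2 !jac_row_of_pair.
have J0 p : J p != 0.
  rewrite -detB; apply/eqP => E.
  have /(congr1 determinant) := jac_inverse _ _ p d sphi spsi Hd.
  by rewrite det_mulmx E mul0r det1 => /esym/eqP; rewrite oner_eq0.
have hE p : h p = rho (psi p) *: (B p *m (B p)^T).
  have AB := jac_inverse _ _ p d sphi spsi Hd.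
  have [_ Hp] := Hrho (psi p).
  have conj (A C G : 'M[R]_2) (e : R) : C *m A = 1%:M -> A *m G *m A^T = e%:M ->
      G = e *: (C *m C^T).
    move=> CA AGA; rewrite -[LHS]mul1mx -CA -[LHS]mulmx1 -[X in _ *m X]trmx1 -CA trmx_mul.
    rewrite -!mulmxA (mulmxA A G) (mulmxA (A *m G)) AGA.
    by rewrite mul_scalar_mx -scalemxAr.
  have -> : h p = h (phi (psi p)) by rewrite (hper (phi (psi p)) p).
  exact: (conj _ _ _ _ AB Hp).
(* The factor [rho] cancels: in dimension two the integrand is invariant under conformal
   rescaling. *)
have eE p : h p 0 0 / Num.sqrt (\det (h p)) =
    (pd 0 x1 p ^+ 2 + pd 0 x2 p ^+ 2) / `|J p|.
  have [rp _] := Hrho (psi p).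
  rewrite hE detZ det_mulmx det_tr detB -expr2 -exprMn sqrtr_sqr normrM gtr0_norm//.
  rewrite mxE mxE sum2 ![(B p)^T _ _]mxE /B !jac_row_of_pair//= -!expr2 -/x1 -/x2.
  by rewrite invfM mulrACA divff ?mul1r// gt_eqF.
have [s [ss sJ]] := nonvanishing_sign J cJ J0.
(* Squared length of the lattice vector to which [psi] sends the period [(2 * pi, 0)]. This vector
   is nonzero, and nonzero vectors of the lattice have length at least 1 because [1 <= c]. *)
pose K : R := k1%:~R ^+ 2 + (c * l1%:~R) ^+ 2.
have K1 : 1 <= K.
  have le1 (z : int) : z != 0 -> 1 <= z%:~R ^+ 2 :> R.
    move=> z0; rewrite -[z%:~R ^+ 2]rmorphXn/= -[1]/(1%:~R) ler_int.
    by rewrite -gtz0_ge1 exprn_even_gt0.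
  have [k0|k0] := eqVneq k1 0; last first.
    by rewrite /K; apply: le_trans (le1 _ k0) _; rewrite lerDl sqr_ge0.
  have l0 : l1 != 0 by move: kl0; rewrite k0; apply: contra => /eqP ->.
  rewrite /K; apply: (@le_trans _ _ ((c * l1%:~R) ^+ 2)); last by rewrite lerDr sqr_ge0.
  by rewrite exprMn; apply: mulr_ege1; [exact: exprn_ege1|exact: le1].
(* This value maximises [2 * b * (2 * pi * K) - b ^+ 2 * K * c], the integral of [low]. *)
pose b : R := 2 * pi / c.
(* Expanding the squared norm of psi_u - b |J| (k1, c l1) and dividing by |J| gives the lower bound.
   It is linear in the derivatives and in the Jacobian, so its integral is determined by the
   periods. *)
pose low p := 2 * b * (k1%:~R * pd 0 x1 p + c * l1%:~R * pd 0 x2 p) - b ^+ 2 * K * (s * J p).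
have b0 : 0 < b by rewrite divr_gt0 ?two_pi_gt0.
have lowP p : low p <= h p 0 0 / Num.sqrt (\det (h p)).
  rewrite eE /low -sJ; have : 0 < `|J p| by rewrite normr_gt0.
  move: `|J p| (pd 0 x1 p) (pd 0 x2 p) => j a1 a2 j0.
  rewrite ler_pdivlMr// /K -subr_ge0.
  have -> : a1 ^+ 2 + a2 ^+ 2 - (2 * b * (k1%:~R * a1 + c * l1%:~R * a2) -
      b ^+ 2 * (k1%:~R ^+ 2 + (c * l1%:~R) ^+ 2) * j) * j =
    (a1 - b * j * k1%:~R) ^+ 2 + (a2 - b * j * (c * l1%:~R)) ^+ 2 by ring.
  by rewrite addr_ge0// sqr_ge0.
have clow : continuous low.
  move=> x; apply: cvgB; apply: cvgM; try exact: cvg_cst.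
    by apply: cvgD; apply: cvgM; try exact: cvg_cst; exact: cpd.
  by apply: cvgM; [exact: cvg_cst|exact: cJ].
have LE : \int[mu2]_(p in cell) low p <=
    \int[mu2]_(p in cell) (h p 0 0 / Num.sqrt (\det (h p))).
  apply: le_Rintegral; first exact: measurable_cell.
  - exact: continuous_integrable_cell.
  - exact: continuous_integrable_cell.
  - by move=> p _; exact: lowP.
apply: le_trans LE.
have P11 p : x1 (p + (2 * pi, 0)) = x1 p + k1%:~R by rewrite /x1 P1.
have P12 p : x2 (p + (2 * pi, 0)) = x2 p + c * l1%:~R by rewrite /x2 P1.
have P21 p : x1 (p + (0, 2 * pi)) = x1 p + k2%:~R by rewrite /x1 P2.
have P22 p : x2 (p + (0, 2 * pi)) = x2 p + c * l2%:~R by rewrite /x2 P2.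
have IJ := Rintegral_jacobian x1 x2 _ _ _ _ s1 s2 P11 P12 P21 P22.
(* The area of the torus with periods (1, 0) and (0, c) is [c], and [psi] has degree 1 or -1. *)
have IsJ : s * \int[mu2]_(p in cell) J p = c.
  have ge0 : 0 <= s * \int[mu2]_(p in cell) J p.
    rewrite -cell_RintegralZ//; apply: Rintegral_ge0 => p _.
    by rewrite -sJ.
  rewrite -[LHS]ger0_norm// IJ.
  have -> : k1%:~R * (c * l2%:~R) - c * l1%:~R * k2%:~R = c * (k1 * l2 - l1 * k2)%:~R.
    by rewrite intrB !intrM; ring.
  have s1' : `|s| = 1.
    by apply/eqP; rewrite -(@eqrXn2 _ 2)// ?normr_ge0// real_normK ?num_real// ss expr1n.
  by rewrite !normrM s1' mul1r -intr_norm Dkl mulr1 gtr0_norm.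
have cZ (k : R) f : continuous f -> continuous (fun p : R * R => k * f p).
  by move=> cf x; apply: cvgM; [exact: cvg_cst|exact: cf].
have c01 := cpd 0 _ s1; have c02 := cpd 0 _ s2.
have cA : continuous (fun p => k1%:~R * pd 0 x1 p + c * l1%:~R * pd 0 x2 p).
  by move=> x; apply: cvgD; [exact: (cZ k1%:~R _ c01)|exact: (cZ (c * l1%:~R) _ c02)].
have IA : \int[mu2]_(p in cell) (k1%:~R * pd 0 x1 p + c * l1%:~R * pd 0 x2 p) =
    2 * pi * K.
  apply: etrans (cell_RintegralD _ _ (cZ k1%:~R _ c01) (cZ (c * l1%:~R) _ c02)) _.
  apply: etrans (congr2 +%R (cell_RintegralZ _ _ c01) (cell_RintegralZ _ _ c02)) _.
  apply: etrans (congr2 (fun x y => k1%:~R * x + c * l1%:~R * y)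
    (Rintegral_pd0_period _ _ s1 P11) (Rintegral_pd0_period _ _ s2 P12)) _.
  by rewrite /K; ring.
have Ilow : \int[mu2]_(p in cell) low p = 2 * b * (2 * pi * K) - b ^+ 2 * K * c.
  apply: etrans (cell_RintegralB _ _ (cZ (2 * b) _ cA) (cZ (b ^+ 2 * K) _ (cZ s _ cJ))) _.
  apply: congr2; first exact: etrans (cell_RintegralZ _ _ cA) (congr1 _ IA).
  congr (- _); apply: etrans (cell_RintegralZ _ _ (cZ s _ cJ)) (congr1 _ _).
  exact: etrans (cell_RintegralZ _ _ cJ) IsJ.
rewrite Ilow; apply: (@le_trans _ _ ((2 * pi) ^+ 2 / c * K)).
  by rewrite ler_peMr// divr_ge0// ?sqr_ge0// ltW.
rewrite le_eqVlt; apply/orP; left; apply/eqP; rewrite /b.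
by field; rewrite gt_eqF.
Qed.

End ExtremalLengthBound.

(** * The energy density of a metric and its differential *)

Section ConformalEnergy.
Context {R : realType}.
Implicit Types (p q : R * R) (i : 'I_2).

Lemma dotE n (u v : 'rV[R]_n) : dot u v = \sum_j u 0 j * v 0 j.
Proof. by rewrite /dot mxE; apply: eq_bigr => j _; rewrite mxE. Qed.

Lemma dot_ge0 n (u : 'rV[R]_n) : 0 <= dot u u.
Proof. by rewrite dotE; apply: sumr_ge0 => j _; rewrite -expr2 sqr_ge0. Qed.

Lemma dot_eq0 n (u : 'rV[R]_n) : dot u u = 0 -> u = 0.
Proof.
rewrite dotE => /eqP; rewrite psumr_eq0; last by move=> j _; rewrite -expr2 sqr_ge0.
move=> /allP H; apply/rowP => j; have := H j (mem_index_enum j).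
by rewrite mxE -expr2 sqrf_eq0 => /eqP.
Qed.

Lemma dot_gt0 n (u : 'rV[R]_n) : u != 0 -> 0 < dot u u.
Proof.
by move=> u0; rewrite lt_neqAle dot_ge0 andbT eq_sym; apply: contra u0 => /eqP/dot_eq0/eqP.
Qed.

Lemma gram_gt0 n (J : 'M[R]_(2, n)) : row_free J ->
  [/\ 0 < (J *m J^T) 0 0, 0 < (J *m J^T) 1 1 & 0 < \det (J *m J^T)].
Proof.
move=> fJ; pose G := J *m J^T.
have xG (x : 'rV[R]_2) : x != 0 -> 0 < (x *m G *m x^T) 0 0.
  move=> x0; have -> : (x *m G *m x^T) 0 0 = dot (x *m J) (x *m J).
    by rewrite /dot trmx_mul /G !mulmxA.
  apply: dot_gt0; apply: contra x0 => /eqP xJ; apply/eqP.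
  by apply: (row_free_inj fJ); rewrite xJ mul0mx.
have Gs : G 1 0 = G 0 1.
  have /matrixP/(_ 0 1) : G^T = G by rewrite /G trmx_mul trmxK.
  by rewrite mxE.
have xGE (a b : R) : (a != 0) || (b != 0) -> 0 < a * a * G 0 0 + 2 * a * b * G 0 1 + b * b * G 1 1.
  move=> ab; pose x : 'rV[R]_2 := \row_j (if j == 0 then a else b).
  have x0 : x != 0.
    apply: contraL ab => /eqP/rowP H.
    have := H 0; have := H 1; rewrite !mxE /= => -> ->.
    by rewrite eqxx.
  have := xG x x0; rewrite mxE sum2 ![x^T _ _]mxE ![(x *m G) _ _]mxE !sum2 ![x _ _]mxE /= Gs.
  by move: (G 0 0) (G 0 1) (G 1 1) => g0 g1 g2; lra.
have G0 : 0 < G 0 0.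
  by have := xGE 1 0; rewrite oner_neq0 => /(_ isT); rewrite !mulr0 !mul0r !mul1r !addr0.
have G1 : 0 < G 1 1.
  by have := xGE 0 1; rewrite oner_neq0 orbT => /(_ isT); rewrite !mulr0 !mul0r !mul1r !add0r.
split=> //; rewrite det2 -/G Gs.
(* This test vector gives the quadratic form the value [G 1 1 * \det G]. *)
have := xGE (G 1 1) (- G 0 1); rewrite (gt_eqF G1) => /(_ isT) H.
have : 0 < G 1 1 * (G 0 0 * G 1 1 - G 0 1 * G 0 1) by move: H; move: (G 0 0) (G 0 1) (G 1 1) => g0 g1 g2; lra.
by rewrite pmulr_rgt0.
Qed.

(** Density of the length-area functional; it is unchanged when [M] is multiplied by a positive
    scalar. *)
Definition energy (M : 'M[R]_2) : R := M 0 0 / Num.sqrt (\det M).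

(** The differential of [energy] at [M] in the direction [dM]. *)
Definition denergy (M dM : 'M[R]_2) : R :=
  dM 0 0 / Num.sqrt (\det M) -
  M 0 0 * (dM 0 0 * M 1 1 + M 0 0 * dM 1 1 - dM 0 1 * M 1 0 - M 0 1 * dM 1 0) /
  (2 * \det M * Num.sqrt (\det M)).

Lemma is_derive_energy (M : R -> 'M[R]_2) (dM : 'M[R]_2) (t : R) :
  (forall i j, is_derive t (1 : R) (fun s => M s i j) (dM i j)) ->
  0 < \det (M t) ->
  is_derive t (1 : R) (fun s => energy (M s)) (denergy (M t) dM).
Proof.
move=> HM D0.
have E : (fun s => \det (M s)) = (fun s => M s 0 0 * M s 1 1 - M s 0 1 * M s 1 0).
  by apply/funext => s; rewrite det2.
have mul (f g : R -> R) (f' g' : R) : is_derive t (1 : R) f f' -> is_derive t (1 : R) g g' ->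
    is_derive t (1 : R) (fun s => f s * g s) (f' * g t + f t * g').
  move=> Hf Hg; have H := is_deriveM Hf Hg; apply: (is_derive_eq H).
  by rewrite /GRing.scale/= addrC mulrC.
have dD : is_derive t (1 : R) (fun s => \det (M s))
    (dM 0 0 * M t 1 1 + M t 0 0 * dM 1 1 - (dM 0 1 * M t 1 0 + M t 0 1 * dM 1 0)).
  by rewrite E; apply: is_deriveB; apply: mul.
have S0 : 0 < Num.sqrt (\det (M t)) by rewrite sqrtr_gt0.
have dS : is_derive t (1 : R) (fun s => Num.sqrt (\det (M s))) ((2 * Num.sqrt (\det (M t)))^-1 *
    (dM 0 0 * M t 1 1 + M t 0 0 * dM 1 1 - (dM 0 1 * M t 1 0 + M t 0 1 * dM 1 0))).
  exact: (is_derive1_comp (is_derive1_sqrt D0) dD).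
have dV : is_derive t (1 : R) (fun s => (Num.sqrt (\det (M s)))^-1)
    (- (Num.sqrt (\det (M t))) ^- 2 * ((2 * Num.sqrt (\det (M t)))^-1 *
    (dM 0 0 * M t 1 1 + M t 0 0 * dM 1 1 - (dM 0 1 * M t 1 0 + M t 0 1 * dM 1 0)))).
  have [d1 d2] := dS; split; first by apply: derivableV => //; rewrite gt_eqF.
  by rewrite deriveV ?gt_eqF// d2.
have H := mul _ _ _ _ (HM 0 0) dV.
apply: (is_derive_eq H); rewrite /denergy.
have SS : \det (M t) = Num.sqrt (\det (M t)) ^+ 2 by rewrite sqr_sqrtr// ltW.
rewrite [in 2 * \det (M t)]SS.
move: (Num.sqrt _) S0 {SS H dV dS dD} => S S0.
move: (M t 0 0) (M t 1 1) (M t 0 1) (M t 1 0) (dM 0 0) (dM 1 1) (dM 0 1) (dM 1 0).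
by move=> *; field; rewrite gt_eqF.
Qed.

End ConformalEnergy.

(** * First variation of the energy along a family of immersions *)

Lemma cvg_sumr {R : realType} {T : Type} (G : set_system T) {FG : Filter G} n
    (f : 'I_n -> T -> R) (l : 'I_n -> R) :
  (forall k, f k x @[x --> G] --> l k) -> \sum_k f k x @[x --> G] --> \sum_k l k.
Proof.
elim: n f l => [|n IH] f l H.
  rewrite big_ord0 (_ : (fun x => _) = (fun=> 0)); first exact: cvg_cst.
  by apply/funext => x; rewrite big_ord0.
rewrite big_ord_recl (_ : (fun x => _) = (fun x => f ord0 x + \sum_k f (lift ord0 k) x)).
  by apply: cvgD; [exact: H|apply: IH => k; exact: H].
by apply/funext => x; rewrite big_ord_recl.
Qed.

Lemma cvg_congr {R : realType} {T : Type} (G : set_system T) (f g : T -> R) (l m : R) :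
  f =1 g -> l = m -> g x @[x --> G] --> m -> f x @[x --> G] --> l.
Proof. by move=> /funext -> ->. Qed.

Section FamilyPartial.
Context {R : realType}.
Implicit Types (p q : R * R) (i : 'I_2).

(** This is [schwarz] in the plane spanned by time and the direction [dir i]: the mixed derivative
    taken first in time exists near [(t, p)] and is continuous there at that point, which yields the
    one taken first in space. *)
Lemma is_derive_pd_family (f ft : R -> R * R -> R) (t d : R) p i : 0 < d ->
  (forall x, `|x - t| < d -> smooth (f x)) ->
  (forall x, `|x - t| < d -> smooth (ft x)) ->
  (forall x q, `|x - t| < d -> is_derive x (1 : R) (f ^~ q) (ft x q)) ->
  pd i (ft y.1) y.2 @[y --> (t, p)] --> pd i (ft t) p ->
  is_derive t (1 : R) (fun s => pd i (f s) p) (pd i (ft t) p).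
Proof.
move=> d0 sf sft df cft.
have line (g : R * R -> R) y : smooth g ->
    is_derive y (1 : R) (fun s : R => g (s *: dir i + p)) (pd i g (y *: dir i + p)).
  by move=> sg; apply: is_derive_line; apply: derivableP; exact: smooth_derivable.
apply: (@schwarz R (fun x y => f x (y *: dir i + p)) (fun x y => ft x (y *: dir i + p))
  (fun x y => pd i (ft x) (y *: dir i + p)) (fun s => pd i (f s) p) t d _ d0).
- by move=> x y xd _; exact: df.
- by move=> x xd; have := line (f x) 0 (sf x xd); rewrite scale0r add0r.
- by move=> x y xd _; apply: line; exact: sft.
move=> r r0; move/cvgrPdist_lt: cft => /(_ r r0)/nbhs_ballP[d1 /= d10 H1].
exists d1 => // x y xd yd; apply: ltW.
rewrite distrC; apply: (H1 (x, y *: dir i + p)); split; first by rewrite /ball/= distrC.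
have pp : ball p d1 p by exact: ballxx.
have i01 : i = 0 \/ i = 1.
  by case: (i) => -[|[|//]] Hi; [left|right]; exact: val_inj.
case: i01 => ->; rewrite ?scale_dir0 ?scale_dir1; split; rewrite /ball/=.
- by rewrite opprD addrCA subrr addr0 normrN.
- by rewrite subrr normr0.
- by rewrite subrr normr0.
- by rewrite opprD addrCA subrr addr0 normrN.
Qed.

End FamilyPartial.

Section FirstVariation.
Context {R : realType} {n : nat} (e : R) (F : R -> R * R -> 'rV[R]_n).
Implicit Types (p q : R * R) (i : 'I_2).
Hypothesis e0 : 0 < e.
Let I : set R := `]-e, e[.
Let Ft t p := derive1 (F ^~ p) t.
Hypothesis sF : smooth_family I F.
Hypothesis sFt : smooth_family I Ft.
Hypothesis dF : forall t, I t -> forall p, derivable (F ^~ p) t 1.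

Local Notation mu := (@lebesgue_measure R).
Local Notation mu2 := (mu \x mu)%E.

Let Iball t : I t -> exists2 d, 0 < d & forall x, `|x - t| < d -> I x.
Proof.
rewrite /I/= in_itv/= => /andP[t1 t2]; exists (Num.min (t + e) (e - t)).
  by rewrite lt_min; apply/andP; split; lra.
move=> x; rewrite lt_min !ltr_norml => /andP[/andP[? ?] /andP[? ?]].
by rewrite in_itv/=; apply/andP; split; lra.
Qed.

(** The product of [I] with the plane is open, so continuity within it is plain continuity. Joint
    limits in time and space later bound the integrand over a compact set. *)
Lemma family_jac_cvg (G : R -> R * R -> 'rV[R]_n) i k (x : R * (R * R)) :
  smooth_family I G -> I x.1 ->
  jac (G y.1) y.2 i k @[y --> x] --> jac (G x.1) x.2 i k.
Proof.
move=> [_ /(_ [:: i]) cG] Ix.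
have oA : open (I `*` [set: R * R]).
  have /continuousP cfst : continuous (fst : R * (R * R) -> R) by move=> y; exact: cvg_fst.
  have -> : I `*` [set: R * R] = fst @^-1` I by apply/seteqP; split=> y // [].
  by apply: cfst; exact: interval_open.
move: cG; rewrite continuous_open_subspace// => /(_ x); rewrite inE => /(_ (conj Ix Logic.I)).
move=> cG.
have E : (fun y : R * (R * R) => jac (G y.1) y.2 i k) =
    (fun M : 'rV[R]_n => M 0 k) \o (fun y : R * (R * R) => ipd [:: i] (G y.1) y.2).
  by apply/funext => y; rewrite /= mxE.
have Ex : jac (G x.1) x.2 i k = ipd [:: i] (G x.1) x.2 0 k by rewrite mxE.
by rewrite E Ex; exact: (cvg_comp _ _ cG (@coord_continuous R 1 n 0 k _)).
Qed.

Lemma is_derive_jac t p i k : I t ->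
  is_derive t (1 : R) (fun s => jac (F s) p i k) (jac (Ft t) p i k).
Proof.
move=> It; have [d d0 dI] := Iball t It.
have sFk := smooth_family_coord _ _ _ k sF.
have sFtk := smooth_family_coord _ _ _ k sFt.
rewrite [X in is_derive _ _ _ X](jacE _ _ _ _ _ (proj1 sFt t It)).
suff H : is_derive t (1 : R) (fun s => pd i (fun q => F s q 0 k) p)
    (pd i (fun q => Ft t q 0 k) p).
  apply: near_eq_is_derive H; apply/nbhs_ballP; exists d => //= s.
  by rewrite /ball/= distrC => /dI Is; rewrite (jacE _ _ _ _ _ (proj1 sF s Is)).
apply: (is_derive_pd_family (fun x q => F x q 0 k) (fun x q => Ft x q 0 k) t d p i d0).
- by move=> x /dI; exact: (proj1 sFk).
- by move=> x /dI; exact: (proj1 sFtk).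
- move=> x q /dI Ix; have H := derivableP (dF x Ix q).
  have := @is_derive_lin R _ _ (fun M : 'rV[R]_n => M 0 k) _ _ _ _ _ _ _ _ H.
  rewrite /Ft derive1E; apply.
  + by move=> u v; rewrite !mxE.
  + by move=> a u; rewrite !mxE.
  + exact: coord_continuous.
- have H : jac (Ft y.1) y.2 i k @[y --> (t, p)] --> jac (Ft t) p i k.
    exact: family_jac_cvg Ft i k (t, p) sFt It.
  rewrite [X in _ --> X](jacE _ _ _ _ _ (proj1 sFt t It)) in H.
  apply: cvg_trans H; apply: near_eq_cvg.
  apply/(nbhs_ballP (t, p)); exists d => //= -[x q] [/= xd _].
  have Ix : I x by apply: dI; rewrite distrC.
  by rewrite (jacE _ _ _ _ _ (proj1 sFt x Ix)).
Qed.

Definition dmetric (f V : R * R -> 'rV[R]_n) p : 'M[R]_2 :=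
  jac V p *m (jac f p)^T + jac f p *m (jac V p)^T.

Lemma dmetricE f V p i j : dmetric f V p i j =
  \sum_k (jac V p i k * jac f p j k + jac f p i k * jac V p j k).
Proof.
rewrite /dmetric [LHS]mxE [X in X + _ = _]mxE [X in _ + X = _]mxE -big_split /=.
by apply: eq_bigr => k _; rewrite ![(_ ^T) _ _]mxE.
Qed.

Lemma metricE (f : R * R -> 'rV[R]_n) p i j :
  metric f p i j = \sum_k jac f p i k * jac f p j k.
Proof. by rewrite /metric mxE; apply: eq_bigr => k _; rewrite [(_ ^T) _ _]mxE. Qed.

Lemma is_derive_metric t p i j : I t ->
  is_derive t (1 : R) (fun s => metric (F s) p i j) (dmetric (F t) (Ft t) p i j).
Proof.
move=> It; have Ex := dmetricE (F t) (Ft t) p i j; rewrite Ex.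
have -> : (fun s => metric (F s) p i j) =
    \sum_k (fun s => jac (F s) p i k * jac (F s) p j k).
  by apply/funext => s; rewrite metricE fct_sumE.
apply: is_derive_sum => k.
have H := is_deriveM (is_derive_jac t p i k It) (is_derive_jac t p j k It).
by apply: (is_derive_eq H); rewrite /GRing.scale/= addrC mulrC.
Qed.

Hypothesis iF : forall t, I t -> immersion (F t).

Let detF t p : I t -> 0 < \det (metric (F t) p).
Proof. by move=> /iF[_ _ /(_ p) /gram_gt0[]]. Qed.

Let cvg_metric (x : R * (R * R)) i j : I x.1 ->
  metric (F y.1) y.2 i j @[y --> x] --> metric (F x.1) x.2 i j.
Proof.
move=> Ix.
refine (cvg_congr _ _ _ _ _ (fun y => metricE (F y.1) y.2 i j) (metricE (F x.1) x.2 i j) _).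
by apply: cvg_sumr => k; apply: cvgM; exact: family_jac_cvg.
Qed.

Let cvg_dmetric (x : R * (R * R)) i j : I x.1 ->
  dmetric (F y.1) (Ft y.1) y.2 i j @[y --> x] --> dmetric (F x.1) (Ft x.1) x.2 i j.
Proof.
move=> Ix.
refine (cvg_congr _ _ _ _ _ (fun y => dmetricE (F y.1) (Ft y.1) y.2 i j)
  (dmetricE (F x.1) (Ft x.1) x.2 i j) _).
by apply: cvg_sumr => k; apply: cvgD; apply: cvgM; exact: family_jac_cvg.
Qed.

Let cvg_det (x : R * (R * R)) : I x.1 ->
  \det (metric (F y.1) y.2) @[y --> x] --> \det (metric (F x.1) x.2).
Proof.
move=> Ix.
refine (cvg_congr _ _ _ _ _ (fun y => det2 (metric (F y.1) y.2)) (det2 (metric (F x.1) x.2)) _).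
by apply: cvgB; apply: cvgM; exact: cvg_metric.
Qed.

Let cvg_sqrt_det (x : R * (R * R)) : I x.1 ->
  Num.sqrt (\det (metric (F y.1) y.2)) @[y --> x] --> Num.sqrt (\det (metric (F x.1) x.2)).
Proof. by move=> Ix; exact: (cvg_comp _ _ (cvg_det x Ix) (@sqrt_continuous R _)). Qed.

Let cvg_energy (x : R * (R * R)) : I x.1 ->
  energy (metric (F y.1) y.2) @[y --> x] --> energy (metric (F x.1) x.2).
Proof.
move=> Ix; apply: cvgM; first exact: cvg_metric.
by apply: cvgV; [rewrite gt_eqF// sqrtr_gt0 detF|exact: cvg_sqrt_det].
Qed.

Let cvg_denergy (x : R * (R * R)) : I x.1 ->
  denergy (metric (F y.1) y.2) (dmetric (F y.1) (Ft y.1) y.2) @[y --> x] -->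
  denergy (metric (F x.1) x.2) (dmetric (F x.1) (Ft x.1) x.2).
Proof.
move=> Ix; have D0 := detF x.1 x.2 Ix.
have S0 : 0 < Num.sqrt (\det (metric (F x.1) x.2)) by rewrite sqrtr_gt0.
apply: cvgB.
  apply: cvgM; first exact: cvg_dmetric.
  by apply: cvgV; [rewrite gt_eqF|exact: cvg_sqrt_det].
apply: cvgM.
  apply: cvgM; first exact: cvg_metric.
  apply: cvgB; [apply: cvgB; [apply: cvgD|]|]; apply: cvgM;
    try exact: cvg_metric; exact: cvg_dmetric.
apply: cvgV; first by rewrite gt_eqF// !mulr_gt0.
by apply: cvgM; [apply: cvgM; [exact: cvg_cst|exact: cvg_det]|exact: cvg_sqrt_det].
Qed.

Let continuous_slice (g : R * (R * R) -> R) t :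
  (forall x, I x.1 -> g y @[y --> x] --> g x) -> I t -> continuous (fun p => g (t, p)).
Proof.
move=> cg It p.
exact: (cvg_comp _ _ (cvg_pair (cvg_cst t) (@cvg_id _ (nbhs p))) (cg (t, p) It)).
Qed.

Lemma continuous_energy t : I t -> continuous (fun p => energy (metric (F t) p)).
Proof. exact: (continuous_slice (fun x => energy (metric (F x.1) x.2))). Qed.

(** An interior minimum in time has zero derivative, and this derivative is computed under the
    integral sign. *)
Lemma first_variation_energy :
  (forall t, I t -> \int[mu2]_(p in cell) energy (metric (F 0) p) <=
                    \int[mu2]_(p in cell) energy (metric (F t) p)) ->
  \int[mu2]_(p in cell) denergy (metric (F 0) p) (dmetric (F 0) (Ft 0) p) = 0.
Proof.
move=> Hmin.
(* On the smaller interval the time derivative of the integrand is bounded, by compactness of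
   [[-h, h]] times the closed cell; this constant is the dominating function. *)
pose h := e / 2; have h0 : 0 < h by rewrite divr_gt0.
have hI t : `]-h, h[%classic t -> I t.
  rewrite /I/= !in_itv/= /h => /andP[h1 h2]; have h3 := e0.
  by apply/andP; split; lra.
have hIc t : `[-h, h]%classic t -> I t.
  rewrite /I/= !in_itv/= /h => /andP[h1 h2]; have h3 := e0.
  by apply/andP; split; lra.
have d1 t p : I t -> is_derive t (1 : R) (fun s => energy (metric (F s) p))
    (denergy (metric (F t) p) (dmetric (F t) (Ft t) p)).
  by move=> It; apply: is_derive_energy; [move=> i j; exact: is_derive_metric|exact: detF].
have [M HM] : exists M : R, forall t p, `]-h, h[%classic t -> cell p ->
    `|denergy (metric (F t) p) (dmetric (F t) (Ft t) p)| <= M.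
  pose K : set (R * (R * R)) := `[-h, h] `*` (`[0, 2 * pi] `*` `[0, 2 * pi]).
  have cK : compact K by apply: compact_setX; [|apply: compact_setX]; exact: segment_compact.
  pose g (x : R * (R * R)) := denergy (metric (F x.1) x.2) (dmetric (F x.1) (Ft x.1) x.2).
  have cg : {within K, continuous g}.
    apply: continuous_in_subspaceT => x; rewrite inE => -[x1 _].
    by apply: cvg_denergy; exact: hIc.
  have /compact_bounded[M [_ HM]] := continuous_compact cg cK.
  exists (M + 1) => t p th [p1 p2]; apply: (HM (M + 1)); first by rewrite ltrDl.
  exists (t, p) => //; split; first exact: subset_itv_oo_cc th.
  by split; [move: p1|move: p2]; rewrite /= !in_itv/= => /andP[-> /ltW ->].
pose f t p := energy (metric (F t) p).
have partE t p : I t -> partial1of2 f t p = denergy (metric (F t) p) (dmetric (F t) (Ft t) p).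
  by move=> It; rewrite partial1of2E; case: (d1 t p It).
have intf t : `]-h, h[%classic t -> mu2.-integrable cell (EFin \o f t).
  by move=> /hI It; apply: continuous_integrable_cell; exact: continuous_energy.
have derf t p : `]-h, h[%classic t -> cell p -> derivable (f ^~ p) t 1.
  by move=> /hI It _; case: (d1 t p It).
have M0 (p : R * R) : 0 <= `|M| by exact: normr_ge0.
have intM : mu2.-integrable cell (EFin \o (fun _ : R * R => `|M|)).
  by apply: continuous_integrable_cell => x; exact: cvg_cst.
have Mub t p : `]-h, h[%classic t -> cell p -> `|partial1of2 f t p| <= `|M|.
  move=> th cp; rewrite partE; last exact: hI.
  by apply: le_trans (HM t p th cp) _; exact: ler_norm.
have I0 : `]-h, h[%classic (0 : R) by rewrite /= in_itv/= oppr_lt0 h0.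
have D t (th : `]-h, h[%classic t) :=
  @derivable_under_integral R _ _ mu2 f cell measurable_cell t (-h) h th intf derf _ M0 intM Mub.
have E2 : (fun p => denergy (metric (F 0) p) (dmetric (F 0) (Ft 0) p)) = partial1of2 f 0.
  by apply/funext => p; exact: (esym (partE 0 p (hI 0 I0))).
rewrite E2.
have DE := @differentiation_under_integral R _ _ mu2 f cell measurable_cell
  0 (-h) h I0 intf derf _ M0 intM Mub.
have hh : -h <= h by rewrite ge0_cp// ltW.
have [_] := @derive1_at_min R (fun t => \int[mu2]_(p in cell) f t p) (-h) h 0 hh D I0
  (fun t th => Hmin t (hI t th)).
by rewrite -derive1E DE => H; exact: H.
Qed.

End FirstVariation.

(** * Orthogonality to the closed span in L^2 *)

Section L2Projection.
Context {R : realType}.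
Implicit Types (p q : R * R).

Local Notation mu := (@lebesgue_measure R).
Local Notation mu2 := (mu \x mu)%E.
Local Notation mR2 := (measurableTypeR R * measurableTypeR R)%type.

Lemma continuous_jac n (f : R * R -> 'rV[R]_n) i k : smooth f ->
  continuous (fun p => jac f p i k).
Proof.
move=> sf x.
refine (cvg_congr _ _ _ _ _ (fun y => jacE n f y i k sf) (jacE n f x i k sf) _).
exact: (smooth_continuous _ (smooth_pd _ i (smooth_coord n f k sf))).
Qed.

Lemma continuous_metric n (f : R * R -> 'rV[R]_n) i j : smooth f ->
  continuous (fun p => metric f p i j).
Proof.
move=> sf x.
refine (cvg_congr _ _ _ _ _ (fun y => metricE f y i j) (metricE f x i j) _).
by apply: cvg_sumr => k; apply: cvgM; exact: continuous_jac.
Qed.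

Lemma continuous_area n (f : R * R -> 'rV[R]_n) : smooth f -> continuous (area f).
Proof.
move=> sf x; rewrite /area.
have cd : \det (metric f y) @[y --> x] --> \det (metric f x).
  refine (cvg_congr _ _ _ _ _ (fun y => det2 (metric f y)) (det2 (metric f x)) _).
  by apply: cvgB; apply: cvgM; exact: continuous_metric.
exact: (cvg_comp _ _ cd (@sqrt_continuous R _)).
Qed.

Lemma area_gt0 n (f : R * R -> 'rV[R]_n) p : immersion f -> 0 < area f p.
Proof. by move=> [_ _ /(_ p) /gram_gt0[_ _ D0]]; rewrite /area sqrtr_gt0. Qed.

Lemma continuous_dot n (u v : R * R -> 'rV[R]_n) :
  (forall j, continuous (fun p => u p 0 j)) -> (forall j, continuous (fun p => v p 0 j)) ->
  continuous (fun p => dot (u p) (v p)).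
Proof.
move=> cu cv x.
refine (cvg_congr _ _ _ _ _ (fun y => dotE n (u y) (v y)) (dotE n (u x) (v x)) _).
by apply: cvg_sumr => k; apply: cvgM; [exact: cu|exact: cv].
Qed.

Lemma dotDr n (u v w : 'rV[R]_n) : dot u (v + w) = dot u v + dot u w.
Proof. by rewrite /dot linearD mulmxDr mxE. Qed.

Lemma dotZr n (u v : 'rV[R]_n) (a : R) : dot u (a *: v) = a * dot u v.
Proof. by rewrite /dot linearZ -scalemxAr mxE. Qed.

Lemma dotZl n (u v : 'rV[R]_n) (a : R) : dot (a *: u) v = a * dot u v.
Proof. by rewrite /dot -scalemxAl mxE. Qed.

Lemma dotC n (u v : 'rV[R]_n) : dot u v = dot v u.
Proof. by rewrite !dotE; apply: eq_bigr => j _; rewrite mulrC. Qed.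

Lemma dotDl n (u v w : 'rV[R]_n) : dot (u + v) w = dot u w + dot v w.
Proof. by rewrite dotC dotDr (dotC _ w u) (dotC _ w v). Qed.

Lemma dot_sumr n k (u : 'rV[R]_n) (v : 'I_k -> 'rV[R]_n) :
  dot u (\sum_i v i) = \sum_i dot u (v i).
Proof.
apply: (big_morph (dot u) (dotDr n u)).
by rewrite dotE big1// => j _; rewrite mxE mulr0.
Qed.

Lemma Rintegral_lin0 k (c : 'I_k -> R) (h : 'I_k -> R * R -> R) :
  (forall i, continuous (h i)) -> (forall i, \int[mu2]_(p in cell) h i p = 0) ->
  \int[mu2]_(p in cell) (\sum_i c i * h i p) = 0.
Proof.
move=> ch h0.
suff [_ ->] : continuous (fun p => \sum_i c i * h i p) /\
  \int[mu2]_(p in cell) (\sum_i c i * h i p) = 0 by [].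
elim: k c h ch h0 => [|k IH] c h ch h0.
  rewrite (_ : (fun p => _) = (fun=> 0)); last by apply/funext => p; rewrite big_ord0.
  by split; [move=> x; exact: cvg_cst|rewrite Rintegral_cst_cell mul0r].
have [c1 I1] := IH (fun i => c (lift ord0 i)) (fun i => h (lift ord0 i))
  (fun i => ch _) (fun i => h0 _).
have c0 : continuous (fun p => c ord0 * h ord0 p).
  by move=> x; apply: cvgM; [exact: cvg_cst|exact: ch].
rewrite (_ : (fun p => _) = (fun p => c ord0 * h ord0 p +
    \sum_i c (lift ord0 i) * h (lift ord0 i) p)); last first.
  by apply/funext => p; rewrite big_ord_recl.
split; first by move=> x; apply: cvgD; [exact: c0|exact: c1].
by rewrite (cell_RintegralD _ _ c0 c1) I1 addr0 (cell_RintegralZ _ _ (ch ord0)) h0 mulr0.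
Qed.

(** The square of [e *: u + s *: v] is nonnegative for [s] equal to 1 or -1. Being linear in the two
    squared norms, the bound integrates directly and stands in for the Cauchy-Schwarz inequality of
    L^2. *)
Lemma dot_AMGM n (u v : 'rV[R]_n) (e : R) : 0 < e ->
  `|dot u v| <= 2^-1 * (e * dot u u + e^-1 * dot v v).
Proof.
move=> e0; have ei : 0 < e^-1 by rewrite invr_gt0.
have H (s : R) : s ^+ 2 = 1 -> - (s * dot u v) <= 2^-1 * (e * dot u u + e^-1 * dot v v).
  move=> s1; have := dot_ge0 n (e *: u + s *: v).
  rewrite dotDl !dotDr !dotZl !dotZr (dotC _ v u) => H.
  have H2 : 0 <= e * dot u u + 2 * (s * dot u v) + e^-1 * dot v v.
    have -> : e * dot u u + 2 * (s * dot u v) + e^-1 * dot v v =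
      e^-1 * (e * (e * dot u u) + e * (s * dot u v) + (s * (e * dot u v) + s ^+ 2 * dot v v)).
      by rewrite s1; field; rewrite gt_eqF.
    apply: mulr_ge0; first exact: ltW.
    by move: H; rewrite expr2 -mulrA.
  by move: H2; lra.
rewrite ler_norml; apply/andP; split.
  by have := H 1; rewrite expr1n mul1r => /(_ erefl); lra.
by have := H (-1); rewrite sqrrN expr1n mulN1r opprK => /(_ erefl).
Qed.

Lemma Rintegral_cellE (h : R * R -> R) : mu2.-integrable cell (EFin \o h) ->
  (\int[mu2]_(p in cell) (h p)%:E = (\int[mu2]_(p in cell) h p)%:E)%E.
Proof.
move=> ih; have F := integrable_fin_num measurable_cell ih.
by rewrite /Rintegral fineK.
Qed.

Lemma integrable_cell_le (a b : R * R -> R) :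
  measurable_fun (cell : set mR2) a -> mu2.-integrable cell (EFin \o b) ->
  (forall p, `|a p| <= b p) -> mu2.-integrable cell (EFin \o a).
Proof.
move=> ma ib ab; apply: (le_integrable measurable_cell _ _ ib).
  exact/measurable_EFinP.
move=> p _ /=; rewrite lee_fin.
by apply: le_trans (ab p) _; exact: ler_norm.
Qed.

(** If [S] in the span is [e]-close to [X], the pairing of [G] with [X] equals its pairing with
    [X - S], which is of order [e]. Since [X] is only measurable, integrability of the products is
    established along with the estimate. *)
Lemma L2_closure_orthogonal (f : R * R -> 'rV[R]_3) (C : set (R * R -> 'rV[R]_3))
    (G : R * R -> 'rV[R]_3) : immersion f ->
  (forall j, continuous (fun p => G p 0 j)) ->
  (forall V, C V -> forall j, continuous (fun p => V p 0 j)) ->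
  (forall V, C V -> \int[mu2]_(p in cell) (dot (G p) (V p) * area f p) = 0) ->
  L2_proj f (L2_closure f (lin_span C)) G (fun=> 0).
Proof.
move=> imf cG cC H.
have ca : continuous (area f) by apply: continuous_area; case: imf.
have dot00 n : dot (0 : 'rV[R]_n) 0 = 0 by rewrite dotE big1// => j _; rewrite mxE mul0r.
split.
  split.
    split; first by move=> j;
      apply: (@continuous_measurable_plane R (fun=> (0 : 'rV[R]_3) 0 j)) => x; exact: cvg_cst.
    rewrite /surf_int (_ : (fun p => _) = (fun=> 0%E)) ?integral0 ?ltry//.
    by apply/funext => p; rewrite dot00 mul0r.
  (* The zero field is the empty linear combination, which belongs to the span of any [C]. *)
  move=> e e0; exists (fun p => \sum_(i < 0) (0 : R) *: (0 : 'rV[R]_3)).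
    by exists 0, (fun=> 0), (fun=> fun=> 0); split => // -[].
  rewrite /L2_inner /surf_int (_ : (fun p => _) = (fun=> 0%E)).
    by rewrite integral0 lte_fin exprn_gt0.
  by apply/funext => p; rewrite big_ord0 /= subrr dot00 mul0r.
move=> X [[mX X2] clX].
have cont1 (u v : R * R -> 'rV[R]_3) : (forall j, continuous (fun p => u p 0 j)) ->
    (forall j, continuous (fun p => v p 0 j)) -> continuous (fun p => dot (u p) (v p) * area f p).
  by move=> cu cv x; apply: cvgM; [exact: (continuous_dot _ _ _ cu cv)|exact: ca].
have meas (u v : R * R -> 'rV[R]_3) :
    (forall j, measurable_fun (cell : set mR2) (fun p => u p 0 j)) ->
    (forall j, measurable_fun (cell : set mR2) (fun p => v p 0 j)) ->
    measurable_fun (cell : set mR2) (fun p => dot (u p) (v p) * area f p).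
  move=> mu1 mv; apply: measurable_funM; last exact: continuous_measurable_plane.
  rewrite (_ : (fun p => _) = (fun p => \sum_j u p 0 j * v p 0 j)); last first.
    by apply/funext => p; rewrite dotE.
  by apply: measurable_sum => j; apply: measurable_funM; [exact: mu1|exact: mv].
have mC (u : R * R -> 'rV[R]_3) : (forall j, continuous (fun p => u p 0 j)) ->
    forall j, measurable_fun (cell : set mR2) (fun p => u p 0 j).
  by move=> cu j; exact: continuous_measurable_plane.
pose K := \int[mu2]_(p in cell) (dot (G p) (G p) * area f p).
have K0 : 0 <= K.
  by apply: Rintegral_ge0 => p _; rewrite mulr_ge0 ?dot_ge0// ltW ?area_gt0.
have key (e : R) : 0 < e -> mu2.-integrable cell (EFin \o (fun p => dot (G p) (X p) * area f p)) /\
    `|\int[mu2]_(p in cell) (dot (G p) (X p) * area f p)| <= 2^-1 * (e * (K + 1)).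
  move=> e0; have [S [k [c [V [CV ES]]]] Hlt] := clX e e0.
  have cS j : continuous (fun p => S p 0 j).
    move=> x; rewrite ES.
    refine (cvg_congr _ _ (fun p => \sum_i c i * V i p 0 j) _ (\sum_i c i * V i x 0 j) _ _ _).
    + by move=> p; rewrite summxE; apply: eq_bigr => i _; rewrite mxE.
    + by rewrite summxE; apply: eq_bigr => i _; rewrite mxE.
    + by apply: cvg_sumr => i; apply: cvgM; [exact: cvg_cst|exact: (cC _ (CV i))].
  pose Y p := X p - S p.
  have mY j : measurable_fun (cell : set mR2) (fun p => Y p 0 j).
    rewrite (_ : (fun p => _) = (fun p => X p 0 j - S p 0 j)); last first.
      by apply/funext => p; rewrite !mxE.
    by apply: measurable_funB; [exact: mX|exact: mC].
  have Y0 p : 0 <= dot (Y p) (Y p) * area f p.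
    by rewrite mulr_ge0 ?dot_ge0// ltW ?area_gt0.
  have iY : mu2.-integrable cell (EFin \o (fun p => dot (Y p) (Y p) * area f p)).
    apply/integrableP; split; first by apply/measurable_EFinP; exact: meas.
    apply: le_lt_trans (ltry (e ^+ 2)); apply: le_trans (ltW Hlt).
    rewrite le_eqVlt; apply/orP; left; apply/eqP.
    by apply: eq_integral => p _ /=; rewrite ger0_norm// Y0.
  have iYle : \int[mu2]_(p in cell) (dot (Y p) (Y p) * area f p) <= e ^+ 2.
    by rewrite -lee_fin -(Rintegral_cellE _ iY); exact: (ltW Hlt).
  have iG : mu2.-integrable cell (EFin \o (fun p => dot (G p) (G p) * area f p)).
    by apply: continuous_integrable_cell; exact: cont1.
  pose bd p := 2^-1 * (e * (dot (G p) (G p) * area f p) + e^-1 * (dot (Y p) (Y p) * area f p)).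
  have ibd0 : mu2.-integrable cell (EFin \o (fun p => e * (dot (G p) (G p) * area f p) +
      e^-1 * (dot (Y p) (Y p) * area f p))).
    have := integrableD measurable_cell (integrableZl measurable_cell e iG)
      (integrableZl measurable_cell (e^-1) iY).
    by apply: (eq_integrable measurable_cell) => p _.
  have ibd : mu2.-integrable cell (EFin \o bd).
    have := integrableZl measurable_cell (2^-1) ibd0.
    by apply: (eq_integrable measurable_cell) => p _.
  have ab p : `|dot (G p) (Y p) * area f p| <= bd p.
    rewrite normrM (gtr0_norm (area_gt0 _ _ _ imf)) /bd.
    have -> : 2^-1 * (e * (dot (G p) (G p) * area f p) + e^-1 * (dot (Y p) (Y p) * area f p)) =
      2^-1 * (e * dot (G p) (G p) + e^-1 * dot (Y p) (Y p)) * area f p by ring.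
    by rewrite ler_wpM2r ?(ltW (area_gt0 _ _ _ imf))// dot_AMGM.
  have iGY : mu2.-integrable cell (EFin \o (fun p => dot (G p) (Y p) * area f p)).
    by apply: (integrable_cell_le _ bd) => //; apply: meas => //; exact: mC.
  have iGS : mu2.-integrable cell (EFin \o (fun p => dot (G p) (S p) * area f p)).
    by apply: continuous_integrable_cell; exact: cont1.
  have E : (fun p => dot (G p) (X p) * area f p) =
           (fun p => dot (G p) (S p) * area f p + dot (G p) (Y p) * area f p).
    by apply/funext => p; rewrite -mulrDl -dotDr /Y addrC subrK.
  have ES0 : \int[mu2]_(p in cell) (dot (G p) (S p) * area f p) = 0.
    rewrite ES (_ : (fun p => _) = (fun p => \sum_i c i * (dot (G p) (V i p) * area f p))); last first.
      apply/funext => p; rewrite dot_sumr mulr_suml; apply: eq_bigr => i _.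
      by rewrite dotZr mulrA.
    by apply: Rintegral_lin0 => i; [apply: cont1 => //; exact: cC|exact: H].
  split.
    by rewrite E; have := integrableD measurable_cell iGS iGY; apply: (eq_integrable measurable_cell) => p _.
  rewrite E (RintegralD measurable_cell iGS iGY) ES0 add0r.
  apply: le_trans (le_normr_Rintegral measurable_cell iGY) _.
  apply: (@le_trans _ _ (\int[mu2]_(p in cell) bd p)).
    by apply: le_Rintegral; [exact: measurable_cell|exact: (integrable_norm iGY)|
      exact: ibd|move=> p _; exact: ab].
  rewrite (RintegralZl _ measurable_cell ibd0).
  rewrite (RintegralD measurable_cell (integrableZl measurable_cell e iG)
      (integrableZl measurable_cell (e^-1) iY)).
  rewrite (RintegralZl _ measurable_cell iG) (RintegralZl _ measurable_cell iY) -/K.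
  rewrite ler_pM2l ?invr_gt0// mulrDr mulr1 lerD2l.
  rewrite mulrC ler_pdivrMr// -expr2; exact: iYle.
have [iX _] := key 1 ltr01.
have X0 : \int[mu2]_(p in cell) (dot (G p) (X p) * area f p) = 0.
  apply/eqP; rewrite -normr_le0; apply/ler_addgt0Pr => e e0; rewrite add0r.
  have K1 : 0 < K + 1 by rewrite ltr_wpDl.
  (* With this value the bound given by [key] becomes exactly [e]. *)
  have [|_] := key (2 * (e / (K + 1))); first by rewrite mulr_gt0// divr_gt0.
  by move/le_trans; apply; rewrite le_eqVlt; apply/orP; left; apply/eqP; field; rewrite gt_eqF.
rewrite /L2_inner /surf_int (_ : (fun p => _) = EFin \o (fun p => dot (G p) (X p) * area f p)); last first.
  by apply/funext => p /=; rewrite subr0.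
by apply: etrans (Rintegral_cellE _ iX) _; rewrite X0.
Qed.

End L2Projection.

(** * Explicit linear algebra in dimensions two and three *)

Section SmallMatrices.
Context {R : realType}.

Lemma invmx2 (A : 'M[R]_2) : \det A != 0 ->
  [/\ invmx A 0 0 = A 1 1 / \det A, invmx A 0 1 = - A 0 1 / \det A,
      invmx A 1 0 = - A 1 0 / \det A & invmx A 1 1 = A 0 0 / \det A].
Proof.
move=> D0.
have i01 (k : 'I_2) : k = 0 \/ k = 1.
  by case: k => -[|[|//]] Hk; [left|right]; exact: val_inj.
pose B : 'M[R]_2 := \matrix_(i, j) (if i == 0 then if j == 0 then A 1 1 / \det A else - A 0 1 / \det A
  else if j == 0 then - A 1 0 / \det A else A 0 0 / \det A).
suff -> : invmx A = B by rewrite !mxE.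
have uA : A \in unitmx by rewrite unitmxE unitfE.
rewrite -[RHS]mul1mx -(mulVmx uA) -mulmxA; suff -> : A *m B = 1%:M by rewrite mulmx1.
move: D0; rewrite /B det2 => D0.
apply/matrixP => i j; rewrite [LHS]mxE sum2 ![(\matrix_(_, _) _) _ _]mxE /= mxE.
by case: (i01 i) => ->; case: (i01 j) => -> /=;
  move: (A 0 0) (A 0 1) (A 1 0) (A 1 1) D0 => a b c d D0; field.
Qed.

(** Ordinals with literal values, so that indexing a literal list computes. *)
Definition o0 : 'I_3 := ord0.
Definition o1 : 'I_3 := @Ordinal 3 1 isT.
Definition o2 : 'I_3 := @Ordinal 3 2 isT.

Lemma ord3P (k : 'I_3) : [\/ k = o0, k = o1 | k = o2].
Proof.
by case: k => -[|[|[|//]]] Hk; [apply: Or31|apply: Or32|apply: Or33]; exact: val_inj.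
Qed.

Lemma sum3 (V : nmodType) (F : 'I_3 -> V) : \sum_k F k = F o0 + F o1 + F o2.
Proof.
rewrite !big_ord_recl big_ord0 addr0 addrA.
by congr (F _ + F _ + F _); exact: val_inj.
Qed.

Lemma dot3 (u v : 'rV[R]_3) :
  dot u v = u 0 o0 * v 0 o0 + u 0 o1 * v 0 o1 + u 0 o2 * v 0 o2.
Proof. by rewrite dotE sum3. Qed.

Lemma crossE (u v : 'rV[R]_3) :
  [/\ cross u v 0 o0 = u 0 o1 * v 0 o2 - u 0 o2 * v 0 o1,
      cross u v 0 o1 = u 0 o2 * v 0 o0 - u 0 o0 * v 0 o2
    & cross u v 0 o2 = u 0 o0 * v 0 o1 - u 0 o1 * v 0 o0].
Proof.
have E k : cross u v 0 k = (-1) ^+ k * (u 0 (lift k 0) * v 0 (lift k 1) - u 0 (lift k 1) * v 0 (lift k 0)).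
  rewrite mxE (expand_det_row _ ord0) (bigD1 k)//= big1 ?addr0; last first.
    by move=> j jk; rewrite !mxE /= (negbTE jk) mul0r.
  rewrite !mxE /= !eqxx mul1r /cofactor add0n; congr (_ * _).
  by rewrite det2 !mxE /= .
have e01 : lift o0 0 = o1 by exact: val_inj.
have e02 : lift o0 1 = o2 by exact: val_inj.
have e10 : lift o1 0 = o0 by exact: val_inj.
have e12 : lift o1 1 = o2 by exact: val_inj.
have e20 : lift o2 0 = o0 by exact: val_inj.
have e21 : lift o2 1 = o1 by exact: val_inj.
rewrite !E e01 e02 e10 e12 e20 e21 /= expr0 expr1 expr2; split; ring.
Qed.

Lemma tr_mul2 (A B : 'M[R]_2) :
  \tr (A *m B) = A 0 0 * B 0 0 + A 0 1 * B 1 0 + A 1 0 * B 0 1 + A 1 1 * B 1 1.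
Proof. by rewrite /mxtrace sum2 ![(A *m B) _ _]mxE !sum2 addrA. Qed.

Lemma mul2E (A B : 'M[R]_2) i j : (A *m B) i j = A i 0 * B 0 j + A i 1 * B 1 j.
Proof. by rewrite mxE sum2. Qed.

Lemma sub_scalar_mxE (A : 'M[R]_2) (a : R) i j : (A - a%:M) i j = A i j - a *+ (i == j).
Proof. by rewrite !mxE. Qed.

Lemma dot3_val (u v : 'rV[R]_3) (a b : 'I_3 -> R) :
  (forall j, u 0 j = a j) -> (forall j, v 0 j = b j) ->
  dot u v = a o0 * b o0 + a o1 * b o1 + a o2 * b o2.
Proof. by move=> ua vb; rewrite dot3 !ua !vb. Qed.

Lemma cross_val (u v : 'rV[R]_3) (a b : 'I_3 -> R) :
  (forall j, u 0 j = a j) -> (forall j, v 0 j = b j) ->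
  [/\ cross u v 0 o0 = a o1 * b o2 - a o2 * b o1,
      cross u v 0 o1 = a o2 * b o0 - a o0 * b o2
    & cross u v 0 o2 = a o0 * b o1 - a o1 * b o0].
Proof. by move=> ua vb; have [-> -> ->] := crossE u v; rewrite !ua !vb. Qed.

End SmallMatrices.

(** * Minimality in the conformal class implies the constrained Willmore condition *)

Section CriticalTori.
Context {R : realType}.
Implicit Types (p q : R * R).

Local Notation mu := (@lebesgue_measure R).
Local Notation mu2 := (mu \x mu)%E.

Lemma plane_continuous_cst (a : R) : continuous (fun _ : R * R => a).
Proof. by move=> x; exact: cvg_cst. Qed.

Lemma plane_continuousN (g : R * R -> R) : continuous g -> continuous (fun p => - g p).
Proof. by move=> cg x; apply: cvgN; exact: cg. Qed.

Lemma plane_continuousD (g h : R * R -> R) : continuous g -> continuous h ->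
  continuous (fun p => g p + h p).
Proof. by move=> cg ch x; apply: cvgD; [exact: cg|exact: ch]. Qed.

Lemma plane_continuousM (g h : R * R -> R) : continuous g -> continuous h ->
  continuous (fun p => g p * h p).
Proof. by move=> cg ch x; apply: cvgM; [exact: cg|exact: ch]. Qed.

Lemma pd_periodic (L : set (R * R)) (f : R * R -> R) i : lattice_periodic L f ->
  lattice_periodic L (pd i f).
Proof.
move=> pf p q pq.
rewrite (_ : p = q + (p - q)) -?pd_shift; last by rewrite addrC subrK.
congr (pd i _ q); apply/funext => x; apply: pf.
by rewrite addrAC subrr add0r.
Qed.

Lemma coord_periodic n (L : set (R * R)) (f : R * R -> 'rV[R]_n) k :
  lattice_periodic L f -> lattice_periodic L (fun p => f p 0 k).
Proof. by move=> pf p q pq; rewrite (pf p q pq). Qed.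

Lemma metric_periodic n (L : set (R * R)) (f : R * R -> 'rV[R]_n) : smooth f ->
  lattice_periodic L f -> lattice_periodic L (metric f).
Proof.
move=> sf pf p q pq; suff E : jac f p = jac f q by rewrite /metric E.
apply/matrixP => i k; apply: etrans (jacE n f p i k sf) _.
apply: etrans (esym (jacE n f q i k sf)).
exact: (pd_periodic L _ i (coord_periodic n L f k pf)).
Qed.

(** What depends on the surface is equality in the length-area bound, continuity of the gradient,
    and an implication about a single smooth periodic field [V]. The family realising a conformal
    variation enters only through the minimality of its energy at time 0. *)
Lemma conf_willmore_critical (c : R) (f : R * R -> 'rV[R]_3) : 1 <= c ->
  immersion f -> conf_class (metric f) (0, c) ->
  \int[mu2]_(p in cell) energy (metric f p) = (2 * pi) ^+ 2 / c ->
  (forall k, continuous (fun p => grad_willmore f p 0 k)) ->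
  (forall V : R * R -> 'rV[R]_3, smooth V -> lattice_periodic lat2pi V ->
    \int[mu2]_(p in cell) denergy (metric f p) (dmetric f V p) = 0 ->
    \int[mu2]_(p in cell) (dot (grad_willmore f p) (V p) * area f p) = 0) ->
  conf_willmore f.
Proof.
move=> c1 imf cf Ef cG HV; split=> //; exists (0, c) => //.
have H V : conf_variation f (0, c) V -> smooth V /\
    \int[mu2]_(p in cell) (dot (grad_willmore f p) (V p) * area f p) = 0.
  move=> [e [F [e0 HF [sF sFt] F0 ->]]].
  set Ft := fun t p => derive1 (F ^~ p) t in sFt *.
  have I0 : `]-e, e[%classic (0 : R) by rewrite /= in_itv/= oppr_lt0 e0.
  have sV : smooth (Ft 0) by exact: (proj1 sFt 0 I0).
  split; first exact: sV.
  apply: (HV (Ft 0) sV).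
    move=> p q pq; rewrite /Ft !derive1E; apply: near_eq_derive.
    apply/nbhs_ballP; exists e; [exact: e0|move=> t].
    rewrite /ball/= sub0r normrN ltr_norml => te.
    have tI : t \in `]-e, e[ by rewrite in_itv.
    have [[_ pF _] _ _] := HF t tI.
    exact: pF.
  have dF t : `]-e, e[%classic t -> forall p, derivable (F ^~ p) t 1.
    by move=> It; case: (HF t It).
  have iF t : `]-e, e[%classic t -> immersion (F t) by move=> It; case: (HF t It).
  have Hmin t : `]-e, e[%classic t -> \int[mu2]_(p in cell) energy (metric (F 0) p) <=
                    \int[mu2]_(p in cell) energy (metric (F t) p).
    move=> It; have [[sFT pFT _] cT _] := HF t It.
    have E0 : \int[mu2]_(p in cell) energy (metric (F 0) p) = (2 * pi) ^+ 2 / c.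
      by rewrite F0; exact: Ef.
    rewrite [leLHS]E0.
    exact: (extremal_length c (metric (F t)) c1 cT (metric_periodic _ _ _ sFT pFT)
      (continuous_energy e F sF iF t It)).
  have := first_variation_energy e F e0 sF sFt dF iF Hmin.
  by rewrite F0.
apply: L2_closure_orthogonal => //.
  move=> V CV j; have [sV _] := H V CV.
  exact: (smooth_continuous _ (smooth_coord _ V j sV)).
by move=> V CV; have [_] := H V CV.
Qed.

End CriticalTori.

(** * Curvature and Willmore gradient of the torus of revolution *)

(* The stereographic image of the torus of radii (s, sg), abstracted from its
   trigonometric entries: in the coordinates X = u + k v and Y = v, the entries
   are C = cos X, S = sin X, c = cos Y, t = sin Y and L = (1 - s c)^-1. *)
Section RevolutionTorus.
Context {R : realType}.
Implicit Types (p q : R * R).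
Variables (s sg k : R) (C S c t L : R * R -> R).
Hypothesis s0 : 0 < s.
Hypothesis sg0 : 0 < sg.
Hypothesis ssg : s ^+ 2 + sg ^+ 2 = 1.
Hypothesis dC0 : pder 0 C (fun p => - S p).
Hypothesis dC1 : pder 1 C (fun p => - (k * S p)).
Hypothesis dS0 : pder 0 S (fun p => C p).
Hypothesis dS1 : pder 1 S (fun p => k * C p).
Hypothesis dc0 : pder 0 c (fun=> 0).
Hypothesis dc1 : pder 1 c (fun p => - t p).
Hypothesis dt0 : pder 0 t (fun=> 0).
Hypothesis dt1 : pder 1 t (fun p => c p).
Hypothesis dL0 : pder 0 L (fun=> 0).
Hypothesis dL1 : pder 1 L (fun p => - (s * t p * (L p * L p))).
Hypothesis CS : forall p, C p ^+ 2 + S p ^+ 2 = 1.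
Hypothesis ct : forall p, c p ^+ 2 + t p ^+ 2 = 1.
Hypothesis Lc : forall p, L p * (1 - s * c p) = 1.
Hypothesis L0 : forall p, 0 < L p.

(** A surface of revolution about the first axis: [Y] runs along the profile circle and [X] is the
    angle of rotation, up to a half turn. *)
Definition rtorus p : 'rV[R]_3 :=
  \row_j [:: s * t p * L p; - (sg * C p * L p); - (sg * S p * L p)]`_j.

Local Notation f := rtorus.
Hypothesis sf : smooth f.

Let fk (j : 'I_3) p := [:: s * t p * L p; - (sg * C p * L p); - (sg * S p * L p)]`_j.

Let fkE j : (fun q => f q 0 j) = fk j.
Proof. by apply/funext => q; rewrite mxE. Qed.

Ltac pdr := first [ exact: dC0 | exact: dC1 | exact: dS0 | exact: dS1 | exact: dc0
  | exact: dc1 | exact: dt0 | exact: dt1 | exact: dL0 | exact: dL1 | exact: pder_cst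
  | apply: pderN; pdr | apply: pderD; pdr | apply: pderM; pdr ].

Let rel p : [/\ S p ^+ 2 = 1 - C p ^+ 2, t p ^+ 2 = 1 - c p ^+ 2,
  sg ^+ 2 = 1 - s ^+ 2 & L p * s * c p = L p - 1].
Proof.
split.
- by rewrite -(CS p) addrAC subrr add0r.
- by rewrite -(ct p) addrAC subrr add0r.
- by rewrite -ssg addrAC subrr add0r.
- by rewrite -[X in L p - X](Lc p); ring.
Qed.

Let f_u (j : 'I_3) p := [:: 0; sg * S p * L p; - (sg * C p * L p)]`_j.
Let f_v (j : 'I_3) p := [:: s * (c p - s) * (L p * L p);
  k * sg * S p * L p + sg * s * C p * t p * (L p * L p);
  - (k * sg * C p * L p) + sg * s * S p * t p * (L p * L p)]`_j.
Let f_uu (j : 'I_3) p := [:: 0; sg * C p * L p; sg * S p * L p]`_j.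
Let f_uv (j : 'I_3) p := [:: 0; k * sg * C p * L p - sg * s * S p * t p * (L p * L p);
  k * sg * S p * L p + sg * s * C p * t p * (L p * L p)]`_j.
Let f_vv (j : 'I_3) p := [:: - (s * t p * (L p * L p) * (1 + 2 * s * (c p - s) * L p));
  k * k * sg * C p * L p - 2 * k * sg * s * S p * t p * (L p * L p) +
    sg * s * C p * c p * (L p * L p) - 2 * sg * s * s * C p * (t p * t p) * (L p * L p * L p);
  k * k * sg * S p * L p + 2 * k * sg * s * C p * t p * (L p * L p) +
    sg * s * S p * c p * (L p * L p) - 2 * sg * s * s * S p * (t p * t p) * (L p * L p * L p)]`_j.

Let d_u j : pder 0 (fk j) (f_u j).
Proof.
by have [->|->|->] := ord3P j; apply: pder_eq; [pdr|move=> p /=; rewrite /f_u /=; ring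
  |pdr|move=> p /=; rewrite /f_u /=; ring|pdr|move=> p /=; rewrite /f_u /=; ring].
Qed.

Let d_v j : pder 1 (fk j) (f_v j).
Proof.
have [->|->|->] := ord3P j; apply: pder_eq; try pdr; move=> p /=; rewrite /f_v /=; try ring.
have [_ t2 _ Lsc] := rel p.
transitivity (L p * (s * c p) * (L p * (1 - s * c p)) - s * s * t p ^+ 2 * (L p * L p)).
  by rewrite Lc; ring.
by rewrite t2; ring.
Qed.

Let d_uu j : pder 0 (f_u j) (f_uu j).
Proof.
by have [->|->|->] := ord3P j; apply: pder_eq; try pdr; move=> p /=; rewrite /f_uu /=; ring.
Qed.

Let d_vu j : pder 1 (f_u j) (f_uv j).
Proof.
by have [->|->|->] := ord3P j; apply: pder_eq; try pdr; move=> p /=; rewrite /f_uv /=; ring.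
Qed.

Let d_uv j : pder 0 (f_v j) (f_uv j).
Proof.
by have [->|->|->] := ord3P j; apply: pder_eq; try pdr; move=> p /=; rewrite /f_uv /=; ring.
Qed.

Let d_vv j : pder 1 (f_v j) (f_vv j).
Proof.
by have [->|->|->] := ord3P j; apply: pder_eq; try pdr; move=> p /=; rewrite /f_vv /=; ring.
Qed.

Let jE0 p j : jac f p 0 j = f_u j p.
Proof. by rewrite (jacE _ _ _ _ _ sf) fkE (pder_pd _ _ _ (d_u j)). Qed.

Let jE1 p j : jac f p 1 j = f_v j p.
Proof. by rewrite (jacE _ _ _ _ _ sf) fkE (pder_pd _ _ _ (d_v j)). Qed.

Let hess a b p j : pd a (pd b f) p 0 j = pd a (pd b (fk j)) p.
Proof. by rewrite -fkE; exact: (ipd_coord _ f j [:: a; b] p sf). Qed.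

Let h00 p j : pd 0 (pd 0 f) p 0 j = f_uu j p.
Proof. by rewrite hess (pder_pd _ _ _ (d_u j)) (pder_pd _ _ _ (d_uu j)). Qed.

Let h10 p j : pd 1 (pd 0 f) p 0 j = f_uv j p.
Proof. by rewrite hess (pder_pd _ _ _ (d_u j)) (pder_pd _ _ _ (d_vu j)). Qed.

Let h01 p j : pd 0 (pd 1 f) p 0 j = f_uv j p.
Proof. by rewrite hess (pder_pd _ _ _ (d_v j)) (pder_pd _ _ _ (d_uv j)). Qed.

Let h11 p j : pd 1 (pd 1 f) p 0 j = f_vv j p.
Proof. by rewrite hess (pder_pd _ _ _ (d_v j)) (pder_pd _ _ _ (d_vv j)). Qed.

(* (c - s)^2 + sg^2 t^2 = (1 - s c)^2 = L^-2, in polynomial form *)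
Let Lcs p : L p * L p * ((c p - s) ^+ 2 + sg ^+ 2 * t p ^+ 2) = 1.
Proof.
have [_ t2 sg2 _] := rel p; rewrite t2 sg2.
transitivity ((L p * (1 - s * c p)) ^+ 2); first by ring.
by rewrite Lc expr1n.
Qed.

(** Stereographic projection is conformal with factor [L]; what remains is the constant metric of
    the torus of radii [s] and [sg] in the 3-sphere, sheared by [k]. *)
Lemma rtorus_metric p :
  [/\ metric f p 0 0 = sg ^+ 2 * (L p * L p),
      metric f p 0 1 = k * sg ^+ 2 * (L p * L p),
      metric f p 1 0 = k * sg ^+ 2 * (L p * L p)
    & metric f p 1 1 = (k ^+ 2 * sg ^+ 2 + s ^+ 2) * (L p * L p)].
Proof.
have [S2 t2 sg2 Lsc] := rel p.
split; rewrite (metricE f p) sum3 ?jE0 ?jE1 /f_u /f_v /=; try by ring: S2.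
transitivity (k ^+ 2 * sg ^+ 2 * (L p * L p) +
  s ^+ 2 * (L p * L p) * (L p * L p * ((c p - s) ^+ 2 + sg ^+ 2 * t p ^+ 2))).
  by ring: S2.
by rewrite Lcs; ring.
Qed.

Let LL0 p : 0 < L p * L p. Proof. by rewrite mulr_gt0. Qed.

Lemma rtorus_det p : \det (metric f p) = (sg * s * (L p * L p)) ^+ 2.
Proof. by have [e00 e01 e10 e11] := rtorus_metric p; rewrite det2 e00 e01 e10 e11; ring. Qed.

Let a0 p : 0 < sg * s * (L p * L p). Proof. by rewrite !mulr_gt0. Qed.

Lemma rtorus_area p : area f p = sg * s * (L p * L p).
Proof. by rewrite /area rtorus_det sqrtr_sqr gtr0_norm. Qed.

Let det0 p : \det (metric f p) != 0.
Proof. by rewrite rtorus_det expf_neq0 ?gt_eqF. Qed.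

Lemma rtorus_row_free p : row_free (jac f p).
Proof.
apply/row_freeP; exists ((jac f p)^T *m invmx (metric f p)).
rewrite mulmxA -/(metric f p) mulmxV// unitmxE unitfE; exact: det0.
Qed.

Lemma rtorus_imetric p :
  [/\ imetric f p 0 0 = (k ^+ 2 * sg ^+ 2 + s ^+ 2) / (sg ^+ 2 * s ^+ 2 * (L p * L p)),
      imetric f p 0 1 = - k / (s ^+ 2 * (L p * L p)),
      imetric f p 1 0 = - k / (s ^+ 2 * (L p * L p))
    & imetric f p 1 1 = (s ^+ 2 * (L p * L p))^-1].
Proof.
have [i00 i01 i10 i11] := invmx2 _ (det0 p).
have [e00 e01 e10 e11] := rtorus_metric p.
rewrite /imetric i00 i01 i10 i11 rtorus_det e00 e01 e10 e11.
have Lp := lt0r_neq0 (L0 p); have s' := lt0r_neq0 s0; have sg' := lt0r_neq0 sg0.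
by split; field; rewrite Lp s' sg'.
Qed.

Let N (j : 'I_3) p := [:: sg * t p * L p; - (C p * L p * (c p - s)); - (S p * L p * (c p - s))]`_j.

Lemma rtorus_normal p j : normal f p 0 j = N j p.
Proof.
have [S2 t2 sg2 Lsc] := rel p.
have pE i j' : jac f p i j' = pd i f p 0 j' by rewrite mxE.
have pu j' : pd 0 f p 0 j' = f_u j' p := etrans (esym (pE 0 j')) (jE0 p j').
have pv j' : pd 1 f p 0 j' = f_v j' p := etrans (esym (pE 1 j')) (jE1 p j').
have [y0 y1 y2] : [/\ cross (pd 0 f p) (pd 1 f p) 0 o0 = sg * s * (L p * L p) * N o0 p,
    cross (pd 0 f p) (pd 1 f p) 0 o1 = sg * s * (L p * L p) * N o1 p
  & cross (pd 0 f p) (pd 1 f p) 0 o2 = sg * s * (L p * L p) * N o2 p].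
  have [x0 x1 x2] := cross_val _ _ _ _ pu pv.
  split; [apply: etrans x0 _|apply: etrans x1 _|apply: etrans x2 _];
    rewrite /f_u /f_v /N /=.
  - by ring: S2.
  - by ring.
  - by ring.
have NN : N o0 p * N o0 p + N o1 p * N o1 p + N o2 p * N o2 p = 1.
  by rewrite -(Lcs p) /N /=; ring: S2.
rewrite /normal dot3 y0 y1 y2.
have -> : sg * s * (L p * L p) * N o0 p * (sg * s * (L p * L p) * N o0 p) +
    sg * s * (L p * L p) * N o1 p * (sg * s * (L p * L p) * N o1 p) +
    sg * s * (L p * L p) * N o2 p * (sg * s * (L p * L p) * N o2 p) =
    (sg * s * (L p * L p)) ^+ 2.
  by rewrite -[RHS]mulr1 -NN; ring.
rewrite sqrtr_sqr gtr0_norm// mxE.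
have an0 := lt0r_neq0 (a0 p).
by have [->|->|->] := ord3P j; rewrite ?y0 ?y1 ?y2 mulKf.
Qed.

Lemma rtorus_sff p :
  [/\ sff f p 0 0 = - (sg * (L p * L p) * (c p - s)),
      sff f p 0 1 = - (k * sg * (L p * L p) * (c p - s)),
      sff f p 1 0 = - (k * sg * (L p * L p) * (c p - s))
    & sff f p 1 1 = - (k ^+ 2 * sg * (L p * L p) * (c p - s)) - sg * s * (L p * L p)].
Proof.
have [S2 t2 sg2 Lsc] := rel p.
have E i j : sff f p i j = dot (pd i (pd j f) p) (normal f p) by rewrite mxE.
have nE := rtorus_normal p.
split; apply: etrans (E _ _) _.
- apply: etrans (dot3_val _ _ _ _ (h00 p) nE) _; rewrite /f_uu /N /=; ring: S2.
- apply: etrans (dot3_val _ _ _ _ (h01 p) nE) _; rewrite /f_uv /N /=; ring: S2.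
- apply: etrans (dot3_val _ _ _ _ (h10 p) nE) _; rewrite /f_uv /N /=; ring: S2.
apply: etrans (dot3_val _ _ _ _ (h11 p) nE) _; rewrite /f_vv /N /=.
transitivity (- (k ^+ 2 * sg * (L p * L p) * (c p - s)) -
   sg * s * (L p * L p) * (L p * (t p ^+ 2 + c p ^+ 2 - s * c p))).
  by ring: S2.
by rewrite t2 subrK Lc mulr1.
Qed.

Let Lp0 p : L p != 0. Proof. exact: lt0r_neq0. Qed.
Let s_0 : s != 0. Proof. exact: lt0r_neq0. Qed.
Let sg_0 : sg != 0. Proof. exact: lt0r_neq0. Qed.

Let shape p := imetric f p *m sff f p.

(** The rotation field is a principal direction, so [shape] is triangular and its diagonal entries
    are the principal curvatures; the second is constant because the profile is a circle. These
    three entries determine the traces taken below. *)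
Lemma rtorus_shape p :
  [/\ shape p 0 0 = - ((c p - s) / sg), shape p 1 0 = 0 & shape p 1 1 = - (sg / s)].
Proof.
have [i00 i01 i10 i11] := rtorus_imetric p.
have [A00 A01 A10 A11] := rtorus_sff p.
have Lp := Lp0 p; have s' := s_0; have sg' := sg_0.
split; rewrite /shape mul2E ?i00 ?i01 ?i10 ?i11 ?A00 ?A01 ?A10 ?A11;
  field; rewrite ?Lp ?s' ?sg'//.
Qed.

Lemma rtorus_mean_curv p : mean_curv f p = - (2 * sg)^-1 * c p + (s / sg - sg / s) / 2.
Proof.
have [g0 _ g1] := rtorus_shape p.
rewrite /mean_curv /mxtrace sum2 -/(shape p) g0 g1.
by field; rewrite s_0 sg_0.
Qed.

(** A conformal change with factor [L] multiplies this squared norm by L^-2, and it is constant on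
    the homogeneous torus. Concretely, the difference of the principal curvatures is
    [(1 - s * c p) / (s * sg)], the inverse of [s * sg * L p]. *)
Lemma rtorus_sff0_sqnorm p :
  sff0_sqnorm f p = (2 * sg ^+ 2 * s ^+ 2 * (L p * L p))^-1.
Proof.
have [g0 g1 g2] := rtorus_shape p.
have Gg : imetric f p *m metric f p = 1%:M.
  by rewrite /imetric mulVmx// unitmxE unitfE det0.
have ME : imetric f p *m sff0 f p = shape p - (mean_curv f p)%:M.
  by rewrite /sff0 mulmxBr -scalemxAr Gg scalemx1.
rewrite /sff0_sqnorm -mulmxA ME tr_mul2.
have M00 : (shape p - (mean_curv f p)%:M) 0 0 = (2 * sg * s * L p)^-1.
  rewrite sub_scalar_mxE g0 mulr1n rtorus_mean_curv.
  have Lp := Lp0 p; have s' := s_0; have sg' := sg_0.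
  have [_ _ sg2 Lsc] := rel p.
  have -> : (2 * sg * s * L p)^-1 = (1 - s * c p) / (2 * sg * s).
    by rewrite -[1 - _](mulKf Lp) Lc mulr1; field; rewrite Lp s' sg'.
  have -> : 1 - s * c p = s ^+ 2 + sg ^+ 2 - s * c p by rewrite ssg.
  by field; rewrite s' sg'.
have M11 : (shape p - (mean_curv f p)%:M) 1 1 = - (2 * sg * s * L p)^-1.
  rewrite -M00 !sub_scalar_mxE g0 g2 !mulr1n.
  by rewrite rtorus_mean_curv; field; rewrite s_0 sg_0.
have M10 : (shape p - (mean_curv f p)%:M) 1 0 = 0.
  by rewrite sub_scalar_mxE g1 mulr0n subrr.
rewrite M00 M10 M11 mulr0 mul0r !addr0.
by field; rewrite Lp0 s_0 sg_0.
Qed.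

(** The mean curvature and the metric coefficients depend on [v] alone, so only the term with both
    derivatives in [v] survives. *)
Lemma rtorus_laplacian p :
  laplacian f (mean_curv f) p = c p / (2 * sg * s ^+ 2 * (L p * L p)).
Proof.
pose H p := - (2 * sg)^-1 * c p + (s / sg - sg / s) / 2.
have mH : mean_curv f = H by apply/funext => q; exact: rtorus_mean_curv.
have dH0 : pd 0 H = (fun=> 0).
  by apply: pder_pd; apply: pder_eq; [rewrite /H; pdr|move=> q /=; ring].
have dH1 : pd 1 H = (fun q => (2 * sg)^-1 * t q).
  by apply: pder_pd; apply: pder_eq; [rewrite /H; pdr|move=> q /=; ring].
have W0 i : (fun q => area f q * imetric f q i 0 * pd 0 H q) = (fun=> 0).
  by apply/funext => q; rewrite dH0 mulr0.
have W01 : (fun q => area f q * imetric f q 0 1 * pd 1 H q) =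
    (fun q => - (k * sg / s) * (2 * sg)^-1 * t q).
  apply/funext => q; rewrite dH1 rtorus_area; have [_ -> _ _] := rtorus_imetric q.
  by field; rewrite Lp0 s_0 sg_0.
have W11 : (fun q => area f q * imetric f q 1 1 * pd 1 H q) =
    (fun q => (2 * s)^-1 * t q).
  apply/funext => q; rewrite dH1 rtorus_area; have [_ _ _ ->] := rtorus_imetric q.
  by field; rewrite Lp0 s_0 sg_0.
have D00 : pd 0 (fun q => area f q * imetric f q 0 0 * pd 0 H q) p = 0.
  by rewrite W0 (pder_pd _ _ _ (pder_cst 0 0)).
have D10 : pd 1 (fun q => area f q * imetric f q 1 0 * pd 0 H q) p = 0.
  by rewrite W0 (pder_pd _ _ _ (pder_cst 1 0)).
have D01 : pd 0 (fun q => area f q * imetric f q 0 1 * pd 1 H q) p = 0.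
  have d : pder 0 (fun q => - (k * sg / s) * (2 * sg)^-1 * t q) (fun=> 0).
    by apply: pder_eq; [pdr|move=> q /=; ring].
  by rewrite W01 (pder_pd _ _ _ d).
have D11 : pd 1 (fun q => area f q * imetric f q 1 1 * pd 1 H q) p = (2 * s)^-1 * c p.
  have d : pder 1 (fun q => (2 * s)^-1 * t q) (fun q => (2 * s)^-1 * c q).
    by apply: pder_eq; [pdr|move=> q /=; ring].
  by rewrite W11 (pder_pd _ _ _ d).
rewrite /laplacian mH.
have E (x00 x01 x10 x11 : R) (F : 'I_2 -> 'I_2 -> R) : F 0 0 = x00 -> F 0 1 = x01 ->
    F 1 0 = x10 -> F 1 1 = x11 -> \sum_i \sum_j F i j = x00 + x01 + (x10 + x11).
  by move=> <- <- <- <-; rewrite !sum2.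
apply: etrans (congr1 _ (E _ _ _ _ _ D00 D01 D10 D11)) _.
rewrite rtorus_area !add0r; field; by rewrite Lp0 s_0 sg_0.
Qed.

Let mu := (s ^+ 2 - sg ^+ 2) / (4 * sg ^+ 3 * s ^+ 3).

(** On the homogeneous torus the gradient is a constant multiple of the normal, and a conformal
    change with factor [L] multiplies its scalar part by L^-3. The constant [mu] vanishes when [s]
    equals [sg], the case of the Clifford torus. *)
Lemma rtorus_grad p j : grad_willmore f p 0 j = mu / (L p * L p * L p) * N j p.
Proof.
rewrite /grad_willmore [LHS]mxE rtorus_normal; congr (_ * _).
rewrite rtorus_laplacian rtorus_sff0_sqnorm rtorus_mean_curv.
have [_ _ sg2 Lsc] := rel p.
have -> : mu / (L p * L p * L p) = (s ^+ 2 - sg ^+ 2) * (1 - s * c p) / (4 * sg ^+ 3 * s ^+ 3 * (L p * L p)).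
  rewrite -[1 - _](mulKf (Lp0 p)) Lc mulr1 /mu.
  by field; rewrite Lp0 s_0 sg_0.
have -> : (s ^+ 2 - sg ^+ 2) * (1 - s * c p) =
    2 * sg ^+ 2 * s * c p - (s * (c p) - s ^+ 2 + sg ^+ 2) +
    (1 - (s ^+ 2 + sg ^+ 2)) * (- s * c p).
  by rewrite sg2; ring.
rewrite ssg subrr mul0r addr0.
by field; rewrite Lp0 s_0 sg_0.
Qed.

(** * Integration by parts on the torus of revolution *)

Hypothesis cC : continuous C.
Hypothesis cS : continuous S.
Hypothesis cc : continuous c.
Hypothesis cct : continuous t.
Hypothesis cL : continuous L.
Hypothesis pC : lattice_periodic lat2pi C.
Hypothesis pS : lattice_periodic lat2pi S.
Hypothesis pc : lattice_periodic lat2pi c.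
Hypothesis pt : lattice_periodic lat2pi t.

Ltac cont := lazymatch goal with
  | |- continuous (fun _ => ?x) => exact (plane_continuous_cst x)
  | |- continuous (fun p => - (@?g p)) => refine (plane_continuousN g _); cont
  | |- continuous (fun p => (@?g p) + (@?h p)) => refine (plane_continuousD g h _ _); cont
  | |- continuous (fun p => (@?g p) * (@?h p)) => refine (plane_continuousM g h _ _); cont
  | _ => first [ exact cC | exact cS | exact cc | exact cct | exact cL ]
  end.

(* [P du + Q dv] is the density of the first variation of [energy] after
   integration by parts, and [M] its divergence up to the factor s^2. *)
Let y (j : 'I_3) p := [:: s * (c p - s); s * sg * C p * t p; s * sg * S p * t p]`_j.
Let P (j : 'I_3) p :=
  (sg * s)^-1 * [:: 0; sg * S p * (1 - s * c p); - (sg * C p * (1 - s * c p))]`_j +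
  k * sg / s ^+ 3 * y j p.
Let Q (j : 'I_3) p := - (sg / s ^+ 3) * y j p.
Let M (j : 'I_3) p := [:: sg * t p; - (C p * (c p - s)); - (S p * (c p - s))]`_j.
Let P0 (j : 'I_3) p :=
  (sg * s)^-1 * [:: 0; sg * C p * (1 - s * c p); sg * S p * (1 - s * c p)]`_j +
  k * sg / s ^+ 3 * [:: 0; - (s * sg * S p * t p); s * sg * C p * t p]`_j.
Let Q1 (j : 'I_3) p := - (sg / s ^+ 3) *
  [:: - (s * t p); s * sg * (- (k * S p * t p) + C p * c p);
      s * sg * (k * C p * t p + S p * c p)]`_j.

Let dP0 j : pder 0 (P j) (P0 j).
Proof.
by have [->|->|->] := ord3P j; apply: pder_eq; try (rewrite /P /y /=; pdr);
  move=> p /=; rewrite /P0 /=; ring.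
Qed.

Let dQ1 j : pder 1 (Q j) (Q1 j).
Proof.
by have [->|->|->] := ord3P j; apply: pder_eq; try (rewrite /Q /y /=; pdr);
  move=> p /=; rewrite /Q1 /=; ring.
Qed.

(** The field [M] is the unit normal divided by [L], so the divergence is normal: to first order,
    tangential fields do not change the integral of [energy]. *)
Let divPQ j p : P0 j p + Q1 j p = M j p / s ^+ 2.
Proof.
have [S2 t2 sg2 Lsc] := rel p; have s' := s_0; have sg' := sg_0.
have [->|->|->] := ord3P j; rewrite /P0 /Q1 /M /=.
- by field; rewrite s' sg'.
- transitivity (C p * (s - (s ^+ 2 + sg ^+ 2) * c p) / s ^+ 2).
    by field; rewrite s' sg'.
  by rewrite ssg; field; rewrite s'.
- transitivity (S p * (s - (s ^+ 2 + sg ^+ 2) * c p) / s ^+ 2).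
    by field; rewrite s' sg'.
  by rewrite ssg; field; rewrite s'.
Qed.

Let contP j : continuous (P j).
Proof. by have [->|->|->] := ord3P j; rewrite /P /y /=; cont. Qed.

Let contQ j : continuous (Q j).
Proof. by have [->|->|->] := ord3P j; rewrite /Q /y /=; cont. Qed.

Let contP0 j : continuous (P0 j).
Proof. by have [->|->|->] := ord3P j; rewrite /P0 /=; cont. Qed.

Let contQ1 j : continuous (Q1 j).
Proof. by have [->|->|->] := ord3P j; rewrite /Q1 /=; cont. Qed.

Let contM j : continuous (M j).
Proof. by have [->|->|->] := ord3P j; rewrite /M /=; cont. Qed.

Let perP j : lattice_periodic lat2pi (P j).
Proof. by move=> p q pq; rewrite /P /y (pC p q pq) (pS p q pq) (pc p q pq) (pt p q pq). Qed.

Let perQ j : lattice_periodic lat2pi (Q j).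
Proof. by move=> p q pq; rewrite /Q /y (pC p q pq) (pS p q pq) (pc p q pq) (pt p q pq). Qed.

Lemma rtorus_continuous_grad j : continuous (fun p => grad_willmore f p 0 j).
Proof.
move=> x.
refine (cvg_congr _ _ _ _ _ (fun q => rtorus_grad q j) (rtorus_grad x j) _).
have cN : continuous (N j).
  by have [->|->|->] := ord3P j; rewrite /N /=; cont.
apply: cvgM; last exact: cN.
apply: cvgM; first exact: cvg_cst.
have cLLL : continuous (fun p => L p * L p * L p) by cont.
by apply: cvgV; [rewrite !mulf_neq0|exact: cLLL].
Qed.

Lemma rtorus_energy p : energy (metric f p) = sg / s.
Proof.
have [e00 _ _ _] := rtorus_metric p.
rewrite /energy e00 rtorus_det sqrtr_sqr gtr0_norm//.
by field; rewrite Lp0 s_0 sg_0.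
Qed.

Local Notation mu2 := ((@lebesgue_measure R) \x (@lebesgue_measure R))%E.

(** Up to divergences of periodic fields, [denergy] is [- T / s ^+ 2] with [T] the scalar product of
    [M] and [V], while the Willmore pairing has density [mu * sg * s * T]. Both integrals are thus
    multiples of the integral of [T]. *)
Lemma rtorus_critical (V : R * R -> 'rV[R]_3) : smooth V -> lattice_periodic lat2pi V ->
  \int[mu2]_(p in cell) denergy (metric f p) (dmetric f V p) = 0 ->
  \int[mu2]_(p in cell) (dot (grad_willmore f p) (V p) * area f p) = 0.
Proof.
move=> sV pV H.
pose Vk j p := V p 0 j.
have sVk j : smooth (Vk j) := smooth_coord _ V j sV.
have dV i j : pder i (Vk j) (pd i (Vk j)) := pderP i _ (fun q => smooth_derivable _ i q (sVk j)).
have d0 j := pderM _ _ _ _ _ (dV 0 j) (dP0 j).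
have d1 j := pderM _ _ _ _ _ (dV 1 j) (dQ1 j).
have cV j : continuous (Vk j) := smooth_continuous _ (sVk j).
have cdV i j : continuous (pd i (Vk j)) := smooth_continuous _ (smooth_pd _ i (sVk j)).
pose U j p := pd 0 (fun p => Vk j p * P j p) p + pd 1 (fun p => Vk j p * Q j p) p.
have c0 j : continuous (pd 0 (fun p => Vk j p * P j p)).
  rewrite (pder_pd _ _ _ (d0 j)) => x; apply: cvgD; apply: cvgM.
  - exact: cdV. - exact: contP. - exact: cV. - exact: contP0.
have c1 j : continuous (pd 1 (fun p => Vk j p * Q j p)).
  rewrite (pder_pd _ _ _ (d1 j)) => x; apply: cvgD; apply: cvgM.
  - exact: cdV. - exact: contQ. - exact: cV. - exact: contQ1.
have cU j : continuous (U j) by move=> x; apply: cvgD; [exact: c0|exact: c1].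
have IU j : \int[mu2]_(p in cell) U j p = 0.
  apply: etrans (cell_RintegralD _ _ (c0 j) (c1 j)) _.
  have pVk := coord_periodic _ _ V j pV.
  have I0 : \int[mu2]_(p in cell) pd 0 (fun p => Vk j p * P j p) p = 0.
    apply: Rintegral_pd_periodic => //; first by move=> q; exact: pder_derivable (d0 j).
    by move=> p q pq; rewrite (pVk p q pq : Vk j p = Vk j q) (perP j p q pq).
  have I1 : \int[mu2]_(p in cell) pd 1 (fun p => Vk j p * Q j p) p = 0.
    apply: Rintegral_pd_periodic => //; first by move=> q; exact: pder_derivable (d1 j).
    by move=> p q pq; rewrite (pVk p q pq : Vk j p = Vk j q) (perQ j p q pq).
  by apply: etrans (congr2 +%R I0 I1) _; rewrite addr0.
have jV i j p : jac V p i j = pd i (Vk j) p := jacE _ _ _ _ _ sV.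
have dE p : denergy (metric f p) (dmetric f V p) =
    \sum_j (pd 0 (Vk j) p * P j p + pd 1 (Vk j) p * Q j p).
  have [e00 e01 e10 e11] := rtorus_metric p.
  have dm i l (fi fl : 'I_3 -> R) : (forall j, jac f p i j = fi j) -> (forall j, jac f p l j = fl j) ->
      dmetric f V p i l = \sum_j (pd i (Vk j) p * fl j + fi j * pd l (Vk j) p).
    by move=> Hi Hl; rewrite dmetricE; apply: eq_bigr => j _; rewrite Hi Hl !jV.
  rewrite /denergy rtorus_det sqrtr_sqr (gtr0_norm (a0 p)) e00 e01 e10 e11.
  rewrite (etrans (dm 0 0 _ _ (jE0 p) (jE0 p)) (sum3 _ _)).
  rewrite (etrans (dm 0 1 _ _ (jE0 p) (jE1 p)) (sum3 _ _)).
  rewrite (etrans (dm 1 0 _ _ (jE1 p) (jE0 p)) (sum3 _ _)).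
  rewrite (etrans (dm 1 1 _ _ (jE1 p) (jE1 p)) (sum3 _ _)).
  have Lp := Lp0 p; have s' := s_0; have sg' := sg_0.
  (* The coefficients are read off from [denergy] at the metric of [f]; they exhibit [P] and [Q] as
     combinations of [f_u] and [f_v], that is as tangent vectors of the surface. *)
  have PE j : P j p = (sg ^+ 2 * (s ^+ 2 - k ^+ 2 * sg ^+ 2) * f_u j p + k * sg ^+ 4 * f_v j p) /
      (L p * L p * sg ^+ 3 * s ^+ 3).
    have Lm : 1 - s * c p = (L p)^-1 by rewrite -[LHS](mulKf Lp) Lc mulr1.
    by have [->|->|->] := ord3P j; rewrite /P /y /f_u /f_v /= ?Lm; field; rewrite Lp s' sg'.
  have QE j : Q j p = (k * sg ^+ 4 * f_u j p - sg ^+ 4 * f_v j p) / (L p * L p * sg ^+ 3 * s ^+ 3).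
    by have [->|->|->] := ord3P j; rewrite /Q /y /f_u /f_v /=; field; rewrite Lp s' sg'.
  apply: etrans _ (esym (eq_bigr _ (fun j _ => congr2
    (fun z w => pd 0 (Vk j) p * z + pd 1 (Vk j) p * w) (PE j) (QE j)))).
  apply: etrans _ (esym (sum3 _ _)).
  move: (f_u o0 p) (f_u o1 p) (f_u o2 p) (f_v o0 p) (f_v o1 p) (f_v o2 p).
  move: (pd 0 (Vk o0) p) (pd 0 (Vk o1) p) (pd 0 (Vk o2) p).
  move: (pd 1 (Vk o0) p) (pd 1 (Vk o1) p) (pd 1 (Vk o2) p).
  move: (L p) Lp => l Lp *.
  by field; rewrite Lp s' sg'.
pose T p := \sum_j M j p * Vk j p.
have cT : continuous T.
  by move=> x; apply: cvg_sumr => j; apply: cvgM; [exact: contM|exact: cV].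
have UT p : denergy (metric f p) (dmetric f V p) = \sum_j 1 * U j p - (s ^+ 2)^-1 * T p.
  rewrite dE /T mulr_sumr -sumrB; apply: eq_bigr => j _.
  rewrite mul1r /U (pder_pd _ _ _ (d0 j)) (pder_pd _ _ _ (d1 j)).
  have := divPQ j p; move: (pd 0 _ _) (pd 1 _ _) => a b.
  move: (P j p) (Q j p) (P0 j p) (Q1 j p) (M j p) (Vk j p) => P' Q' P0' Q1' M' v' E.
  transitivity (a * P' + v' * (P0' + Q1') + b * Q' - v' * (P0' + Q1')); first by ring.
  by rewrite {2}E; ring.
have IT : \int[mu2]_(p in cell) T p = 0.
  have cSU : continuous (fun p => \sum_j 1 * U j p).
    by move=> x; apply: cvg_sumr => j; apply: cvgM; [exact: cvg_cst|exact: cU].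
  have cT' : continuous (fun p => (s ^+ 2)^-1 * T p).
    by move=> x; apply: cvgM; [exact: cvg_cst|exact: cT].
  have := H; rewrite (_ : (fun p => denergy _ _) =
    (fun p => \sum_j 1 * U j p - (s ^+ 2)^-1 * T p)); last first.
    exact/funext.
  rewrite (cell_RintegralB _ _ cSU cT') (Rintegral_lin0 _ (fun=> 1) U cU IU) sub0r.
  rewrite (cell_RintegralZ _ _ cT) => /eqP.
  by rewrite oppr_eq0 mulf_eq0 invr_eq0 expf_eq0/= (negbTE s_0) => /eqP.
have E : (fun p => dot (grad_willmore f p) (V p) * area f p) = (fun p => mu * sg * s * T p).
  apply/funext => p; rewrite rtorus_area /T sum3.
  rewrite (dot3_val _ _ (fun j => mu / (L p * L p * L p) * N j p)
    (fun j => Vk j p) (fun j => rtorus_grad p j) (fun j => erefl)).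
  rewrite /N /M /=; move: (Vk o0 p) (Vk o1 p) (Vk o2 p) => v0 v1 v2.
  move: mu => m'.
  by field; rewrite Lp0.
by rewrite E (cell_RintegralZ _ _ cT) IT mulr0.
Qed.

End RevolutionTorus.

(** * Conformal class of a sheared rectangular metric *)

Section ShearedClass.
Context {R : realType}.
Implicit Types (p q : R * R).

Lemma lattice_diagB (a b : R) p q : lattice (a, 0) (0, b) (p - q) ->
  exists k l : int, p.1 - q.1 = a * k%:~R /\ p.2 - q.2 = b * l%:~R.
Proof. by move=> /lattice_diagP[k [l [E1 E2]]]; exists k, l. Qed.

(** In the coordinates u + k v and v the metric is [lam] times diag (1, c^2). The shear has integer
    coefficients and determinant 1, so it preserves the lattice; [phi] is a scaling followed by the
    inverse shear. *)
Lemma conf_class_sheared (c : R) (k : nat) (h : R * R -> 'M[R]_2) (lam : R * R -> R) :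
  1 <= c -> (forall p, 0 < lam p) ->
  (forall p, [/\ h p 0 0 = lam p, h p 0 1 = k%:R * lam p, h p 1 0 = k%:R * lam p
               & h p 1 1 = (k%:R ^+ 2 + c ^+ 2) * lam p]) ->
  conf_class h (0, c).
Proof.
move=> c1 lam0 hE; have c0 : 0 < c by exact: lt_le_trans ltr01 c1.
(* Abstracting [2 * pi] turns it into an atom for [field]. *)
have [P PE P0] : exists2 P : R, P = 2 * pi & P != 0.
  by exists (2 * pi); rewrite ?gt_eqF ?two_pi_gt0.
have LE : lat2pi = lattice (P, 0) (0, P) :> set (R * R) by rewrite PE.
have c_0 : c != 0 by rewrite gt_eqF.
split.
  split => /=; [by rewrite lexx invr_ge0 ler0n| |by []].
  by rewrite expr0n add0r sqrtr_sqr gtr0_norm.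
pose phi (p : R * R) := (P * p.1 + - (P * k%:R / c) * p.2, 0 * p.1 + P / c * p.2).
pose psi (p : R * R) := (P^-1 * p.1 + k%:R / P * p.2, 0 * p.1 + c / P * p.2).
have sphi : smooth phi by exact: smooth_affine.
have spsi : smooth psi by exact: smooth_affine.
have phipsi q : phi (psi q) = q.
  by rewrite [RHS]surjective_pairing /phi /psi; congr pair => /=; field; rewrite ?c_0 P0.
have psiphi q : psi (phi q) = q.
  by rewrite [RHS]surjective_pairing /phi /psi; congr pair => /=; field; rewrite ?c_0 P0.
exists phi.
  split.
    split=> // p q /lattice_diagB[a [b [E1 E2]]]; rewrite LE; apply/lattice_diagP.
    exists (a - k%:Z * b), b; rewrite /phi; congr pair => /=.
      rewrite intrB intrM; transitivity (P * (p.1 - q.1) - P * k%:R / c * (p.2 - q.2)); first by ring.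
      by rewrite E1 E2; field.
    transitivity (P / c * (p.2 - q.2)); first by ring.
    by rewrite E2; field.
  exists psi.
    split=> // p q; rewrite LE => /lattice_diagB[a [b [E1 E2]]]; apply/lattice_diagP.
    exists (a + k%:Z * b), b; rewrite /psi; congr pair => /=.
      rewrite intrD intrM; transitivity (P^-1 * (p.1 - q.1) + k%:R / P * (p.2 - q.2)); first by ring.
      by rewrite E1 E2; field.
    transitivity (c / P * (p.2 - q.2)); first by ring.
    by rewrite E2; field.
  have Lz (x y : R) : lattice (x, 0) (0, y) (0 : R * R).
    by apply/lattice_diagP; exists 0, 0; rewrite !mulr0.
  split=> q; first by rewrite psiphi subrr.
  by rewrite phipsi subrr LE.
exists (fun q => P ^+ 2 * lam (phi q)) => q; split.
  by rewrite mulr_gt0// lt_neqAle sqr_ge0 eq_sym expf_neq0.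
have [h00 h01 h10 h11] := hE (phi q).
have d i (x y : R) := pder_pd _ _ _ (pder_lin i x y).
pose J := jac (row_of_pair \o phi) q.
have J00 : J 0 0 = P.
  by apply: etrans (jac_row_of_pair phi q 0 0 sphi) _; rewrite /= (d 0 P (- (P * k%:R / c))).
have J01 : J 0 1 = 0.
  by apply: etrans (jac_row_of_pair phi q 0 1 sphi) _; rewrite /= (d 0 0 (P / c)).
have J10 : J 1 0 = - (P * k%:R / c).
  by apply: etrans (jac_row_of_pair phi q 1 0 sphi) _; rewrite /= (d 1 P (- (P * k%:R / c))).
have J11 : J 1 1 = P / c.
  by apply: etrans (jac_row_of_pair phi q 1 1 sphi) _; rewrite /= (d 1 0 (P / c)).
rewrite /pullback -/J.
have i01 (a : 'I_2) : a = 0 \/ a = 1.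
  by case: a => -[|[|//]] Hk; [left|right]; exact: val_inj.
apply/matrixP => i j.
have E : (J *m h (phi q) *m J^T) i j =
    (J i 0 * h (phi q) 0 0 + J i 1 * h (phi q) 1 0) * J j 0 +
    (J i 0 * h (phi q) 0 1 + J i 1 * h (phi q) 1 1) * J j 1.
  by rewrite mul2E !(mul2E J) ![J^T _ _]mxE.
apply: etrans E _; rewrite h00 h01 h10 h11 [RHS]mxE.
move: (J) J00 J01 J10 J11 => {}J J00 J01 J10 J11.
by case: (i01 i) => ->; case: (i01 j) => -> /=;
  rewrite ?J00 ?J01 ?J10 ?J11 ?mulr1n ?mulr0n; field.
Qed.

End ShearedClass.

(** * Homogeneous tori in the 3-sphere and their Willmore energy *)

Section HomogeneousTorus.
Context {R : realType}.
Implicit Types (p q : R * R).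

Definition q0 : 'I_4 := ord0.
Definition q1 : 'I_4 := @Ordinal 4 1 isT.
Definition q2 : 'I_4 := @Ordinal 4 2 isT.
Definition q3 : 'I_4 := @Ordinal 4 3 isT.

Lemma ord4P (k : 'I_4) : [\/ k = q0, k = q1, k = q2 | k = q3].
Proof.
case: k => -[|[|[|[|//]]]] Hk.
- by apply: Or41; exact: val_inj.
- by apply: Or42; exact: val_inj.
- by apply: Or43; exact: val_inj.
- by apply: Or44; exact: val_inj.
Qed.

Lemma sum4 (V : nmodType) (F : 'I_4 -> V) : \sum_k F k = F q0 + F q1 + F q2 + F q3.
Proof.
rewrite !big_ord_recl big_ord0 addr0 !addrA.
by congr (F _ + F _ + F _ + F _); exact: val_inj.
Qed.

Variables (x y : R) (a b : 'I_2 -> R) (C S D E : R * R -> R).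
Hypothesis x0 : x != 0.
Hypothesis y0 : y != 0.
Hypothesis ab0 : a 0 * b 1 - a 1 * b 0 != 0.
Hypothesis dC : forall i, pder i C (fun p => - (a i * S p)).
Hypothesis dS : forall i, pder i S (fun p => a i * C p).
Hypothesis dD : forall i, pder i D (fun p => - (b i * E p)).
Hypothesis dE : forall i, pder i E (fun p => b i * D p).
Hypothesis CS : forall p, C p ^+ 2 + S p ^+ 2 = 1.
Hypothesis DE : forall p, D p ^+ 2 + E p ^+ 2 = 1.

(** Both tori of the theorem have this form, as orbits of rotations in the two coordinate planes:
    [C], [S] and [D], [E] are the cosine and sine of phases with constant gradients [a] and [b]. *)
Definition htorus p : 'rV[R]_4 := \row_j [:: x * C p; x * S p; y * D p; y * E p]`_j.

Local Notation f := htorus.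
Hypothesis sf : smooth f.

Let fk (j : 'I_4) p := [:: x * C p; x * S p; y * D p; y * E p]`_j.

Let fkE j : (fun q => f q 0 j) = fk j.
Proof. by apply/funext => q; rewrite mxE. Qed.

Ltac pdr := first [ exact: dC | exact: dS | exact: dD | exact: dE | exact: pder_cst
  | apply: pderN; pdr | apply: pderM; pdr ].

Let f1 i (j : 'I_4) p := [:: - (x * a i * S p); x * a i * C p; - (y * b i * E p); y * b i * D p]`_j.
Let f2 i l (j : 'I_4) p := [:: - (x * a i * a l * C p); - (x * a i * a l * S p);
  - (y * b i * b l * D p); - (y * b i * b l * E p)]`_j.

Let d1 i j : pder i (fk j) (f1 i j).
Proof.
by have [->|->|->|->] := ord4P j; apply: pder_eq; try pdr; move=> p /=; rewrite /f1 /=; ring.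
Qed.

Let d2 i l j : pder i (f1 l j) (f2 i l j).
Proof.
by have [->|->|->|->] := ord4P j; apply: pder_eq; try pdr; move=> p /=; rewrite /f2 /=; ring.
Qed.

Let jE i p j : jac f p i j = f1 i j p.
Proof. by rewrite (jacE _ _ _ _ _ sf) fkE (pder_pd _ _ _ (d1 i j)). Qed.

Let hE i l p j : pd i (pd l f) p 0 j = f2 i l j p.
Proof.
have H : pd i (pd l f) p 0 j = pd i (pd l (fk j)) p.
  by rewrite -fkE; exact: (ipd_coord _ f j [:: i; l] p sf).
by rewrite H (pder_pd _ _ _ (d1 l j)) (pder_pd _ _ _ (d2 i l j)).
Qed.

Let rel p : S p ^+ 2 = 1 - C p ^+ 2 /\ E p ^+ 2 = 1 - D p ^+ 2.
Proof.
by split; [rewrite -(CS p)|rewrite -(DE p)]; rewrite addrAC subrr add0r.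
Qed.

Lemma htorus_metric p i l :
  metric f p i l = x ^+ 2 * (a i * a l) + y ^+ 2 * (b i * b l).
Proof.
have [S2 E2] := rel p.
have H : metric f p i l = \sum_j f1 i j p * f1 l j p.
  by rewrite (metricE f p); apply: eq_bigr => j _; rewrite (jE i) (jE l).
by rewrite H sum4 /f1 /=; ring: S2 E2.
Qed.

Let del := a 0 * b 1 - a 1 * b 0.

Lemma htorus_det p : \det (metric f p) = (x * y * del) ^+ 2.
Proof. by rewrite det2 !htorus_metric /del; ring. Qed.

Lemma htorus_area p : area f p = `|x * y * del|.
Proof. by rewrite /area htorus_det sqrtr_sqr. Qed.

Let det0 p : \det (metric f p) != 0.
Proof. by rewrite htorus_det expf_neq0 ?mulf_neq0. Qed.

Lemma htorus_row_free p : row_free (jac f p).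
Proof.
apply/row_freeP; exists ((jac f p)^T *m invmx (metric f p)).
rewrite mulmxA -/(metric f p) mulmxV// unitmxE unitfE; exact: det0.
Qed.

Lemma htorus_dot p : dot (f p) (f p) = x ^+ 2 + y ^+ 2.
Proof.
have [S2 E2] := rel p.
have H : dot (f p) (f p) = \sum_j fk j p * fk j p.
  by rewrite dotE; apply: eq_bigr => j _; rewrite -fkE.
by rewrite H sum4 /fk /=; ring: S2 E2.
Qed.

(** In each of the two planes second derivatives are radial and first derivatives are tangent to the
    circle, so there is no tangential part to remove. *)
Let normal_hess i l p : normal_part f p (pd i (pd l f) p) = pd i (pd l f) p.
Proof.
suff H : pd i (pd l f) p *m (jac f p)^T = 0.
  by rewrite /normal_part H !mul0mx subr0.
apply/rowP => k; rewrite [RHS]mxE.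
have H : (pd i (pd l f) p *m (jac f p)^T) 0 k = \sum_j f2 i l j p * f1 k j p.
  by rewrite mxE; apply: eq_bigr => j _; rewrite hE [(_ ^T) _ _]mxE jE.
by rewrite H sum4 /f2 /f1 /=; ring.
Qed.

Lemma htorus_mean_curv p j : mean_curv_vec f p 0 j =
  - 2^-1 * [:: C p / x; S p / x; D p / y; E p / y]`_j.
Proof.
have [i00 i01 i10 i11] := invmx2 _ (det0 p).
have H : mean_curv_vec f p 0 j = 2^-1 * (\sum_i \sum_l imetric f p i l * f2 i l j p).
  rewrite /mean_curv_vec mxE; congr (_ * _); rewrite summxE; apply: eq_bigr => i _.
  by rewrite summxE; apply: eq_bigr => l _; rewrite mxE normal_hess hE.
have ab := ab0.
rewrite H !sum2 /imetric i00 i01 i10 i11 htorus_det !htorus_metric /del.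
by have [->|->|->|->] := ord4P j; rewrite /f2 /=;
  move: (C p) (S p) (D p) (E p) (a 0) (a 1) (b 0) (b 1) ab => ? ? ? ? ? ? ? ? ab;
  field; rewrite ab x0 y0.
Qed.

(** The mean curvature vector in R^4 has constant squared norm [(x ^- 2 + y ^- 2) / 4], which on the
    unit sphere is the inverse of [4 * (x * y) ^+ 2]. *)
Lemma htorus_willmore : x ^+ 2 + y ^+ 2 = 1 ->
  willmore f = (pi ^+ 2 * `|del| / `|x * y|)%:E.
Proof.
move=> xy1.
have H p : dot (mean_curv_vec f p) (mean_curv_vec f p) * area f p = `|del| / (4 * `|x * y|).
  have [S2 E2] := rel p.
  have Hd : dot (mean_curv_vec f p) (mean_curv_vec f p) =
      \sum_(j < 4) (- 2^-1 * [:: C p / x; S p / x; D p / y; E p / y]`_j) ^+ 2.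
    by rewrite dotE; apply: eq_bigr => j _; rewrite htorus_mean_curv expr2.
  rewrite Hd sum4 htorus_area /= normrM.
  have -> : (- 2^-1 * (C p / x)) ^+ 2 + (- 2^-1 * (S p / x)) ^+ 2 +
    (- 2^-1 * (D p / y)) ^+ 2 + (- 2^-1 * (E p / y)) ^+ 2 =
    ((C p ^+ 2 + S p ^+ 2) * y ^+ 2 + (D p ^+ 2 + E p ^+ 2) * x ^+ 2) / (4 * (x * y) ^+ 2).
    by field; rewrite x0 y0.
  rewrite CS DE !mul1r addrC xy1 mul1r -(real_normK (num_real (x * y))).
  have n0 : `|x * y| != 0 by rewrite normr_eq0 mulf_neq0.
  by field.
rewrite /willmore /surf_int.
rewrite (_ : (fun p => _) = (fun=> (`|del| / (4 * `|x * y|))%:E)); last first.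
  by apply/funext => p; rewrite H.
rewrite integral_cst; last exact: measurable_cell.
have n0 : `|x * y| != 0 by rewrite normr_eq0 mulf_neq0.
apply: etrans (congr1 (fun z => _ * z)%E mu_cell) _.
by rewrite -EFinM; congr EFin; field.
Qed.

End HomogeneousTorus.

(** * Periodicity and derivatives of trigonometric functions of linear phases *)

Section TrigonometricLifts.
Context {R : realType}.
Implicit Types (p q : R * R).

Lemma cos_sin_2pi_int (x : R) (z : int) :
  cos (x + 2 * pi * z%:~R) = cos x /\ sin (x + 2 * pi * z%:~R) = sin x.
Proof.
have E : 2 * pi = pi *+ 2 :> R by rewrite mulr_natl.
have Hn (n : nat) (y : R) : cos (y + 2 * pi * n%:R) = cos y /\ sin (y + 2 * pi * n%:R) = sin y.
  elim: n y => [|n IH] y; first by rewrite mulr0 addr0.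
  have -> : y + 2 * pi * n.+1%:R = y + 2 * pi * n%:R + pi *+ 2.
    by rewrite -[n.+1%:R]natr1 -E mulrDr mulr1 addrA.
  rewrite cosD2pi sinD2pi; exact: IH.
case: z => n; first exact: Hn.
have [H1 H2] := Hn n.+1 (x + 2 * pi * (Negz n)%:~R).
move: H1 H2; rewrite NegzE mulrNz -pmulrn mulrN subrK => <- <-.
by [].
Qed.

Lemma trig_periodic (a b : int) :
  lattice_periodic lat2pi (fun p : R * R => cos (a%:~R * p.1 + b%:~R * p.2)) /\
  lattice_periodic lat2pi (fun p : R * R => sin (a%:~R * p.1 + b%:~R * p.2)).
Proof.
suff H p q : lat2pi (p - q) ->
    cos (a%:~R * p.1 + b%:~R * p.2) = cos (a%:~R * q.1 + b%:~R * q.2) /\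
    sin (a%:~R * p.1 + b%:~R * p.2) = sin (a%:~R * q.1 + b%:~R * q.2).
  by split=> p q /H[].
move=> /lattice_diagB[k [l [E1 E2]]].
have -> : a%:~R * p.1 + b%:~R * p.2 =
    a%:~R * q.1 + b%:~R * q.2 + 2 * pi * (a * k + b * l)%:~R.
  rewrite intrD !intrM.
  transitivity (a%:~R * q.1 + b%:~R * q.2 + (a%:~R * (p.1 - q.1) + b%:~R * (p.2 - q.2))).
    by ring.
  by rewrite E1 E2; ring.
exact: cos_sin_2pi_int.
Qed.

Lemma pder_cos_lin i (a b : R) :
  pder i (fun p => cos (a * p.1 + b * p.2))
         (fun p => - ((if i == 0 then a else b) * sin (a * p.1 + b * p.2))).
Proof.
by apply: pder_eq; [apply: pder_cos; exact: pder_lin|move=> p /=; rewrite mulNr mulrC].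
Qed.

Lemma pder_sin_lin i (a b : R) :
  pder i (fun p => sin (a * p.1 + b * p.2))
         (fun p => (if i == 0 then a else b) * cos (a * p.1 + b * p.2)).
Proof.
by apply: pder_eq; [apply: pder_sin; exact: pder_lin|move=> p /=; rewrite mulrC].
Qed.

Lemma sfam_cst (c : R) : sfam (fun _ _ => c).
Proof. by apply: (sfam_coef (fun=> c)) => x; exact: cvg_cst. Qed.

Lemma sfam_opp (G : R -> R * R -> R) : sfam G -> sfam (fun t p => - G t p).
Proof.
move=> sG; rewrite (_ : (fun t p => _) = (fun t p => -1 * G t p)).
  by apply: sfam_mul => //; exact: sfam_cst.
by apply/funext => t; apply/funext => p; rewrite mulN1r.
Qed.

End TrigonometricLifts.

(** * Tubes around torus knots *)

(* Tubes of radius arctan (q / p) around the curves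
   v |-> (S e^{iv}, c e^{imv}) of S^3, in the normal frame transported by the
   one-parameter group diag (e^{iv}, e^{imv}), rotated by the angle phi = u - v. *)
Section Tube.
Context {R : realType}.
Implicit Types (w z : R * R).
Variables (m c S n p q : R) (cv sv cm sm cf sn : R * R -> R).
Hypothesis cS : c ^+ 2 + S ^+ 2 = 1.
Hypothesis pq : p ^+ 2 + q ^+ 2 = 1.
Hypothesis n0 : 0 < n.
Hypothesis nE : n ^+ 2 = m ^+ 2 * c ^+ 2 + S ^+ 2.
Hypothesis q0' : q != 0.
(** Nondegeneracy of the tube: the quantity is the scalar product of its longitudinal derivative
    with the velocity of the core curve, [x] standing for the cosine [cf w]. *)
Hypothesis kappa : forall x : R, -1 <= x <= 1 ->
  p * (S ^+ 2 + m ^+ 2 * c ^+ 2) - q * (m ^+ 2 - 1) * S * c * x != 0.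
Hypothesis dcv : forall i, pder i cv (fun w => - ((if i == 0 then 0 else 1) * sv w)).
Hypothesis dsv : forall i, pder i sv (fun w => (if i == 0 then 0 else 1) * cv w).
Hypothesis dcm : forall i, pder i cm (fun w => - ((if i == 0 then 0 else m) * sm w)).
Hypothesis dsm : forall i, pder i sm (fun w => (if i == 0 then 0 else m) * cm w).
Hypothesis dcf : forall i, pder i cf (fun w => - ((if i == 0 then 1 else -1) * sn w)).
Hypothesis dsn : forall i, pder i sn (fun w => (if i == 0 then 1 else -1) * cf w).
Hypothesis csv : forall w, cv w ^+ 2 + sv w ^+ 2 = 1.
Hypothesis csm : forall w, cm w ^+ 2 + sm w ^+ 2 = 1.
Hypothesis csf : forall w, cf w ^+ 2 + sn w ^+ 2 = 1.

Definition tube w : 'rV[R]_4 := \row_j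
  [:: cv w * (p * S + q * c * cf w) - sv w * (q * (m * c / n) * sn w);
      sv w * (p * S + q * c * cf w) + cv w * (q * (m * c / n) * sn w);
      cm w * (p * c - q * S * cf w) - sm w * - (q * (S / n) * sn w);
      sm w * (p * c - q * S * cf w) + cm w * - (q * (S / n) * sn w)]`_j.

Local Notation f := tube.
Hypothesis sf : smooth f.

Let fk (j : 'I_4) w :=
  [:: cv w * (p * S + q * c * cf w) - sv w * (q * (m * c / n) * sn w);
      sv w * (p * S + q * c * cf w) + cv w * (q * (m * c / n) * sn w);
      cm w * (p * c - q * S * cf w) - sm w * - (q * (S / n) * sn w);
      sm w * (p * c - q * S * cf w) + cm w * - (q * (S / n) * sn w)]`_j.

Let fkE j : (fun w => f w 0 j) = fk j.
Proof. by apply/funext => w; rewrite mxE. Qed.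

Let rel w : [/\ sv w ^+ 2 = 1 - cv w ^+ 2, sm w ^+ 2 = 1 - cm w ^+ 2 &
  sn w ^+ 2 = 1 - cf w ^+ 2].
Proof.
by split; [rewrite -(csv w)|rewrite -(csm w)|rewrite -(csf w)]; rewrite addrAC subrr add0r.
Qed.

Lemma tube_dot w : dot (f w) (f w) = 1.
Proof.
have [v2 m2 f2] := rel w.
have H : dot (f w) (f w) = \sum_j fk j w * fk j w.
  by rewrite dotE; apply: eq_bigr => j _; rewrite -fkE.
have n_0 := lt0r_neq0 n0.
transitivity (p ^+ 2 * (c ^+ 2 + S ^+ 2) + q ^+ 2 * (c ^+ 2 + S ^+ 2) * cf w ^+ 2 +
    q ^+ 2 * ((m ^+ 2 * c ^+ 2 + S ^+ 2) / n ^+ 2) * sn w ^+ 2).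
  by rewrite H sum4 /fk /=; field: v2 m2.
rewrite cS -nE divff ?expf_neq0// !mulr1 -addrA -mulrDr csf mulr1.
exact: pq.
Qed.

Ltac pdr := first [ exact: dcv | exact: dsv | exact: dcm | exact: dsm | exact: dcf
  | exact: dsn | exact: pder_cst
  | apply: pderN; pdr | apply: pderD; pdr | apply: pderM; pdr ].

Let f_u (j : 'I_4) w :=
  [:: cv w * (- (q * c * sn w)) - sv w * (q * (m * c / n) * cf w);
      sv w * (- (q * c * sn w)) + cv w * (q * (m * c / n) * cf w);
      cm w * (q * S * sn w) - sm w * - (q * (S / n) * cf w);
      sm w * (q * S * sn w) + cm w * - (q * (S / n) * cf w)]`_j.

(* the derivative along phi = const *)
Let f_w (j : 'I_4) w :=
  [:: - (sv w * (p * S + q * c * cf w)) - cv w * (q * (m * c / n) * sn w);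
      cv w * (p * S + q * c * cf w) - sv w * (q * (m * c / n) * sn w);
      m * (- (sm w * (p * c - q * S * cf w)) - cm w * - (q * (S / n) * sn w));
      m * (cm w * (p * c - q * S * cf w) - sm w * - (q * (S / n) * sn w))]`_j.

Let d_u j : pder 0 (fk j) (f_u j).
Proof.
by have [->|->|->|->] := ord4P j; apply: pder_eq; try pdr; move=> w /=; rewrite /f_u /=; ring.
Qed.

Let d_v j : pder 1 (fk j) (fun w => f_w j w - f_u j w).
Proof.
by have [->|->|->|->] := ord4P j; apply: pder_eq; try pdr; move=> w /=; rewrite /f_w /f_u /=; ring.
Qed.

Let jE0 w j : jac f w 0 j = f_u j w.
Proof. by rewrite (jacE _ _ _ _ _ sf) fkE (pder_pd _ _ _ (d_u j)). Qed.

Let jE1 w j : jac f w 1 j = f_w j w - f_u j w.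
Proof. by rewrite (jacE _ _ _ _ _ sf) fkE (pder_pd _ _ _ (d_v j)). Qed.

(** Velocity of the core curve. It is orthogonal to the normal frame, hence to [f_u]. *)
Let K (j : 'I_4) w := [:: - (S * sv w); S * cv w; - (m * c * sm w); m * c * cm w]`_j.

Let KU w : \sum_j f_u j w * K j w = 0.
Proof.
have [v2 m2 f2] := rel w.
by rewrite sum4 /f_u /K /=; ring: v2 m2.
Qed.

Let KW w : \sum_j f_w j w * K j w =
  p * (S ^+ 2 + m ^+ 2 * c ^+ 2) - q * (m ^+ 2 - 1) * S * c * cf w.
Proof.
have [v2 m2 f2] := rel w.
by rewrite sum4 /f_w /K /=; ring: v2 m2.
Qed.

Let UU w : \sum_j f_u j w * f_u j w = q ^+ 2.
Proof.
have [v2 m2 f2] := rel w; have n_0 := lt0r_neq0 n0.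
transitivity (q ^+ 2 * (c ^+ 2 + S ^+ 2) * sn w ^+ 2 +
    q ^+ 2 * ((m ^+ 2 * c ^+ 2 + S ^+ 2) / n ^+ 2) * cf w ^+ 2).
  by rewrite sum4 /f_u /=; field: v2 m2.
by rewrite cS -nE divff ?expf_neq0// !mulr1 -mulrDr addrC csf mulr1.
Qed.

(** Tested against [K] and [f_u], the Jacobian becomes a square matrix whose first entry is zero and
    whose anti-diagonal entries are [q ^+ 2] and the quantity of [kappa]. *)
Lemma tube_row_free w : row_free (jac f w).
Proof.
pose B : 'M[R]_(4, 2) := \matrix_(j, l) (if l == 0 then K j w else f_u j w).
have JB i l : (jac f w *m B) i l = \sum_j jac f w i j * (if l == 0 then K j w else f_u j w).
  by rewrite mxE; apply: eq_bigr => j _; rewrite [B _ _]mxE.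
have J00 : (jac f w *m B) 0 0 = 0.
  by apply: etrans (JB _ _) (etrans _ (KU w)); apply: eq_bigr => j _; rewrite jE0.
have J01 : (jac f w *m B) 0 1 = q ^+ 2.
  by apply: etrans (JB _ _) (etrans _ (UU w)); apply: eq_bigr => j _; rewrite jE0.
have J10 : (jac f w *m B) 1 0 =
    p * (S ^+ 2 + m ^+ 2 * c ^+ 2) - q * (m ^+ 2 - 1) * S * c * cf w.
  have E : \sum_j (f_w j w - f_u j w) * K j w =
      p * (S ^+ 2 + m ^+ 2 * c ^+ 2) - q * (m ^+ 2 - 1) * S * c * cf w.
    rewrite -(KW w) -[RHS]subr0 -[X in _ - X](KU w) -sumrB.
    by apply: eq_bigr => j _; rewrite mulrBl.
  by apply: etrans (JB _ _) (etrans _ E); apply: eq_bigr => j _; rewrite jE1.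
have D0 : \det (jac f w *m B) != 0.
  rewrite det2 J00 J01 J10 mul0r sub0r oppr_eq0 mulf_neq0 ?expf_neq0//.
  apply: kappa; have [v2 m2 f2] := rel w.
  by rewrite -ler_norml -(@ler_pXn2r _ 2)// ?nnegrE// expr1n real_normK ?num_real//
    -(csf w) lerDl sqr_ge0.
apply/row_freeP; exists (B *m invmx (jac f w *m B)).
by rewrite mulmxA mulmxV// unitmxE unitfE.
Qed.

End Tube.

(** * Named cosines and sines of linear phases *)

Section LinearTrig.
Context {R : realType}.
Implicit Types (p w : R * R).

Definition lcos (a b : R) p := cos (a * p.1 + b * p.2).
Definition lsin (a b : R) p := sin (a * p.1 + b * p.2).

Lemma lcos_lsin a b p : lcos a b p ^+ 2 + lsin a b p ^+ 2 = 1.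
Proof. exact: cos2Dsin2. Qed.

Lemma pder_lcos i a b : pder i (lcos a b) (fun p => - ((if i == 0 then a else b) * lsin a b p)).
Proof. exact: pder_cos_lin. Qed.

Lemma pder_lsin i a b : pder i (lsin a b) (fun p => (if i == 0 then a else b) * lcos a b p).
Proof. exact: pder_sin_lin. Qed.

Lemma sfam_lcos a b : sfam (fun _ => lcos a b). Proof. exact: sfam_cos. Qed.

Lemma sfam_lsin a b : sfam (fun _ => lsin a b). Proof. exact: sfam_sin. Qed.

Lemma lcos_periodic (a b : int) : lattice_periodic lat2pi (lcos a%:~R b%:~R).
Proof. by case: (@trig_periodic R a b). Qed.

Lemma lsin_periodic (a b : int) : lattice_periodic lat2pi (lsin a%:~R b%:~R).
Proof. by case: (@trig_periodic R a b). Qed.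

Lemma smooth_lcos a b : smooth (lcos a b).
Proof. by apply: sfam_smooth; exact: sfam_lcos. Qed.

Lemma smooth_lsin a b : smooth (lsin a b).
Proof. by apply: sfam_smooth; exact: sfam_lsin. Qed.

Lemma smooth_htorus x y a b c d :
  smooth (htorus x y (lcos a b) (lsin a b) (lcos c d) (lsin c d)).
Proof.
apply: smooth_row => j.
rewrite (_ : (fun p => _) = (fun p => [:: x * lcos a b p; x * lsin a b p;
    y * lcos c d p; y * lsin c d p]`_j)); last first.
  by apply/funext => p; rewrite mxE.
apply: sfam_smooth; have [->|->|->|->] := ord4P j => /=;
  apply: sfam_mul; try exact: sfam_cst; try exact: sfam_lcos; exact: sfam_lsin.
Qed.

End LinearTrig.

(** * The competitor: energy, conformal class and criticality *)

Section Stereographic.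
Context {R : realType}.
Implicit Types (p w : R * R).
Variables (s sg : R) (k : nat).
Hypothesis s0 : 0 < s.
Hypothesis sg0 : 0 < sg.
Hypothesis ssg : s ^+ 2 + sg ^+ 2 = 1.
Hypothesis s_ge : sg <= s.

Local Notation K := (k%:R : R).

(** The sign of the second radius is the one with which the tube at time 0 of the homotopy produces
    this torus. *)
Definition twisted_torus : R * R -> 'rV[R]_4 :=
  htorus s (- sg) (lcos 0 1) (lsin 0 1) (lcos 1 K) (lsin 1 K).

Let pcos01 : lattice_periodic lat2pi (lcos (0 : R) 1).
Proof. exact: (lcos_periodic 0 1). Qed.
Let psin01 : lattice_periodic lat2pi (lsin (0 : R) 1).
Proof. exact: (lsin_periodic 0 1). Qed.
Let pcos1k : lattice_periodic lat2pi (lcos (1 : R) K).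
Proof. exact: (lcos_periodic 1 k). Qed.
Let psin1k : lattice_periodic lat2pi (lsin (1 : R) K).
Proof. exact: (lsin_periodic 1 k). Qed.

Let s_0 : s != 0. Proof. by rewrite gt_eqF. Qed.
Let sg_0 : - sg != 0. Proof. by rewrite oppr_eq0 gt_eqF. Qed.

Let del_twisted_torus : (if (0 : 'I_2) == 0 then 0 else 1) * (if (1 : 'I_2) == 0 then 1 else K) -
  (if (1 : 'I_2) == 0 then 0 else 1) * (if (0 : 'I_2) == 0 then 1 else K) = -1 :> R.
Proof. by rewrite /= mul0r mulr1 sub0r. Qed.

Let del_twisted_torus0 : (if (0 : 'I_2) == 0 then 0 else 1) * (if (1 : 'I_2) == 0 then 1 else K) -
  (if (1 : 'I_2) == 0 then 0 else 1) * (if (0 : 'I_2) == 0 then 1 else K) != 0 :> R.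
Proof. by rewrite del_twisted_torus oppr_eq0 oner_neq0. Qed.

Lemma twisted_torus_immersionS3 : immersionS3 twisted_torus.
Proof.
split.
  split; first exact: smooth_htorus.
    move=> p q pq; rewrite /twisted_torus /htorus.
    by rewrite (pcos01 _ _ pq) (psin01 _ _ pq) (pcos1k _ _ pq) (psin1k _ _ pq).
  exact: (htorus_row_free _ _ (fun i => if i == 0 then 0 else 1) (fun i => if i == 0 then 1 else K)
    _ _ _ _ s_0 sg_0 del_twisted_torus0 (fun i => pder_lcos i 0 1) (fun i => pder_lsin i 0 1)
    (fun i => pder_lcos i 1 K) (fun i => pder_lsin i 1 K) (lcos_lsin _ _) (lcos_lsin _ _)
    (smooth_htorus _ _ _ _ _ _)).
move=> p; apply: etrans (htorus_dot _ _ _ _ _ _ (lcos_lsin _ _) (lcos_lsin _ _) p) _.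
by rewrite sqrrN.
Qed.

Lemma twisted_torus_willmore : willmore twisted_torus = (pi ^+ 2 / (s * sg))%:E.
Proof.
apply: etrans (htorus_willmore _ _ (fun i => if i == 0 then 0 else 1) (fun i => if i == 0 then 1 else K)
    _ _ _ _ s_0 sg_0 del_twisted_torus0 (fun i => pder_lcos i 0 1) (fun i => pder_lsin i 0 1)
    (fun i => pder_lcos i 1 K) (fun i => pder_lsin i 1 K) (lcos_lsin _ _) (lcos_lsin _ _)
    (smooth_htorus _ _ _ _ _ _) _) _; first by rewrite sqrrN.
by rewrite del_twisted_torus mulrN !normrN normr1 mulr1 gtr0_norm ?mulr_gt0.
Qed.

Lemma twisted_torus_conf_class : conf_class (metric twisted_torus) (0, s / sg).
Proof.
apply: (conf_class_sheared _ k _ (fun=> sg ^+ 2)).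
- by rewrite ler_pdivlMr// mul1r.
- by move=> _; rewrite exprn_gt0.
have H p i l : metric twisted_torus p i l = s ^+ 2 * ((if i == 0 then 0 else 1) * (if l == 0 then 0 else 1)) +
   sg ^+ 2 * ((if i == 0 then 1 else K) * (if l == 0 then 1 else K)).
  rewrite -(sqrrN sg).
  exact: (htorus_metric _ _ (fun i => if i == 0 then 0 else 1) (fun i => if i == 0 then 1 else K)
    _ _ _ _ (fun i => pder_lcos i 0 1) (fun i => pder_lsin i 0 1)
    (fun i => pder_lcos i 1 K) (fun i => pder_lsin i 1 K) (lcos_lsin _ _) (lcos_lsin _ _)
    (smooth_htorus _ _ _ _ _ _)).
move=> p; have g0 : sg != 0 by rewrite gt_eqF.
by split; apply: etrans (H _ _ _) _ => /=; field.
Qed.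

Let L p := (1 - s * lcos 0 1 p)^-1.

Let s1 : s < 1.
Proof.
rewrite -(@ltr_pXn2r _ 2)// ?nnegrE ?ler01 ?(ltW s0)// expr1n -ssg ltrDl exprn_gt0//.
Qed.

Let den0 p : 0 < 1 - s * lcos 0 1 p.
Proof.
rewrite subr_gt0 (le_lt_trans _ s1)// ler_piMr ?(ltW s0)//; exact: cos_le1.
Qed.

Let Lc p : L p * (1 - s * lcos 0 1 p) = 1.
Proof. by rewrite /L mulVf// gt_eqF. Qed.

Let L0 p : 0 < L p.
Proof. by rewrite /L invr_gt0. Qed.

Let sfL : sfam (fun _ => L).
Proof.
apply: sfam_inv; first by move=> _ p; rewrite gt_eqF.
apply: sfam_add; first exact: sfam_cst.
apply: sfam_opp; apply: sfam_mul; [exact: sfam_cst|exact: sfam_lcos].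
Qed.

Let dL i : pder i L (fun p => - (s * ((if i == 0 then 0 else 1) * lsin 0 1 p) * (L p * L p))).
Proof.
apply: pder_eq.
  apply: pderV; first by move=> p; rewrite gt_eqF.
  apply: pderD; first exact: pder_cst.
  apply: pderN; apply: pderM; [exact: pder_cst|exact: pder_lcos].
move=> p /=; rewrite /L; have := den0 p.
move: (lsin 0 1 p) (lcos 0 1 p) (if i == 0 then _ else _) => x y d y0.
by field; rewrite gt_eqF.
Qed.

Let rt := rtorus s sg (lcos 1 K) (lsin 1 K) (lsin 0 1) L.

Let srt : smooth rt.
Proof.
apply: smooth_row => j.
rewrite (_ : (fun p => _) = (fun p => [:: s * lsin 0 1 p * L p; - (sg * lcos 1 K p * L p);
   - (sg * lsin 1 K p * L p)]`_j)); last by apply/funext => p; rewrite mxE.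
apply: sfam_smooth; have [->|->|->] := ord3P j => /=; try apply: sfam_opp;
  apply: sfam_mul (sfL); (apply: sfam_mul; first exact: sfam_cst);
  first [exact: sfam_lcos|exact: sfam_lsin].
Qed.

Let dC0 : pder 0 (lcos 1 K) (fun p => - lsin 1 K p).
Proof. by apply: pder_eq (pder_lcos 0 1 K) _ => p /=; rewrite mul1r. Qed.
Let dC1 : pder 1 (lcos 1 K) (fun p => - (K * lsin 1 K p)).
Proof. exact: (pder_lcos 1 1 K). Qed.
Let dS0 : pder 0 (lsin 1 K) (fun p => lcos 1 K p).
Proof. by apply: pder_eq (pder_lsin 0 1 K) _ => p /=; rewrite mul1r. Qed.
Let dS1 : pder 1 (lsin 1 K) (fun p => K * lcos 1 K p).
Proof. exact: (pder_lsin 1 1 K). Qed.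
Let dc0 : pder 0 (lcos (0 : R) 1) (fun=> 0).
Proof. by apply: pder_eq (pder_lcos 0 0 1) _ => p /=; rewrite mul0r oppr0. Qed.
Let dc1 : pder 1 (lcos (0 : R) 1) (fun p => - lsin 0 1 p).
Proof. by apply: pder_eq (pder_lcos 1 0 1) _ => p /=; rewrite mul1r. Qed.
Let dt0 : pder 0 (lsin (0 : R) 1) (fun=> 0).
Proof. by apply: pder_eq (pder_lsin 0 0 1) _ => p /=; rewrite mul0r. Qed.
Let dt1 : pder 1 (lsin (0 : R) 1) (fun p => lcos 0 1 p).
Proof. by apply: pder_eq (pder_lsin 1 0 1) _ => p /=; rewrite mul1r. Qed.
Let dL0 : pder 0 L (fun=> 0).
Proof. by apply: pder_eq (dL 0) _ => p /=; rewrite mul0r mulr0 mul0r oppr0. Qed.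
Let dL1 : pder 1 L (fun p => - (s * lsin 0 1 p * (L p * L p))).
Proof. by apply: pder_eq (dL 1) _ => p /=; rewrite mul1r. Qed.

Let rt_conf : conf_class (metric rt) (0, s / sg).
Proof.
apply: (conf_class_sheared _ k _ (fun p => sg ^+ 2 * (L p * L p))).
- by rewrite ler_pdivlMr// mul1r.
- by move=> p; rewrite mulr_gt0 ?exprn_gt0// mulr_gt0.
have g0 : sg != 0 by rewrite gt_eqF.
move=> p; have [h00 h01 h10 h11] := rtorus_metric _ _ _ _ _ _ _ _ ssg dC0 dC1 dS0 dS1 dt0 dt1
  dL0 dL1 (lcos_lsin _ _) (lcos_lsin _ _) Lc srt p.
split; [exact: h00|rewrite mulrA; exact: h01|rewrite mulrA; exact: h10|].
by apply: etrans h11 _; field.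
Qed.

Lemma twisted_torus_conf_willmoreS3 : conf_willmoreS3 twisted_torus.
Proof.
split; first exact: twisted_torus_immersionS3.
(* Projection from the first basis vector. The last two coordinates of the torus run on a circle of
   radius [sg] and never vanish together, so the torus misses this point; the image is then a
   surface of revolution. *)
pose P : 'rV[R]_4 := \row_j (j == 0 :> nat)%:R.
pose B : 'M[R]_(3, 4) := \matrix_(i < 3, j < 4) (j == i.+1 :> nat)%:R.
have dP (x : 'rV[R]_4) : dot x P = x 0 q0.
  by rewrite dotE sum4 !mxE /= mulr1 !mulr0 !addr0.
have mB (x : 'rV[R]_4) j : (x *m B^T) 0 j = x 0 (lift ord0 j).
  rewrite mxE sum4 !mxE /= !mulr0.
  have [->|->|->] := ord3P j; rewrite /= ?mulr0 ?mulr1 ?add0r ?addr0; congr (x _ _); exact: val_inj.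
exists P, B; split.
- by rewrite dP mxE.
- apply/matrixP => i j; rewrite !mxE sum4 !mxE /= !mulr0 add0r.
  by have [->|->|->] := ord3P i; have [->|->|->] := ord3P j;
    rewrite /= ?mulr0 ?mulr1 ?mul0r ?add0r ?addr0.
- apply/matrixP => i j; rewrite !mxE sum4 !mxE /= !mulr0 !addr0.
  by rewrite mul0r.
- move=> p fp.
  have E x : x = P -> x 0 q2 = 0 /\ x 0 q3 = 0 by move=> ->; rewrite !mxE.
  have [] := E _ fp; rewrite !mxE /= => /eqP; rewrite mulf_eq0 (negbTE sg_0) /= => /eqP c0 /eqP.
  rewrite mulf_eq0 (negbTE sg_0) /= => /eqP sn0.
  by have := lcos_lsin 1 K p; rewrite c0 sn0 expr0n addr0 => /eqP; rewrite eq_sym oner_eq0.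
have E : stereo P B \o twisted_torus = rt.
  apply/funext => p; apply/rowP => j; rewrite /stereo /= mxE mB dP.
  rewrite [twisted_torus p 0 q0]mxE [RHS]mxE [twisted_torus p 0 _]mxE /= -/(L p).
  by have [->|->|->] := ord3P j; rewrite /= ?bump_0 /=; ring.
rewrite E.
have cL : continuous L by apply: smooth_continuous; exact: sfam_smooth.
have cc a b : continuous (lcos (a : R) b) by apply: smooth_continuous; exact: smooth_lcos.
have cs a b : continuous (lsin (a : R) b) by apply: smooth_continuous; exact: smooth_lsin.
have c1 : 1 <= s / sg by rewrite ler_pdivlMr// mul1r.
have frt p : row_free (jac rt p) := rtorus_row_free _ _ _ _ _ _ _ _ s0 sg0 ssg dC0 dC1 dS0 dS1 dt0 dt1
  dL0 dL1 (lcos_lsin _ _) (lcos_lsin _ _) Lc L0 srt p.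
have prt : lattice_periodic lat2pi rt.
  move=> p q pq; rewrite /rt /rtorus /L.
  by rewrite (pcos01 _ _ pq) (psin01 _ _ pq) (pcos1k _ _ pq) (psin1k _ _ pq).
apply: (conf_willmore_critical _ _ c1 _ rt_conf).
- by split.
- have e p : energy (metric rt p) = sg / s := rtorus_energy _ _ _ _ _ _ _ _ s0 sg0 ssg dC0 dC1 dS0 dS1
    dt0 dt1 dL0 dL1 (lcos_lsin _ _) (lcos_lsin _ _) Lc L0 srt p.
  rewrite (_ : (fun p => _) = (fun=> sg / s)); last exact/funext.
  by rewrite Rintegral_cst_cell invf_div mulrC.
- move=> j; exact: (rtorus_continuous_grad _ _ _ _ _ _ _ _ s0 sg0 ssg dC0 dC1 dS0 dS1 dc0 dc1
    dt0 dt1 dL0 dL1 (lcos_lsin _ _) (lcos_lsin _ _) Lc L0 srt (cc _ _) (cs _ _) (cc _ _) (cs _ _) cL j).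
- move=> V; exact: (rtorus_critical _ _ _ _ _ _ _ _ s0 sg0 ssg dC0 dC1 dS0 dS1 dc0 dc1
    dt0 dt1 dL0 dL1 (lcos_lsin _ _) (lcos_lsin _ _) Lc L0 srt (cc _ _) (cs _ _) (cc _ _) (cs _ _)
    pcos1k psin1k pcos01 psin01 V).
Qed.

End Stereographic.

(** * Energy and conformal class of the multiply covered torus *)

Section Covering.
Context {R : realType}.
Implicit Types (p w : R * R).
Variables (m : nat) (r rho : R).
Local Notation M := (m%:R : R).
Hypothesis M1 : 1 <= M.
Hypothesis r0 : 0 < r.
Hypothesis rhoE : rho = M * r.
Hypothesis rrho : r ^+ 2 + rho ^+ 2 = 1.

Lemma torus_mrE : torus_mr m r = htorus r rho (lcos 1 0) (lsin 1 0) (lcos 0 M) (lsin 0 M).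
Proof.
have M0 : 0 <= M := le_trans ler01 M1.
have E : Num.sqrt (1 - r ^+ 2) = rho.
  rewrite -[X in X - _]rrho [X in X - _]addrC addrK sqrtr_sqr ger0_norm//.
  by rewrite rhoE mulr_ge0// ltW.
apply/funext => p; rewrite /torus_mr /torus_r /htorus E /lcos /lsin /=.
by rewrite !mul1r !mul0r addr0 add0r.
Qed.

Let M0 : M != 0. Proof. by rewrite gt_eqF// (lt_le_trans ltr01). Qed.
Let r_0 : r != 0. Proof. by rewrite gt_eqF. Qed.
Let rho_0 : rho != 0. Proof. by rewrite rhoE mulf_neq0. Qed.
Let del0 : (if (0 : 'I_2) == 0 then 1 else 0) * (if (1 : 'I_2) == 0 then 0 else M) -
  (if (1 : 'I_2) == 0 then 1 else 0) * (if (0 : 'I_2) == 0 then 0 else M) != 0 :> R.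
Proof. by rewrite /= mul1r mul0r subr0. Qed.

(** The relation [rho = M * r] simplifies the general value [pi ^+ 2 * M / (r * rho)]. *)
Lemma torus_mr_willmore : willmore (torus_mr m r) = (pi ^+ 2 / r ^+ 2)%:E.
Proof.
rewrite torus_mrE.
apply: etrans (htorus_willmore _ _ (fun i => if i == 0 then 1 else 0) (fun i => if i == 0 then 0 else M)
    _ _ _ _ r_0 rho_0 del0 (fun i => pder_lcos i 1 0) (fun i => pder_lsin i 1 0)
    (fun i => pder_lcos i 0 M) (fun i => pder_lsin i 0 M) (lcos_lsin _ _) (lcos_lsin _ _)
    (smooth_htorus _ _ _ _ _ _) rrho) _.
rewrite /= mul1r mul0r subr0 rhoE !normrM (gtr0_norm r0) (ger0_norm (le_trans ler01 M1)).
by congr EFin; field; rewrite M0 r_0.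
Qed.

(** The metric is rectangular, the case of zero shear, and its side ratio [M * rho / r] equals
    [M ^+ 2]. *)
Lemma torus_mr_conf_class : conf_class (metric (torus_mr m r)) (0, M ^+ 2).
Proof.
rewrite torus_mrE.
apply: (conf_class_sheared _ 0 _ (fun=> r ^+ 2)).
- by rewrite exprn_ege1.
- by move=> _; rewrite exprn_gt0.
have H p i l := htorus_metric r rho (fun i => if i == 0 then 1 else 0) (fun i => if i == 0 then 0 else M)
    _ _ _ _ (fun i => pder_lcos i 1 0) (fun i => pder_lsin i 1 0)
    (fun i => pder_lcos i 0 M) (fun i => pder_lsin i 0 M) (lcos_lsin _ _) (lcos_lsin _ _)
    (smooth_htorus _ _ _ _ _ _) p i l.
by move=> p; split; apply: etrans (H _ _ _) _ => /=; rewrite ?rhoE; ring.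
Qed.

End Covering.

(** * The regular homotopy through tubes *)

Section Homotopy.
Context {R : realType}.
Implicit Types (p w : R * R) (t : R).
Variables (m : nat).
Local Notation M := (m%:R : R).
Hypothesis m2 : (1 < m)%N.

Let M1 : 1 < M. Proof. by rewrite ltr1n. Qed.
Let M0 : 0 < M. Proof. exact: lt_trans ltr01 M1. Qed.
Let M_0 : M != 0. Proof. by rewrite gt_eqF. Qed.

(** Angle of the core curve: [(S, c)] turns from [(1, 0)] at time 0 to [(0, 1)] at time 1. *)
Let al t : R := pi / 2 * (1 - t).
Let c t : R := cos (al t).
Let S t : R := sin (al t).
Let n t : R := Num.sqrt (M ^+ 2 * c t ^+ 2 + S t ^+ 2).
(** The ratio of [Q] to [P], interpolated linearly between [sg / s], which is [M ^- 2], and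
    [r / rho], which is [M^-1]. *)
Let tau t : R := (1 - t) / M ^+ 2 + t / M.
Let P t : R := (Num.sqrt (1 + tau t ^+ 2))^-1.
Let Q t : R := tau t * P t.

Let cS t : c t ^+ 2 + S t ^+ 2 = 1. Proof. exact: cos2Dsin2. Qed.

Let n_gt0 t : 0 < n t.
Proof.
rewrite sqrtr_gt0 (@lt_le_trans _ _ 1)// -[leLHS](cS t) lerD2r ler_peMl ?sqr_ge0//.
by rewrite exprn_ege1// ltW.
Qed.

Let nE t : n t ^+ 2 = M ^+ 2 * c t ^+ 2 + S t ^+ 2.
Proof. by rewrite sqr_sqrtr// addr_ge0 ?sqr_ge0// mulr_ge0 ?sqr_ge0. Qed.

Let tau2 t : 0 < 1 + tau t ^+ 2.
Proof. by rewrite ltr_pwDl ?sqr_ge0. Qed.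

Let P_gt0 t : 0 < P t.
Proof. by rewrite invr_gt0 sqrtr_gt0. Qed.

Let PQ t : P t ^+ 2 + Q t ^+ 2 = 1.
Proof.
rewrite /Q exprMn -[X in X + _]mul1r -mulrDl /P exprVn sqr_sqrtr ?ltW//.
by rewrite divff// gt_eqF.
Qed.

Let tau_gt0 t : 0 <= t <= 1 -> 0 < tau t.
Proof.
move=> /andP[t0 t1]; rewrite /tau.
have [->|tn0] := eqVneq t 0; first by rewrite subr0 mul0r addr0 divr_gt0 ?exprn_gt0.
have tp : 0 < t by rewrite lt_neqAle eq_sym tn0.
have M20 : 0 <= M ^+ 2 by rewrite exprn_ge0// ltW.
by rewrite ltr_wpDl ?divr_gt0// divr_ge0// subr_ge0.
Qed.

Let tauM t : 0 <= t <= 1 -> tau t * M <= 1.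
Proof.
move=> /andP[t0 t1].
have -> : tau t * M = 1 - (1 - t) * (1 - M^-1) by rewrite /tau; field.
by rewrite lerBlDr lerDl mulr_ge0 ?subr_ge0// invf_le1// ltW.
Qed.

(** Divided by [P t], this is the quadratic form S^2 - X S c + M^2 c^2 in (S, c), which is definite
    when |X| < 2 M. Since [tau t] is at most 1 / M, |X| is at most M. *)
Let kappa t : 0 <= t <= 1 -> forall x : R, -1 <= x <= 1 ->
  P t * (S t ^+ 2 + M ^+ 2 * c t ^+ 2) - Q t * (M ^+ 2 - 1) * S t * c t * x != 0.
Proof.
move=> t01 x x1; pose X := tau t * (M ^+ 2 - 1) * x.
have -> : P t * (S t ^+ 2 + M ^+ 2 * c t ^+ 2) - Q t * (M ^+ 2 - 1) * S t * c t * x =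
    P t * ((S t - X * c t / 2) ^+ 2 + (M ^+ 2 - X ^+ 2 / 4) * c t ^+ 2).
  by rewrite /X /Q; field.
rewrite mulf_neq0 ?gt_eqF//.
have X2 : X ^+ 2 <= M ^+ 2.
  rewrite -[X ^+ 2]real_normK ?num_real// lerXn2r ?nnegrE ?normr_ge0 ?(ltW M0)//.
  have M21 : 0 <= M ^+ 2 - 1 by rewrite subr_ge0 exprn_ege1// ltW.
  rewrite /X !normrM (gtr0_norm (tau_gt0 _ t01)) (ger0_norm M21).
  have x1' : `|x| <= 1 by rewrite ler_norml.
  rewrite (le_trans (ler_piMr _ x1'))// ?mulr_ge0// ?(ltW (tau_gt0 _ t01))//.
  rewrite (@le_trans _ _ (tau t * M * M))//.
    by rewrite -mulrA ler_wpM2l ?(ltW (tau_gt0 _ t01))// -expr2 lerBlDr lerDl.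
  by rewrite ler_piMl ?(ltW M0)// tauM.
have [c0|c0] := eqVneq (c t) 0.
  have S2 : S t ^+ 2 = 1 by rewrite -(cS t) c0 expr0n add0r.
  by rewrite c0 mulr0 mul0r subr0 S2 expr0n mulr0 addr0.
rewrite ltr_wpDl ?sqr_ge0// mulr_gt0//; last by rewrite lt_neqAle sqr_ge0 eq_sym expf_neq0.
have := exprn_gt0 2 M0; lra.
Qed.

Let F t := tube M (c t) (S t) (n t) (P t) (Q t) (lcos 0 1) (lsin 0 1) (lcos 0 M) (lsin 0 M)
  (lcos 1 (-1)) (lsin 1 (-1)).

Let cal : continuous al.
Proof.
by move=> x; apply: cvgM; [exact: cvg_cst|apply: cvgB; [exact: cvg_cst|exact: cvg_id]].
Qed.
Let cc : continuous c.
Proof. by move=> x; apply: (cvg_comp _ _ (cal x)); exact: continuous_cos. Qed.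
Let cSt : continuous S.
Proof. by move=> x; apply: (cvg_comp _ _ (cal x)); exact: continuous_sin. Qed.
Let cn : continuous n.
Proof.
move=> x.
have H : M ^+ 2 * c y ^+ 2 + S y ^+ 2 @[y --> x] --> M ^+ 2 * c x ^+ 2 + S x ^+ 2.
  apply: cvgD; last exact: (cvg_comp _ _ (cSt x) (@exprn_continuous R 2 _)).
  apply: cvgM; first exact: cvg_cst.
  exact: (cvg_comp _ _ (cc x) (@exprn_continuous R 2 _)).
exact: (cvg_comp _ _ H (@sqrt_continuous R _)).
Qed.
Let ctau : continuous tau.
Proof.
move=> x; apply: cvgD; apply: cvgM; try exact: cvg_cst; last exact: cvg_id.
by apply: cvgB; [exact: cvg_cst|exact: cvg_id].
Qed.
Let cP : continuous P.
Proof.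
move=> x; apply: cvgV; first by rewrite gt_eqF// sqrtr_gt0.
have H : 1 + tau y ^+ 2 @[y --> x] --> 1 + tau x ^+ 2.
  apply: cvgD; first exact: cvg_cst.
  exact: (cvg_comp _ _ (ctau x) (@exprn_continuous R 2 _)).
exact: (cvg_comp _ _ H (@sqrt_continuous R _)).
Qed.
Let cQ : continuous Q.
Proof. by move=> x; apply: cvgM; [exact: ctau|exact: cP]. Qed.
Let ccn : continuous (fun t => M * c t / n t).
Proof.
move=> x; apply: cvgM; first by apply: cvgM; [exact: cvg_cst|exact: cc].
by apply: cvgV; [rewrite gt_eqF|exact: cn].
Qed.
Let cSn : continuous (fun t => S t / n t).
Proof.
move=> x; apply: cvgM; first exact: cSt.
by apply: cvgV; [rewrite gt_eqF|exact: cn].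
Qed.

Ltac sf := first [ exact: (sfam_coef _ cc) | exact: (sfam_coef _ cSt) | exact: (sfam_coef _ cP)
  | exact: (sfam_coef _ cQ) | exact: (sfam_coef _ ccn) | exact: (sfam_coef _ cSn)
  | exact: sfam_lcos | exact: sfam_lsin
  | apply: sfam_opp; sf | apply: sfam_add; sf | apply: sfam_mul; sf ].

Let sF : smooth_family `[0, 1] F.
Proof.
apply: smooth_family_row => j; apply: sfam_smooth_family.
rewrite (_ : (fun t p => _) = (fun t w =>
    [:: lcos 0 1 w * (P t * S t + Q t * c t * lcos 1 (-1) w) -
        lsin 0 1 w * (Q t * (M * c t / n t) * lsin 1 (-1) w);
      lsin 0 1 w * (P t * S t + Q t * c t * lcos 1 (-1) w) +
        lcos 0 1 w * (Q t * (M * c t / n t) * lsin 1 (-1) w);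
      lcos 0 M w * (P t * c t - Q t * S t * lcos 1 (-1) w) -
        lsin 0 M w * - (Q t * (S t / n t) * lsin 1 (-1) w);
      lsin 0 M w * (P t * c t - Q t * S t * lcos 1 (-1) w) +
        lcos 0 M w * - (Q t * (S t / n t) * lsin 1 (-1) w)]`_j)); last first.
  by apply/funext => t; apply/funext => p; rewrite mxE.
by have [->|->|->|->] := ord4P j => /=; sf.
Qed.

Let iF t : 0 <= t <= 1 -> immersionS3 (F t).
Proof.
move=> t01; have sFt : smooth (F t) by case: sF => + _; apply; rewrite /= in_itv.
split; last first.
  by move=> p; apply: tube_dot => //; exact: lcos_lsin.
split=> //; last first.
  move=> p; apply: (tube_row_free _ _ _ _ _ _ _ _ _ _ _ _ (cS t) (n_gt0 t) (nE t) _ (kappa _ t01)) => //;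
    try (by move=> i; exact: pder_lcos); try (by move=> i; exact: pder_lsin); try exact: lcos_lsin.
  by rewrite mulf_neq0 ?gt_eqF ?tau_gt0.
move=> p q pq; rewrite /F /tube.
rewrite (lcos_periodic 0 1 _ _ pq : lcos 0 1 p = lcos 0 1 q).
rewrite (lsin_periodic 0 1 _ _ pq : lsin 0 1 p = lsin 0 1 q).
rewrite (lcos_periodic 0 m _ _ pq : lcos 0 M p = lcos 0 M q).
rewrite (lsin_periodic 0 m _ _ pq : lsin 0 M p = lsin 0 M q).
rewrite (lcos_periodic 1 (-1) _ _ pq : lcos 1 (-1) p = lcos 1 (-1) q).
by rewrite (lsin_periodic 1 (-1) _ _ pq : lsin 1 (-1) p = lsin 1 (-1) q).
Qed.

Lemma twisted_torus_torus_mr_homotopic (s sg r rho : R) :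
  0 < s -> 0 < sg -> s = M ^+ 2 * sg -> s ^+ 2 + sg ^+ 2 = 1 ->
  0 < r -> rho = M * r -> r ^+ 2 + rho ^+ 2 = 1 ->
  reg_homotopicS3 (twisted_torus s sg m.-1) (torus_mr m r).
Proof.
move=> s0 sg0 sE ssg r0 rhoE rrho.
(* A point of the unit circle with positive abscissa is determined by its slope. *)
have PQval t x y : 0 < x -> tau t = y / x -> x ^+ 2 + y ^+ 2 = 1 -> P t = x /\ Q t = y.
  move=> x0 tE xy; have x_0 : x != 0 by rewrite gt_eqF.
  suff Px : P t = x by rewrite /Q Px tE divfK.
  rewrite /P (_ : 1 + tau t ^+ 2 = (x^-1) ^+ 2); last first.
    rewrite tE; transitivity ((x ^+ 2 + y ^+ 2) / x ^+ 2); first by field.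
    by rewrite xy mul1r exprVn.
  by rewrite sqrtr_sqr gtr0_norm ?invr_gt0// invrK.
have kE : (m.-1)%:R = M - 1 :> R by rewrite -[m in RHS](ltn_predK m2) -natr1 addrK.
exists F; split=> //.
- have a0 : al 0 = pi / 2 by rewrite /al subr0 mulr1.
  have c0 : c 0 = 0 by rewrite /c a0 cos_pihalf.
  have S0 : S 0 = 1 by rewrite /S a0 sin_pihalf.
  have n0 : n 0 = 1 by rewrite /n c0 S0 expr0n mulr0 add0r expr1n sqrtr1.
  have [P0 Q0] : P 0 = s /\ Q 0 = sg.
    apply: PQval => //; rewrite /tau sE; field.
    by rewrite M_0 gt_eqF.
  apply/funext => p; apply/rowP => j; rewrite /F /twisted_torus c0 S0 n0 P0 Q0 [LHS]mxE [RHS]mxE.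
  (* With shear m - 1 the phase of the second circle is m v plus the tube angle u - v, and the
     addition formulas apply. *)
  have eX : 1 * p.1 + (m.-1)%:R * p.2 = (0 * p.1 + M * p.2) + (1 * p.1 + -1 * p.2).
    by rewrite kE; ring.
  have cX : lcos 1 (m.-1)%:R p = lcos 0 M p * lcos 1 (-1) p - lsin 0 M p * lsin 1 (-1) p.
    by rewrite /lcos eX cosD.
  have sX : lsin 1 (m.-1)%:R p = lsin 0 M p * lcos 1 (-1) p + lcos 0 M p * lsin 1 (-1) p.
    by rewrite /lsin eX sinD.
  have [->|->|->|->] := ord4P j => /=; rewrite ?cX ?sX.
  + by field.
  + by field.
  + by field.
  + by field.
- have a1 : al 1 = 0 by rewrite /al subrr mulr0.
  have c1 : c 1 = 1 by rewrite /c a1 cos0.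
  have S1 : S 1 = 0 by rewrite /S a1 sin0.
  have n1 : n 1 = M by rewrite /n c1 S1 expr0n expr1n mulr1 addr0 sqrtr_sqr gtr0_norm.
  have [P1 Q1] : P 1 = rho /\ Q 1 = r.
    apply: PQval; [by rewrite rhoE mulr_gt0| |by rewrite addrC].
    by rewrite /tau rhoE; field; rewrite M_0 gt_eqF.
  rewrite (torus_mrE _ _ _ (ltW M1) r0 rhoE rrho).
  apply/funext => p; apply/rowP => j; rewrite /F c1 S1 n1 P1 Q1 [LHS]mxE [RHS]mxE.
  (* At this end the phase u of the first circle is v plus the tube angle u - v. *)
  have eX : 1 * p.1 + 0 * p.2 = (0 * p.1 + 1 * p.2) + (1 * p.1 + -1 * p.2) by ring.
  have cX : lcos 1 0 p = lcos 0 1 p * lcos 1 (-1) p - lsin 0 1 p * lsin 1 (-1) p.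
    by rewrite /lcos eX cosD.
  have sX : lsin 1 0 p = lsin 0 1 p * lcos 1 (-1) p + lcos 0 1 p * lsin 1 (-1) p.
    by rewrite /lsin eX sinD.
  have [->|->|->|->] := ord4P j => /=; rewrite ?cX ?sX.
  + by field.
  + by field.
  + by field.
  + by field.
Qed.

End Homotopy.

(** * Choice of the radii and comparison of the energies *)

Theorem corollary1p2 (R : realType) (m : nat) (hm : (3 <= m)%N) :
  exists r : R, 0 < r < 1 /\
  exists f : R * R -> 'rV[R]_4,
    [/\ conf_willmoreS3 f,
        reg_homotopicS3 f (torus_mr m r),
        same_conf_class f (torus_mr m r),
        ((8 * pi)%:E <= willmore f)%E
      & (willmore f < willmore (torus_mr m r))%E].
Proof.
pose M : R := m%:R.
have M3 : 3 <= M by rewrite ler_nat.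
have M0 : 0 < M by exact: lt_le_trans M3.
have M2 : 9 <= M ^+ 2 by rewrite (_ : 9 = 3 ^+ 2) ?lerXn2r ?nnegrE ?(ltW M0)// -natrX.
have inv_sqrt (x : R) : 0 < x -> 0 < (Num.sqrt x)^-1 /\ (Num.sqrt x)^-1 ^+ 2 = x^-1.
  by move=> x0; rewrite invr_gt0 sqrtr_gt0 x0 exprVn sqr_sqrtr// ltW.
(* The radii solve [r ^+ 2 + (M * r) ^+ 2 = 1] and [(M ^+ 2 * sg) ^+ 2 + sg ^+ 2 = 1], which puts
   both tori on the unit sphere and in the class [(0, M ^+ 2)]. *)
have [r0 r2] : 0 < (Num.sqrt (1 + M ^+ 2))^-1 /\ (Num.sqrt (1 + M ^+ 2))^-1 ^+ 2 = (1 + M ^+ 2)^-1.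
  by apply: inv_sqrt; rewrite ltr_pwDl ?sqr_ge0.
have [sg0 sg2] : 0 < (Num.sqrt (1 + M ^+ 4))^-1 /\ (Num.sqrt (1 + M ^+ 4))^-1 ^+ 2 = (1 + M ^+ 4)^-1.
  by apply: inv_sqrt; rewrite ltr_pwDl ?exprn_ge0 ?ltW.
set r := (Num.sqrt (1 + M ^+ 2))^-1 in r0 r2.
set sg := (Num.sqrt (1 + M ^+ 4))^-1 in sg0 sg2.
have M2_0 : 1 + M ^+ 2 != 0 by rewrite gt_eqF// ltr_pwDl ?sqr_ge0.
have M4_0 : 1 + M ^+ 4 != 0 by rewrite gt_eqF// ltr_pwDl ?exprn_ge0 ?ltW.
have M_0 : M != 0 by rewrite gt_eqF.
have rrho : r ^+ 2 + (M * r) ^+ 2 = 1 by rewrite exprMn r2; field.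
have s0 : 0 < M ^+ 2 * sg by rewrite mulr_gt0// exprn_gt0.
have ssg : (M ^+ 2 * sg) ^+ 2 + sg ^+ 2 = 1 by rewrite exprMn sg2; field.
have M1 : 1 <= M by lra.
have sgs : sg <= M ^+ 2 * sg by rewrite ler_peMl ?(ltW sg0)//; lra.
have Ws : willmore (twisted_torus (M ^+ 2 * sg) sg m.-1) = (pi ^+ 2 * (M ^+ 2 + M ^- 2))%:E.
  rewrite twisted_torus_willmore//; congr EFin.
  rewrite -mulrA -expr2 sg2; field.
  by rewrite M_0.
have Wm : willmore (torus_mr m r) = (pi ^+ 2 * (1 + M ^+ 2))%:E.
  by rewrite (torus_mr_willmore _ _ _ M1 r0 erefl rrho) r2 invrK.
exists r; split.
  rewrite r0 /= -(@ltr_pXn2r _ 2)// ?nnegrE ?ler01 ?(ltW r0)// expr1n -[ltRHS]rrho ltrDl.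
  by rewrite exprn_gt0// mulr_gt0.
exists (twisted_torus (M ^+ 2 * sg) sg m.-1); split.
- exact: twisted_torus_conf_willmoreS3.
- exact: (twisted_torus_torus_mr_homotopic m (ltnW hm) _ _ _ (M * r) s0 sg0 erefl ssg r0 erefl rrho).
- exists (0, M ^+ 2); split.
    have := twisted_torus_conf_class _ _ m.-1 sg0 sgs.
    by rewrite mulfK// gt_eqF.
  exact: (torus_mr_conf_class _ _ _ M1 r0 erefl rrho).
(* Since [M ^+ 2] is at least 9, it is enough that [8 * pi <= pi ^+ 2 * 9], which already follows
   from [2 <= pi]. *)
- rewrite Ws lee_fin; have p2 := @pi_ge2 R.
  have i0 : 0 <= M ^- 2 by rewrite invr_ge0 sqr_ge0.
  rewrite (@le_trans _ _ (pi ^+ 2 * 9))//; first by nra.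
  by rewrite ler_wpM2l ?sqr_ge0//; lra.
(* Once [M ^+ 2] is cancelled, the comparison reads [M ^- 2 < 1]. *)
- rewrite Ws Wm lte_fin ltr_pM2l ?exprn_gt0 ?pi_gt0// addrC ltrD2r.
  by rewrite invf_lt1 ?exprn_gt0//; lra.
Qed.
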